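(* Let $(\rho_\circ,\rho_\bullet)$ be a subcritical pair of offspring distributions on $\mathbb Z_+$ such that $\rho_\circ$ is geometric with parameter $1-p\in(0,1)$ (i.e. $\rho_\circ(k)=(1-p)p^k$ for $k\ge0$) and $\rho_\bullet$ has no exponential moment. For every $k\ge1$ (such that the conditioning is non-degenerate), let $T_k^{\circ,\bullet}$ be a random tree with law $\mathsf{GW}_{\rho_\circ,\rho_\bullet}^{(k)}$. Then, in distribution for the local-$*$ topology, $$T_k^{\circ,\bullet}\xrightarrow[k\to\infty]{(d)}\mathbf T_\infty^{\circ,\bullet}(\rho_\circ,\rho_\bullet).$$
   Context: Plane trees are in Ulam–Harris notation; $k_u$ is the number of children of a vertex $u$, $|u|$ its height. Vertices at even height (including the root) are white, those at odd height black; $\mathbf t_\circ,\mathbf t_\bullet$ are the corresponding sets. For a pair $(\rho_\circ,\rho_\bullet)$ of probability measures on $\mathbb Z_+$ with means $m_\circ,m_\bullet$, $\mathsf{GW}_{\rho_\circ,\rho_\bullet}(\mathbf t)=\prod_{u\in\mathbf t_\circ}\rho_\circ(k_u)\prod_{u\in\mathbf t_\bullet}\rho_\bullet(k_u)$ on finite plane trees, and $\mathsf{GW}^{(k)}_{\rho_\circ,\rho_\bullet}$ is this law conditioned on the tree having $k$ vertices; limits in $k$ are along the values of $k$ for which the conditioning event has positive probability. The pair is subcritical if $m_\circ m_\bullet<1$. $\rho$ has no exponential moment if $\sum_k e^{sk}\rho(k)=\infty$ for all $s>0$. **Local-$*$ topology.** For a vertex $u$, $-u1,-u2,\dots,-uk_u$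 denote its children listed from the last one: $-uj=u(k_u+1-j)$. For $R\ge0$, the left-right ball $\mathbf B_R^{\leftrightarrow}(\mathbf t)$ is the subtree defined as follows: the root belongs to it, and a vertex $u$ with parent $\hat u$ belongs to it iff $\hat u$ does, $|u|\le 2R$, and $u\in\{\hat u1,\dots,\hat uR\}\cup\{-\hat u1,\dots,-\hat uR\}$. The local-$*$ distance is $d^*_{\rm loc}(\mathbf t,\mathbf t')=1/(1+\sup\{R\ge0:\mathbf B_R^{\leftrightarrow}(\mathbf t)=\mathbf B_R^{\leftrightarrow}(\mathbf t')\})$ on finite plane trees; $\mathcal T$ is the completion (it contains trees with vertices of infinite degree, whose children are ordered as $u1,u2,\dots$ from the left and $-u1,-u2,\dots$ from the right). **The tree $\mathbf T^{\circ,\bullet}_\infty(\rho_\circ,\rho_\bullet)$ (subcritical case).** It has a.s. a unique spine started at the root, with $2L'$ vertices, where $P(L'=k)=(1-m_\circ m_\bullet)(m_\circ m_\bullet)^{k-1}$, $k\ge1$. The topmost (black) vertex $u_\infty$ of the spine has infinite degree (infinitely many children, ordered as $u_\infty1,u_\infty2,\dots$ from the left and $-u_\infty1,-u_\infty2,\dots$ from the right); the other spine vertices have offspring distribution $\bar\rho_\circ$ if white and $\bar\rho_\bullet$ if black, where $\bar\rho(k)=k\rho(k)/m_\rho$ for a probability measure $\rho$ on $\mathbb Z_+$ with mean $m_\rho$, with one child chosen uniformly among the offspring belonging to the spine. Outside the spine, white (resp. black) vertices have offspring distribution $\rho_\circ$ (resp. $\rho_\bullet$). All numbers of offspring are independent.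 *)

(* Defs.v *)
From HB Require Import structures.
From mathcomp Require Import all_boot all_order all_algebra.
From mathcomp Require Import all_classical all_reals all_analysis.
From mathcomp Require Import zify.

Set Implicit Arguments.
Unset Strict Implicit.
Unset Printing Implicit Defensive.
Import Order.TTheory GRing.Theory Num.Theory.
Import numFieldNormedType.Exports.

Local Open Scope classical_set_scope.
Local Open Scope ring_scope.

Inductive plane_tree := Node of seq plane_tree.

HB.instance Definition _ := gen_eqMixin plane_tree.
HB.instance Definition _ := gen_choiceMixin plane_tree.

Definition leaf : plane_tree := Node [::].
Definition children (t : plane_tree) : seq plane_tree := let: Node ts := t in ts.

(* Ulam-Harris addresses have labels in [int]: label [j >= 1] leads to the child
   [uj], label [-j] to the child [-uj]; in a vertex of finite degree only the
   labels [1, ..., k_u] are used. *)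
Definition address := seq int.

Fixpoint vertices (t : plane_tree) : seq address :=
  let: Node ts := t in
  [::] :: flatten [seq [seq Posz jv.1 :: u | u <- jv.2]
                  | jv <- zip (iota 1%N (size ts)) (map vertices ts)].

(* 0 if [u] is not a vertex of [t]. *)
Fixpoint nb_children (t : plane_tree) (u : address) : nat :=
  match u with
  | [::] => size (children t)
  | Posz j.+1 :: u' => nb_children (nth leaf (children t) j) u'
  | _ => 0%N
  end.

(* A vertex has degree [Some k], or [None] if it is infinite, in which case its
   children are indexed by all nonzero labels. *)
Definition child_label (k : option nat) (l : int) : bool :=
  if k is Some n then (0 < l) && (l <= Posz n) else l != 0.

Definition in_tree (k : address -> option nat) (u : address) : bool :=
  all (fun i => child_label (k (take i u)) (nth 0 u i)) (iota 0%N (size u)).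

(* The value [Some 0] off the tree makes the degree function canonical. *)
Record lr_tree := LRTree {
  degree :> address -> option nat ;
  degree_out : forall u, ~~ in_tree degree u -> degree u = Some 0%N }.

HB.instance Definition _ := gen_eqMixin lr_tree.
HB.instance Definition _ := gen_choiceMixin lr_tree.

Definition prune (k : address -> option nat) (u : address) : option nat :=
  if in_tree k u then k u else Some 0%N.

Lemma in_tree_rcons k u l :
  in_tree k (rcons u l) = in_tree k u && child_label (k u) l.
Proof.
rewrite /in_tree size_rcons -addn1 iotaD all_cat /= add0n andbT.
rewrite nth_rcons ltnn eqxx -cats1 take_size_cat //; congr (_ && _).
apply: eq_in_all => i; rewrite mem_iota add0n => /andP[_ ilt].
by rewrite takel_cat ?(ltnW ilt)// nth_cat ilt.
Qed.

Lemma in_tree_prune k u : in_tree (prune k) u = in_tree k u.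
Proof.
elim/last_ind: u => // u l IH; rewrite !in_tree_rcons IH /prune.
by case: (in_tree k u).
Qed.

Lemma prune_out k u : ~~ in_tree (prune k) u -> prune k u = Some 0%N.
Proof. by rewrite in_tree_prune /prune => /negbTE ->. Qed.

Definition lr_tree_of (k : address -> option nat) : lr_tree := LRTree (@prune_out k).

Definition embed (t : plane_tree) : lr_tree :=
  lr_tree_of (fun u => Some (nb_children t u)).

(* The labels, in planar order, of the children [u1, ..., uR, -uR, ..., -u1] of a
   vertex of degree [k]; recall that [-uj = u(k+1-j)] if [k] is finite. *)
Definition ball_labels (r : nat) (k : option nat) : seq int :=
  match k with
  | Some n => [seq Posz j | j <- iota 1%N n & (j <= r) || (n.+1 <= j + r)]%N
  | None => [seq Posz j | j <- iota 1%N r] ++ [seq - Posz j | j <- rev (iota 1%N r)]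
  end.

Fixpoint lr_ball_at (r h : nat) (t : lr_tree) (u : address) : plane_tree :=
  if h is h'.+1 then
    Node [seq lr_ball_at r h' t (rcons u l) | l <- ball_labels r (t u)]
  else leaf.

Definition lr_ball (r : nat) (t : lr_tree) : plane_tree :=
  lr_ball_at r (2 * r)%N t [::].

(* The inverse is taken in [\bar R], so that the distance is 0 when the supremum
   is infinite. *)
Definition dstar (R : realType) (t t' : lr_tree) : R :=
  fine ((1 + ereal_sup [set r%:R%:E | r in [set r | lr_ball r t = lr_ball r t']])^-1)%E.

Definition keep_lr T (r : nat) (s : seq T) : seq T :=
  if (size s <= 2 * r)%N then s else take r s ++ drop (size s - r) s.

Lemma keep_lr_map T T' (f : T -> T') r s : keep_lr r (map f s) = map f (keep_lr r s).
Proof. by rewrite /keep_lr size_map; case: ifP => // _; rewrite map_cat map_take map_drop. Qed.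

Lemma size_keep_lr T r (s : seq T) : size (keep_lr r s) = minn (size s) (2 * r)%N.
Proof.
rewrite /keep_lr; case: leqP => // lt.
have rs : (r <= size s)%N by rewrite (leq_trans _ (ltnW lt))// leq_pmull.
by rewrite size_cat size_takel// size_drop subKn// addnn -mul2n.
Qed.

Lemma keep_lrK T r r' (s : seq T) : (r <= r')%N -> keep_lr r (keep_lr r' s) = keep_lr r s.
Proof.
move=> rr'; have [le|lt] := leqP (size s) (2 * r'); first by rewrite [keep_lr r' s]/keep_lr le.
have := size_keep_lr r' s; rewrite (minn_idPr (ltnW lt)).
rewrite {1}/keep_lr leqNgt lt/= => sz.
rewrite [keep_lr r' s]/keep_lr [(size s <= _)%N]leqNgt lt/= /keep_lr sz.
rewrite [(size s <= _)%N]leqNgt (leq_ltn_trans _ lt) ?leq_mul2l//=.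
case: leqP => [le|lt']; first by have -> : r' = r by lia.
have szt : size (take r' s) = r' by rewrite size_takel//; move: lt; lia.
congr (_ ++ _); first by rewrite takel_cat ?szt// take_takel.
rewrite drop_cat szt ifN; last by lia.
by rewrite drop_drop; congr drop; move: rr' lt lt'; lia.
Qed.

Lemma ball_labels_keep r r' k : (r <= r')%N ->
  keep_lr r (ball_labels r' k) = ball_labels r k.
Proof.
have fin n q : ball_labels q (Some n) = keep_lr q [seq Posz j | j <- iota 1%N n].
  rewrite /= keep_lr_map; congr map; rewrite /keep_lr size_iota.
  case: leqP => h.
    by apply/all_filterP/allP => j; rewrite mem_iota; lia.
  have -> : iota 1%N n = iota 1 q ++ iota q.+1 (n - q - q) ++ iota (n - q).+1 q.
    have -> : (n - q).+1 = (q.+1 + (n - q - q))%N by lia.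
    by rewrite -iotaD -add1n -iotaD; congr iota; lia.
  rewrite !filter_cat take_size_cat ?size_iota//.
  rewrite [X in drop _ X]catA drop_size_cat; last by rewrite size_cat !size_iota; lia.
  have -> : [seq j <- iota q.+1 (n - q - q) | (j <= q)%N || (n < j + q)%N] = [::].
    by apply/eqP; rewrite -(negbK (_ == _)) -has_filter; apply/negP => /hasP[j]; rewrite mem_iota; lia.
  by congr cat; apply/all_filterP/allP => j; rewrite mem_iota; lia.
move=> rr'; case: k => [n|]; first by rewrite !fin keep_lrK.
rewrite /= /keep_lr size_cat !size_map size_rev !size_iota.
case: leqP => h; first by have -> : r' = r by lia.
rewrite takel_cat ?size_map ?size_iota// -map_take take_iota (minn_idPl rr').
rewrite drop_cat size_map size_iota ifN; last by lia.
rewrite -map_drop; congr (_ ++ map _ _).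
rewrite -[X in iota _ X](subnKC rr') iotaD rev_cat drop_size_cat// size_rev size_iota; lia.
Qed.

Fixpoint keep_ball (r h : nat) (t : plane_tree) : plane_tree :=
  if h is h'.+1 then Node [seq keep_ball r h' t' | t' <- keep_lr r (children t)]
  else leaf.

Lemma keep_lr_ball r r' h h' t u : (r <= r')%N -> (h <= h')%N ->
  keep_ball r h (lr_ball_at r' h' t u) = lr_ball_at r h t u.
Proof.
move=> rr'; elim: h h' u => [//|h IH] [//|h'] u hh' /=.
rewrite keep_lr_map (ball_labels_keep _ rr') -map_comp; congr Node.
by apply: eq_map => l /=; rewrite IH.
Qed.

Lemma lr_ball_le r r' t t' : (r <= r')%N ->
  lr_ball r' t = lr_ball r' t' -> lr_ball r t = lr_ball r t'.
Proof.
by move=> rr' /(congr1 (keep_ball r (2 * r)%N)); rewrite !keep_lr_ball// leq_mul2l.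
Qed.

Lemma size_ball_labels r k :
  size (ball_labels r k) = if k is Some n then minn n (2 * r)%N else (2 * r)%N.
Proof.
case: k => [n|]; last first.
  by rewrite /= size_cat !size_map size_rev size_iota addnn mul2n.
have [nr|rn] := leqP n (2 * r).
  rewrite /= size_map; set s := seq.filter _ _.
  have -> : s = iota 1%N n by apply/all_filterP/allP => j; rewrite mem_iota; lia.
  by rewrite size_iota.
have -> : ball_labels r (Some n) = keep_lr r (ball_labels n (Some n)).
  by rewrite ball_labels_keep//; lia.
rewrite size_keep_lr /= size_map; set s := seq.filter _ _.
have -> : s = iota 1%N n by apply/all_filterP/allP => j; rewrite mem_iota; lia.
by rewrite size_iota; lia.
Qed.

Lemma mem_ball_labels r k l :
  child_label k l -> (`|l| <= r)%N -> l \in ball_labels r k.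
Proof.
case: k => [n|] /= kl lr.
  case: l kl lr => [j|//] /= kl lr; rewrite mem_map; last by move=> ? ? [].
  by rewrite mem_filter mem_iota; lia.
rewrite mem_cat; case: l kl lr => [j|j] kl lr.
  by rewrite mem_map ?mem_iota; [lia|move=> ? ? []].
by rewrite NegzE orbC (mem_map (f := fun j : nat => - Posz j)) ?mem_rev ?mem_iota; [lia|move=> ? ? /oppr_inj[]].
Qed.

Lemma lr_ball_inj t t' : (forall r, lr_ball r t = lr_ball r t') -> t = t'.
Proof.
move=> tt'.
pose E (u : address) := exists r0, forall r, (r0 <= r)%N ->
  lr_ball_at r (2 * r - size u)%N t u = lr_ball_at r (2 * r - size u)%N t' u.
have E0 : E [::] by exists 0%N => r _; rewrite subn0; exact: tt'.
have Edeg u : E u -> t u = t' u.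
  move=> [r0 h].
  pose N := ((odflt 0 (t u)) + (odflt 0 (t' u)) + r0 + size u)%N.+1.
  have := h N ltac:(lia); have -> : (2 * N - size u = (2 * N - size u).-1.+1)%N by lia.
  move=> [/(congr1 size)]; rewrite !size_map !size_ball_labels.
  rewrite {}/N; case: (t u) => [n|]; case: (t' u) => [n'|] //= e; last lia; last lia.
  by congr Some; lia.
have Estep u l : E u -> child_label (t u) l -> E (rcons u l).
  move=> Eu lu; have tu := Edeg _ Eu; have [r0 h] := Eu.
  exists ((maxn r0 `|l|) + size u).+1 => r rl.
  have := h r ltac:(lia); have -> : (2 * r - size u = (2 * r - size (rcons u l)).+1)%N.
    by rewrite size_rcons; lia.
  rewrite /= -tu => -[] /(eq_in_map _ _ _).2; apply.
  by apply: mem_ball_labels; [|lia].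
have main u : in_tree t u -> E u /\ in_tree t' u.
  elim/last_ind: u => [//|u l IH]; rewrite !in_tree_rcons => /andP[/IH[Eu ->] lu].
  by rewrite -(Edeg _ Eu) lu; split=> //; exact: Estep.
have main' u : in_tree t' u -> E u /\ in_tree t u.
  elim/last_ind: u => [//|u l IH]; rewrite !in_tree_rcons => /andP[/IH[Eu ->]].
  by rewrite -(Edeg _ Eu) => lu; rewrite lu; split=> //; exact: Estep.
have eqd : degree t = degree t'.
  apply/funext => u; case: (boolP (in_tree t u)) => [/main[/Edeg//]|nt].
  rewrite (degree_out nt) degree_out//; apply: contra nt => /main' [] //.
case: t t' eqd {tt' E E0 Edeg Estep main main'} => [k kP] [k' kP'] /= kk'.
by subst k'; congr LRTree; exact: Prop_irrelevance.
Qed.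

Section dstar_metric.
Variable R : realType.
Implicit Types t : lr_tree.
Local Notation dstar := (@dstar R).

Let S t t' := ereal_sup [set (r%:R%:E : \bar R) | r in [set r | lr_ball r t = lr_ball r t']].

Let S_ge t t' r : lr_ball r t = lr_ball r t' -> (r%:R%:E <= S t t')%E.
Proof. by move=> e; apply: ereal_sup_ubound; exists r. Qed.

Let S_ge0 t t' : (0%:E <= S t t')%E.
Proof. exact: (@S_ge _ _ 0). Qed.

Lemma dstar_ge0 t t' : 0 <= dstar t t'.
Proof. by rewrite fine_ge0// inve_ge0 adde_ge0//; exact: S_ge0. Qed.

Lemma dstar_le t t' r : lr_ball r t = lr_ball r t' -> dstar t t' <= r.+1%:R^-1.
Proof.
move/S_ge => h; rewrite /dstar -/(S t t'); case: (S t t') (S_ge0 t t') h => [s||] //=.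
  rewrite !lee_fin => s0 rs; rewrite inver ifF/=; last by apply/negbTE; rewrite gt_eqF// ltr_pwDl.
  by rewrite lef_pV2 ?posrE ?ltr_pwDl// -natr1 [1 + s]addrC lerD2r.
Qed.

Lemma dstar_ge t t' r : lr_ball r.+1 t <> lr_ball r.+1 t' -> r.+1%:R^-1 <= dstar t t'.
Proof.
move=> h; have Sr : (S t t' <= r%:R%:E)%E.
  apply: ge_ereal_sup => _ [q /= e <-]; rewrite lee_fin ler_nat leqNgt.
  by apply/negP => rq; apply: h; exact: lr_ball_le e.
rewrite /dstar -/(S t t'); case: (S t t') (S_ge0 t t') Sr => [s||] //=.
rewrite !lee_fin => s0 sr; rewrite inver ifF/=; last by apply/negbTE; rewrite gt_eqF// ltr_pwDl.
by rewrite lef_pV2 ?posrE ?ltr_pwDl// -natr1 [1 + s]addrC lerD2r.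
Qed.

Lemma dstar_lt t t' r : dstar t t' < r.+1%:R^-1 <-> lr_ball r.+1 t = lr_ball r.+1 t'.
Proof.
split=> [h|/dstar_le h]; last first.
  by rewrite (le_lt_trans h)// ltf_pV2 ?posrE ?ltr0n// ltr_nat.
by apply: contrapT => /dstar_ge; rewrite leNgt h.
Qed.

Lemma dstarxx t : dstar t t = 0.
Proof.
apply/eqP; rewrite eq_le dstar_ge0 andbT leNgt; apply/negP => d0.
have [n] := @ltr_add_invr R 0 _ d0; rewrite add0r => nd.
by have := lt_le_trans nd (@dstar_le t t n erefl); rewrite ltxx.
Qed.

Lemma dstar_eq0 t t' : dstar t t' = 0 -> t = t'.
Proof.
move=> d0; apply: lr_ball_inj => r; apply: (@lr_ball_le r r.+1) => //.
by apply/dstar_lt; rewrite d0 invr_gt0.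
Qed.

Lemma dstar_sym t t' : dstar t t' = dstar t' t.
Proof.
by rewrite /dstar; congr (fine (_ + ereal_sup _)^-1)%E; apply/seteqP; split=> _ [r /= e <-]; exists r.
Qed.

Lemma dstar_ultra t2 t1 t3 : dstar t1 t3 <= Num.max (dstar t1 t2) (dstar t2 t3).
Proof.
rewrite leNgt gt_max; apply/negP => /andP[d12 d23].
have [e|ne] := pselect (forall r, lr_ball r t1 = lr_ball r t3).
  by have := d12; rewrite (lr_ball_inj e) dstarxx ltNge dstar_ge0.
have ex : exists r, `[< lr_ball r t1 <> lr_ball r t3 >].
  by move/existsNP: ne => [r h]; exists r; apply/asboolP.
have [[|r] /asboolP h min] := ex_minnP ex; first by [].
have /dstar_le d13 : lr_ball r t1 = lr_ball r t3.
  by apply: contrapT => /asboolP /min; rewrite ltnn.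
apply: h; transitivity (lr_ball r.+1 t2); apply/dstar_lt; exact: lt_le_trans d13.
Qed.

Lemma dstar_triangle t2 t1 t3 : dstar t1 t3 <= dstar t1 t2 + dstar t2 t3.
Proof.
by apply: (le_trans (dstar_ultra t2 t1 t3)); rewrite ge_max lerDl lerDr !dstar_ge0.
Qed.

End dstar_metric.

(* The completion of the set of finite plane trees for [dstar]: [lr_ball_dense]
   gives the density of the finite trees, [localstar_cvg] the completeness. The
   parameter [R] is where the distance takes its values. *)
Definition localstar (R : realType) := lr_tree.

HB.instance Definition _ (R : realType) := Choice.on (localstar R).
HB.instance Definition _ (R : realType) := isPointed.Build (localstar R) (embed leaf).
HB.instance Definition _ (R : realType) := @isMetric.Build R (localstar R)
  (@dstar R) (@dstarxx R) (@dstar_eq0 R) (@dstar_sym R) (@dstar_triangle R).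

Lemma ball_labels_fin r n : ball_labels r (Some n) = keep_lr r [seq Posz j | j <- iota 1%N n].
Proof.
case: (leqP r n) => rn; last first.
  rewrite /keep_lr size_map size_iota ifT; last by lia.
  by congr map; apply/all_filterP/allP => j; rewrite mem_iota; lia.
rewrite -(ball_labels_keep _ rn); congr keep_lr.
by congr map; apply/all_filterP/allP => j; rewrite mem_iota; lia.
Qed.

Definition subtree (t : plane_tree) (u : address) : plane_tree :=
  foldl (fun t' l => nth leaf (children t') `|l|.-1) t u.

Lemma nb_children_subtree t u : in_tree (embed t) u ->
  nb_children t u = size (children (subtree t u)).
Proof.
rewrite in_tree_prune.
move=> tu; have : all (fun l => 0 < l) u.
  elim/last_ind: u tu => // u l IH; rewrite in_tree_rcons all_rcons.
  by case/andP => /IH -> /= /andP[->].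
elim: u t {tu} => [//|l u IH] t /= /andP[l0 /IH h].
by case: l l0 => [[|j]|j] //= _; rewrite h.
Qed.

Lemma lr_ball_embed r t : lr_ball r (embed t) = keep_ball r (2 * r)%N t.
Proof.
rewrite /lr_ball; set h := (2 * r)%N; rewrite -[t in RHS]/(subtree t [::]).
have : in_tree (embed t) [::] by [].
elim: h [::] => [//|h IH] u tu /=.
have -> : prune (fun u => Some (nb_children t u)) u = Some (size (children (subtree t u))).
  by move: (tu); rewrite /prune in_tree_prune => ->; rewrite nb_children_subtree.
rewrite ball_labels_fin; set ts := children _.
have -> : ts = [seq nth leaf ts `|l|.-1 | l <- [seq Posz j | j <- iota 1%N (size ts)]].
  by rewrite -map_comp (iotaDl 1 0) -map_comp -[LHS](mkseq_nth leaf).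
rewrite !size_map size_iota (keep_lr_map (fun l => nth leaf ts `|l|.-1)) -map_comp; congr Node.
apply: (eq_in_map _ _ _).1 => l lin /=; rewrite IH; first by rewrite /subtree foldl_rcons.
rewrite in_tree_rcons tu /=.
have {lin} : l \in [seq Posz j | j <- iota 1%N (size ts)].
  by move: lin; rewrite /keep_lr; case: ifP => // _; rewrite mem_cat => /orP[/mem_take|/mem_drop].
case/mapP => j; rewrite mem_iota => jt ->.
by move: (tu); rewrite /prune in_tree_prune => ->; rewrite nb_children_subtree//=.
Qed.

Lemma lr_ball_dense r t : lr_ball r (embed (lr_ball r t)) = lr_ball r t.
Proof. by rewrite lr_ball_embed keep_lr_ball. Qed.

(* The child with label [l] of a vertex of degree [k], counted from the left if
   [k] is finite. *)
Definition norm_label (k : option nat) (l : int) : int :=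
  if k is Some n then if l < 0 then l + Posz n.+1 else l else l.

Definition norm_address (t : lr_tree) (u : address) : address :=
  foldl (fun v l => rcons v (norm_label (t v) l)) [::] u.

Lemma norm_address_rcons t u l : norm_address t (rcons u l) =
  rcons (norm_address t u) (norm_label (t (norm_address t u)) l).
Proof. by rewrite /norm_address foldl_rcons. Qed.

Definition label_pos (sz : nat) (l : int) : nat :=
  match l with Posz j => j.-1 | Negz j => sz - j.+1 end.

Lemma nth_ball_labels r k l (sz := size (ball_labels r k)) :
  l != 0 -> (`|l| <= r)%N -> (`|l| <= sz)%N ->
  (label_pos sz l < sz)%N /\ nth 0 (ball_labels r k) (label_pos sz l) = norm_label k l.
Proof.
move=> l0 lr lsz; split; first by case: l l0 lr lsz => -[|j] //=; lia.
rewrite /sz; case: k @sz lsz => [n|] sz.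
  rewrite /sz size_ball_labels ball_labels_fin /keep_lr size_map size_iota => lsz.
  move: lsz; have [nr|nr] := leqP n (2 * r)%N => lsz.
    rewrite (nth_map 0%N) ?size_iota; last by case: l l0 lr lsz => -[|j] //=; lia.
    rewrite nth_iota; last by case: l l0 lr lsz => -[|j] //=; lia.
    by case: l l0 lr lsz => -[|j] //=; lia.
  rewrite nth_cat size_takel ?size_map ?size_iota; last by lia.
  case: l l0 lr lsz => [[|j]|j] //= _ lr lsz.
    rewrite ifT; last by lia.
    by rewrite nth_take ?(nth_map 0%N) ?size_iota ?nth_iota//; lia.
  rewrite ifF; last by lia.
  rewrite nth_drop (nth_map 0%N) ?size_iota; last by lia.
  by rewrite nth_iota; lia.
rewrite /sz size_ball_labels => lsz; rewrite /= nth_cat size_map size_iota.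
case: l l0 lr lsz => [[|j]|j] //= _ lr lsz.
  rewrite ifT; last by lia.
  by rewrite (nth_map 0%N) ?size_iota ?nth_iota//; lia.
rewrite ifF; last by lia.
rewrite (nth_map 0%N) ?size_rev ?size_iota; last by lia.
rewrite nth_rev ?size_iota ?nth_iota; lia.
Qed.

Lemma ball_labels_norm r k : size (ball_labels r k) = (2 * r)%N ->
  ball_labels r k = [seq norm_label k l | l <- ball_labels r None].
Proof.
move=> sz; apply: (@eq_from_nth _ 0); rewrite ?size_map sz ?size_ball_labels// => i ir.
rewrite (nth_map 0) ?size_ball_labels//.
have [ilr|rli] := ltnP i r.
  have := @nth_ball_labels r None (Posz i.+1) isT; have := @nth_ball_labels r k (Posz i.+1) isT.
  by rewrite sz size_ball_labels /= => /(_ ltac:(lia) ltac:(lia)) [_ ->] /(_ ltac:(lia) ltac:(lia)) [_ ->].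
pose j := (2 * r - i).-1.
have := @nth_ball_labels r None (Negz j) isT; have := @nth_ball_labels r k (Negz j) isT.
rewrite sz size_ball_labels /=; have -> : (2 * r - j.+1 = i)%N by rewrite /j; lia.
by move=> /(_ ltac:(lia) ltac:(lia)) [_ ->] /(_ ltac:(lia) ltac:(lia)) [_ ->].
Qed.

Section complete.
Variables (R : realType) (F : set_system (localstar R)).
Hypotheses (FF : ProperFilter F) (Fc : cauchy F).

Let ev_ball r : exists b : lr_tree, F [set t | lr_ball r t = lr_ball r b].
Proof.
have /(_ r.+1%:R^-1) [|b Fb] := (@cauchyP R (localstar R) F FF).1 Fc; first by rewrite invr_gt0.
exists b; apply: filterS Fb => t; rewrite ballEmdist /= => h.
by symmetry; apply: (@lr_ball_le r r.+1) => //; apply/(dstar_lt R).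
Qed.

Let b r : lr_tree := sval (cid (ev_ball r)).
Let bP r : F [set t | lr_ball r t = lr_ball r (b r)].
Proof. by rewrite /b; case: cid. Qed.

Let D (u : address) : option nat :=
  if pselect (exists n, F [set t : lr_tree | t (norm_address t u) = Some n]) is left e
  then Some (sval (cid e)) else None.

Let L := lr_tree_of D.

Let LE u : in_tree L u -> L u = D u.
Proof. by rewrite in_tree_prune /= /prune => ->. Qed.

Let D_fin u n : D u = Some n -> F [set t : lr_tree | t (norm_address t u) = Some n].
Proof. by rewrite /D; case: pselect => // e [<-]; case: cid. Qed.

Let D_inf u n : D u = None -> ~ F [set t : lr_tree | t (norm_address t u) = Some n].
Proof. by rewrite /D; case: pselect => // e _ Fn; apply: e; exists n. Qed.

Let same r := [set t : lr_tree | lr_ball r t = lr_ball r (b r)].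
Let C (u : address) := exists r0, forall r t, (r0 <= r)%N -> same r t ->
  lr_ball_at r (2 * r - size u) t (norm_address t u) =
  lr_ball_at r (2 * r - size u) (b r) (norm_address (b r) u).

Let C_size u : C u -> exists r0, forall r t, (r0 <= r)%N -> same r t ->
  size (ball_labels r (t (norm_address t u))) = size (ball_labels r (D u)).
Proof.
move=> [r0 h].
have key r t t' : (r0 + (size u).+1 <= r)%N -> same r t -> same r t' ->
    size (ball_labels r (t (norm_address t u))) = size (ball_labels r (t' (norm_address t' u))).
  move=> rr st st'; have := h r t ltac:(lia) st; rewrite -(h r t' ltac:(lia) st').
  have -> : (2 * r - size u = (2 * r - size u).-1.+1)%N by lia.
  by move=> [/(congr1 size)]; rewrite !size_map.
exists (r0 + (size u).+1)%N => r t rr st.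
case E : (D u) => [n|].
  have [t0 [st0 /= t0n]] := filter_ex (filterI (bP r) (D_fin E)).
  by rewrite (key r t t0)// t0n.
rewrite [in RHS]size_ball_labels; apply: contrapT => sz.
case tE : (t (norm_address t u)) sz => [n|]; last by rewrite size_ball_labels.
rewrite size_ball_labels => sz; have nr : (n < 2 * r)%N by lia.
apply: (D_inf (n := n) E); apply: filterS (bP r) => t' st' /=.
have := key r t t' rr st st'; rewrite tE !size_ball_labels.
by case: (t' _) => [n'|] e; [congr Some; lia|lia].
Qed.

Let C_in u : in_tree L u -> C u.
Proof.
elim/last_ind: u => [_|u l IH]; first by exists 0%N => r t _; rewrite subn0.
rewrite in_tree_rcons => /andP[uL]; rewrite LE// => lD.
have Cu := IH uL; have [r1 sz] := C_size Cu; have [r0 h] := Cu.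
exists (r0 + r1 + (size u) + `|l|).+1 => r t rr st; rewrite size_rcons.
have := h r t ltac:(lia) st.
have -> : (2 * r - size u = (2 * r - (size u).+1).+1)%N by lia.
move=> [] /= e; rewrite !norm_address_rcons.
have l0 : l != 0 by case: (D u) lD => [n|] //= /andP[+ _]; case: l {rr} => -[|].
have lsz : (`|l| <= size (ball_labels r (D u)))%N.
  rewrite size_ball_labels; case: (D u) lD => [n|] /= lD; last lia.
  by case: l lD l0 rr => j //= lD _ rr; lia.
have szt := sz r t ltac:(lia) st; have szb := sz r (b r) ltac:(lia) erefl.
have := @nth_ball_labels r (t (norm_address t u)) l l0 ltac:(lia); rewrite szt => /(_ lsz) [plt <-].
have := @nth_ball_labels r (b r (norm_address (b r) u)) l l0 ltac:(lia); rewrite szb => /(_ lsz) [_ <-].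
move/(congr1 (fun s => nth leaf s (label_pos (size (ball_labels r (D u))) l))): e.
by rewrite !(nth_map 0) ?szt ?szb.
Qed.

Let filter_seq (s : seq int) (P : int -> set lr_tree) :
  (forall l, l \in s -> F (P l)) -> F [set t | forall l, l \in s -> P l t].
Proof.
elim: s => [|l s IH] h; first by apply: filterS filterT => t _ l.
have Fl := h l (mem_head _ _).
have Fs := IH (fun l' ls => h l' (mem_behead (s := l :: s) ls)).
apply: filterS (filterI Fl Fs) => t [Pl Ps] l'; rewrite in_cons => /orP[/eqP->//|]; exact: Ps.
Qed.

Let ev_at r h u : in_tree L u ->
  F [set t | lr_ball_at r h t (norm_address t u) = lr_ball_at r h L u].
Proof.
elim: h u => [|h IH] u uL; first by apply: filterS filterT.
have lab : F [set t : lr_tree | ball_labels r (t (norm_address t u)) =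
    [seq norm_label (t (norm_address t u)) l | l <- ball_labels r (D u)]].
  case E : (D u) => [n|].
    apply: filterS (D_fin E) => t /= ->; rewrite -[LHS]map_id.
    apply: (eq_in_map _ _ _).1 => l; rewrite /= => /mapP[j _ ->] //.
  have [r0 sz] := C_size (C_in uL).
  apply: filterS (bP (maxn r0 r)) => t st /=; apply: ball_labels_norm.
  have := sz _ t (leq_maxl _ _) st; rewrite E !size_ball_labels.
  by case: (t _) => [n|] //; lia.
have ch : F [set t : lr_tree | forall l, l \in ball_labels r (D u) ->
    lr_ball_at r h t (norm_address t (rcons u l)) = lr_ball_at r h L (rcons u l)].
  apply: filter_seq => l lin; apply: IH; rewrite in_tree_rcons uL LE//=.
  move: lin; case: (D u) => [n|] /=.
    by move=> /mapP[j]; rewrite mem_filter mem_iota => + ->; lia.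
  rewrite mem_cat => /orP[/mapP[j]|/mapP[j]]; rewrite ?mem_rev mem_iota => + ->; lia.
apply: filterS (filterI lab ch) => t /= [tlab tch].
rewrite tlab -/L [prune D u]LE// -map_comp; congr Node.
apply: (eq_in_map _ _ _).1 => l lin /=.
by rewrite -tch// norm_address_rcons.
Qed.

Lemma localstar_cvg : cvg F.
Proof.
apply/cvg_ex; exists (L : localstar R).
apply/metricType_numDomainType.fcvgrPdist_lt => e e0.
have [n] := @ltr_add_invr R 0 _ e0; rewrite add0r => ne.
apply: filterS (@ev_at n (2 * n)%N [::] isT) => t /= h.
by apply: le_lt_trans ne; apply: dstar_le; symmetry.
Qed.
End complete.

HB.instance Definition _ (R : realType) :=
  Uniform_isComplete.Build (localstar R) (@localstar_cvg R).

Section offspring.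
Context {R : realType}.
Implicit Types rho : nat -> R.

Definition is_pmf rho : Prop :=
  (forall k, 0 <= rho k) /\ (\sum_(0 <= k <oo) (rho k)%:E = 1)%E.

Definition mean rho : \bar R := (\sum_(0 <= k <oo) (k%:R * rho k)%:E)%E.

Definition no_exponential_moment rho : Prop :=
  forall s : R, 0 < s -> (\sum_(0 <= k <oo) (expR (s * k%:R) * rho k)%:E = +oo)%E.

Definition subcritical rho_w rho_b : Prop := (mean rho_w * mean rho_b < 1)%E.

Definition size_biased rho (k : nat) : R := k%:R * rho k / fine (mean rho).

(* White vertices are those of even height. *)
Definition GW rho_w rho_b (t : plane_tree) : R :=
  (\prod_(u <- vertices t | ~~ odd (size u)) rho_w (nb_children t u)) *
  (\prod_(u <- vertices t | odd (size u)) rho_b (nb_children t u)).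

Definition nb_vertices (t : plane_tree) : nat := size (vertices t).

(* The probability that the tree has [k] vertices. *)
Definition GW_size rho_w rho_b (k : nat) : \bar R :=
  \esum_(t in [set t | nb_vertices t = k]) (GW rho_w rho_b t)%:E.

Definition GW_cond rho_w rho_b (k : nat) (t : plane_tree) : R :=
  if nb_vertices t == k then GW rho_w rho_b t / fine (GW_size rho_w rho_b k) else 0.

End offspring.

(* [X] is a discrete random variable with probability mass function [f]; [E] is
   countable in all uses. *)
Definition has_law d (Om : measurableType d) (R : realType) (P : probability Om R)
    (E : Type) (X : Om -> E) (f : E -> R) : Prop :=
  forall x, measurable (X @^-1` [set x]) /\ P (X @^-1` [set x]) = (f x)%:E.

Definition mutually_independent d (Om : measurableType d) (R : realType)
    (P : probability Om R) (I : eqType) (E : I -> Type) (X : forall i, Om -> E i) : Prop :=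
  forall (s : seq I) (A : forall i, set (E i)), uniq s ->
    P (\bigcap_(i in [set` s]) (X i @^-1` A i)) =
    (\prod_(i <- s) P (X i @^-1` A i))%E.

Definition cvg_in_distribution (R : realType) (M : topologicalType) (F : set_system nat)
    (dk : nat -> measure_display) (Omk : forall k, measurableType (dk k))
    (Pk : forall k, probability (Omk k) R) (Xk : forall k, Omk k -> M)
    (d : measure_display) (Om : measurableType d) (P : probability Om R)
    (X : Om -> M) : Prop :=
  forall f : M -> R, continuous f -> (exists C, forall x, `|f x| <= C) ->
    ('E_(Pk k)[f \o Xk k] @[k --> F] --> 'E_P[f \o X])%E.

(* The vertex at height [h] of the spine along which the vertex at height [i] has
   [(S i).1] children and is followed by the [(S i).2]-th one. *)
Definition spine (S : nat -> nat * nat) (h : nat) : address :=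
  [seq Posz (S i).2 | i <- iota 0%N h].

(* The tree whose spine has [2 * L] vertices, the topmost one with infinite degree,
   the others with degrees given by [S], and whose vertices off the spine have
   degrees given by [xi]. *)
Definition spine_tree (L : nat) (S : nat -> nat * nat) (xi : address -> nat) : lr_tree :=
  lr_tree_of (fun u => let h := size u in
    if (h < 2 * L)%N && (u == spine S h) then
      if h.+1 == (2 * L)%N then None else Some (S h).1
    else Some (xi u)).

Section limit_tree.
Context {R : realType} (rho_w rho_b : nat -> R).

Definition color_law (h : nat) : nat -> R := if odd h then rho_b else rho_w.

Definition spine_length_law (k : nat) : R :=
  let m := fine (mean rho_w * mean rho_b) in
  if k is k'.+1 then (1 - m) * m ^+ k' else 0.

(* The joint law of the size-biased degree of the spine vertex at height [h] and of
   the rank, uniform among its children, of the next spine vertex. *)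
Definition spine_step_law (h : nat) (x : nat * nat) : R :=
  if (1 <= x.2 <= x.1)%N then size_biased (color_law h) x.1 / x.1%:R else 0.

(* The index types of the independent variables [L], [S i] and [xi u]. *)
Definition source : eqType := option (nat + address)%type.

Definition source_type (i : source) : Type :=
  if i is Some (inl _) then (nat * nat)%type else nat.

Definition source_family (Om : Type) (L : Om -> nat) (S : nat -> Om -> nat * nat)
    (xi : address -> Om -> nat) (i : source) : Om -> source_type i :=
  match i with
  | None => L
  | Some (inl n) => S n
  | Some (inr u) => xi u
  end.

Definition limit_source d (Om : measurableType d) (P : probability Om R)
    (L : Om -> nat) (S : nat -> Om -> nat * nat) (xi : address -> Om -> nat) : Prop :=
  [/\ has_law P L spine_length_law,
      forall h, has_law P (S h) (spine_step_law h),
      forall u, has_law P (xi u) (color_law (size u)) &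
      mutually_independent P (source_family L S xi)].

End limit_tree.

Definition limit_tree (Om : Type) (L : Om -> nat) (S : nat -> Om -> nat * nat)
    (xi : address -> Om -> nat) (w : Om) : lr_tree :=
  spine_tree (L w) (fun h => S h w) (fun u => xi u w).

(* Main.v *)
(* Put [mu 0 = 1 - p] and [mu (k + 1) = p * rho_b k]. Since [rho_w] is geometric,
   the Janson-Stefansson bijection turns the mass of the white forests with [m]
   trees and [n] vertices into a first passage probability of the walk with steps
   [mu], equal to [m / n * P (S_n = n - m)] by the cycle lemma. As [mu] has mean
   less than 1 and no exponential moment, [P (S_n = n - 1)] decays
   subexponentially; large deviations for the number of steps equal to [k] then
   show that [P (S_(n-1) = x - k)] and [P (S_n = x)] are equivalent, and that,
   given [S_n = n - 1], the steps that do not stay bounded keep the part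
   [1 - mean mu] of the conditional mean of a step. Such a large step is the degree
   of [u_infty].

   A pattern fixes the spine, what hangs from it, and the first and last [r]
   subtrees at [u_infty]. By the above, the probability that the conditioned tree
   is a pattern filled with a large forest has a lower limit which is at least the
   probability of the pattern for the limit tree. Patterns are disjoint events of
   total mass 1 for the limit tree, and a pattern determines the ball of radius
   [r]; replacing a continuous function by its infimum over balls gives half of the
   convergence, and applying this to the opposite function the other half. *)

Require Import Defs.
From mathcomp Require Import all_boot all_order all_algebra.
From mathcomp Require Import all_classical all_reals all_analysis.
From mathcomp Require Import measurable_realfun zify ring lra.

Set Implicit Arguments.
Unset Strict Implicit.
Unset Printing Implicit Defensive.
Import Order.TTheory GRing.Theory Num.Theory.
Import numFieldNormedType.Exports.

Local Open Scope classical_set_scope.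
Local Open Scope ring_scope.

(** * Walks and forest masses *)

(** The tail of [rho_b] has no regularity, so the probability of one large degree has no usable
    asymptotics by itself; only a weighted sum over that degree has. When [k] trees with [N]
    vertices in all fill a pattern at [u_infty], the cycle lemma gives them the factor [k / N], and
    the factor [k] turns the sum over [k] into a conditional mean of a step, restricted to large
    steps. The walk may be periodic, which rules out a plain local limit theorem: two walk
    probabilities are compared only if one arises from the other by exchanging steps of positive
    mass. The steps to exchange come from the pattern itself, closed with leaves into a finite tree
    of positive weight. The constants of the two sides agree because [mu] has mean [p * (1 + mb)]
    and [mw = p / (1 - p)], where [mw] and [mb] are the means of [rho_w] and [rho_b]: thus
    [(1 - p * (1 + mb)) / p], which comes from the walk, equals [(1 - mw * mb) / mw], which comes
    from the spine. *)

Section walk.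
Variables (R : realType) (mu : nat -> R).

Fixpoint walk (n x : nat) : R :=
  if n is n'.+1 then \sum_(k < x.+1) mu k * walk n' (x - k) else (x == 0%N)%:R.

(** First passage probability: started from [m], the walk whose increments are a step minus one
    first reaches 0 at time [n]. Cutting the sum at [k <= n'] loses nothing, since the level falls
    by at most one per step ([forest_mass_gt]). *)
Fixpoint forest_mass (n m : nat) : R :=
  match n, m with
  | 0%N, _ => (m == 0%N)%:R
  | _.+1, 0%N => 0
  | n'.+1, m'.+1 => \sum_(k < n'.+1) mu k * forest_mass n' (m' + k)
  end.

(** Truncation keeps generating functions polynomial, and does not affect the coefficients of degree
    below [K] of a power. *)
Definition step_poly (K : nat) : {poly R} := \poly_(i < K) mu i.

Lemma coef_step_poly K k : (k < K)%N -> (step_poly K)`_k = mu k.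
Proof. by rewrite coef_poly => ->. Qed.

Lemma walkE K n x : (x < K)%N -> walk n x = (step_poly K ^+ n)`_x.
Proof.
elim: n x => [|n IH] x xK; first by rewrite expr0 coef1.
rewrite exprS coefM /=; apply: eq_bigr => i _.
rewrite coef_step_poly ?IH//; have := ltn_ord i; lia.
Qed.

Lemma walk1 x : walk 1 x = mu x.
Proof. by rewrite (@walkE x.+1)// expr1 coef_step_poly. Qed.

(** By exchangeability, one step given that [n + 1] steps have sum [x] has mean [x / (n + 1)]. For
    generating functions, this is the derivative of [Q ^+ n.+1], multiplied by ['X]. *)
Lemma walk_mean n x :
  n.+1%:R * (\sum_(k < x.+1) k%:R * mu k * walk n (x - k)) = x%:R * walk n.+1 x.
Proof.
set Q := step_poly x.+1.
have XdE (q : {poly R}) i : ('X * q^`())`_i = i%:R * q`_i.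
  rewrite coefXM; case: i => [|i] /=; first by rewrite mul0r.
  by rewrite coef_deriv mulr_natl.
have -> : \sum_(k < x.+1) k%:R * mu k * walk n (x - k) = ('X * Q^`() * Q ^+ n)`_x.
  rewrite coefM; apply: eq_bigr => i _.
  rewrite XdE coef_step_poly// (@walkE x.+1)//; have := ltn_ord i; lia.
rewrite (@walkE x.+1)// -XdE deriv_exp /= mulr_natl -coefMn; congr (_ `_ _).
by rewrite mulrnAr mulrA.
Qed.

Lemma forest_mass_gt n m : (n < m)%N -> forest_mass n m = 0.
Proof.
elim: n m => [|n IH] [|m] //= nm.
by apply: big1 => k _; rewrite IH ?mulr0//; lia.
Qed.

(** Induction by conditioning on the first step: the factor [m + k] of the induction hypothesis
    splits into a part in [m], which sums to a walk probability, and a part in [k], which is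
    [walk_mean]. *)
Lemma cycle_lemma n m : (m <= n)%N ->
  n%:R * forest_mass n m = m%:R * walk n (n - m).
Proof.
elim: n m => [|n IH] [|m] // mn; rewrite ?mul0r ?mulr0//.
(* The induction hypothesis carries a factor [n] that has to be cancelled, so [n = 0] is treated by
   hand. *)
have [n0|n0] := posnP n.
  have m0 : m = 0%N by lia.
  by rewrite n0 m0 /= !big_ord_recl !big_ord0 /= !addr0 ?subnn ?eqxx.
have n0R : (n%:R : R) != 0 by rewrite pnatr_eq0 -lt0n.
apply: (mulfI n0R); rewrite subSS.
have -> : forest_mass n.+1 m.+1 = \sum_(k < (n - m).+1) mu k * forest_mass n (m + k).
  rewrite /= -(subnKC (_ : (n - m).+1 <= n.+1)%N); last lia.
  rewrite big_split_ord /= [X in _ + X]big1 ?addr0// => k _.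
  by rewrite forest_mass_gt ?mulr0//; lia.
have -> : n%:R * (n.+1%:R * \sum_(k < (n - m).+1) mu k * forest_mass n (m + k)) =
    n.+1%:R * (\sum_(k < (n - m).+1) (m%:R * (mu k * walk n ((n - m) - k)) +
                k%:R * mu k * walk n ((n - m) - k))).
  rewrite mulrCA; congr (_ * _); rewrite mulr_sumr; apply: eq_bigr => k _.
  rewrite mulrCA IH; last by have := ltn_ord k; lia.
  have -> : (n - (m + k) = n - m - k)%N by lia.
  by rewrite natrD; ring.
rewrite big_split /= mulrDr walk_mean -mulr_sumr -/(walk n.+1 (n - m)).
by rewrite natrB// -!natr1; ring.
Qed.

(** The path is split at the time when its level has dropped by [k], that is, after the first [k]
    trees. *)
Lemma forest_mass_conv n k l :
  forest_mass n (k + l) = \sum_(i < n.+1) forest_mass i k * forest_mass (n - i) l.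
Proof.
elim: n k => [|n IH] [|k].
- by rewrite big_ord_recl big_ord0 /= addr0 add0n mul1r.
- by rewrite big_ord_recl big_ord0 /= mul0r addr0.
- rewrite add0n big_ord_recl /= mul1r big1 ?addr0// => i _.
  by rewrite /= mul0r.
rewrite addSn big_ord_recl /= mul0r add0r.
under eq_bigr => j _.
  rewrite -addnA [(l + j)%N]addnC addnA IH mulr_sumr.
  over.
rewrite exchange_big /=; apply: eq_bigr => i _.
rewrite !subSS mulr_suml.
rewrite -[LHS](big_mkord xpredT (fun j : nat => mu j * (forest_mass i (k + j) * forest_mass (n - i) l))).
rewrite (big_cat_nat _ (n := i.+1)) //= [X in _ + X]big1_seq ?addr0 => [|j /andP[_]]; last first.
  by rewrite mem_index_iota => ij; rewrite (@forest_mass_gt i) ?mul0r ?mulr0//; lia.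
by rewrite big_mkord; apply: eq_bigr => j _; rewrite mulrA.
Qed.

Hypothesis mu_ge0 : forall k, 0 <= mu k.

Lemma walk_ge0 n x : 0 <= walk n x.
Proof.
elim: n x => [|n IH] x /=; first by rewrite ler0n.
by apply: sumr_ge0 => k _; rewrite mulr_ge0.
Qed.

Lemma forest_mass_ge0 n m : 0 <= forest_mass n m.
Proof.
elim: n m => [|n IH] [|m] //=.
by apply: sumr_ge0 => k _; rewrite mulr_ge0.
Qed.

Lemma walkD n m x y : walk n x * walk m y <= walk (n + m) (x + y).
Proof.
rewrite !(@walkE (x + y).+1) ?ltnS ?leq_addr ?leq_addl// exprD coefM.
have xlt : (x < (x + y).+1)%N by lia.
rewrite (bigD1 (Ordinal xlt)) //= addKn lerDl sumr_ge0// => i _.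
by rewrite -!walkE ?mulr_ge0 ?walk_ge0//; have := ltn_ord i; lia.
Qed.

Lemma walk_add n x k : mu k * walk n x <= walk n.+1 (x + k).
Proof. by rewrite mulrC -[mu k]walk1 -[n.+1]addn1 walkD. Qed.

End walk.

Section nonneg_coefs.
Variable R : realType.
Implicit Types q : {poly R}.

Definition nonneg_coefs q := forall i, 0 <= q`_i.

Lemma nonneg_coefsM q1 q2 : nonneg_coefs q1 -> nonneg_coefs q2 -> nonneg_coefs (q1 * q2).
Proof. by move=> h1 h2 i; rewrite coefM sumr_ge0// => j _; rewrite mulr_ge0. Qed.

Lemma nonneg_coefsX q n : nonneg_coefs q -> nonneg_coefs (q ^+ n).
Proof.
move=> h; elim: n => [|n IH]; first by move=> i; rewrite expr0 coef1 ler0n.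
by rewrite exprS; exact: nonneg_coefsM.
Qed.

Lemma coef_le_horner1 q i : nonneg_coefs q -> q`_i <= q.[1].
Proof.
move=> q0; rewrite horner_coef.
under eq_bigr do rewrite expr1n mulr1.
have [lt|ge] := ltnP i (size q); last by rewrite nth_default// sumr_ge0.
by rewrite (bigD1 (Ordinal lt))//= lerDl sumr_ge0.
Qed.

End nonneg_coefs.

(** * Large deviations for the number of steps of a given size *)

Section walk_ratio.
Variables (R : realType) (mu : nat -> R).
Hypothesis mu_ge0 : forall k, 0 <= mu k.
Hypothesis mu_sum : forall K, \sum_(k < K) mu k <= 1.

(* Large deviations for the number [j] of steps equal to [k]: [v = e^t] marks
   these steps, and Jensen's inequality bounds the conditional mean of [j]. *)
Lemma walk_tilt n x k (t dl : R) : (k <= x)%N -> 0 < mu k ->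
  expR (- (dl * n.+1%:R)) <= walk mu n.+1 x ->
  t * (mu k * (walk mu n (x - k) / walk mu n.+1 x)) <= mu k * (expR t - 1) + dl.
Proof.
move=> kx muk aN; set a := walk mu n.+1 x in aN *.
have a0 : 0 < a by apply: lt_le_trans aN; exact: expR_gt0.
pose Q := step_poly mu x.+1; pose M : {poly R} := mu k *: 'X^k; pose Q' : {poly R} := Q - M.
have QE : Q = Q' + M by rewrite /Q' subrK.
have M0 : nonneg_coefs M.
  by move=> i; rewrite coefZ coefXn mulr_ge0.
have Q'0 : nonneg_coefs Q'.
  move=> i; rewrite coefB coefZ coefXn /Q coef_poly.
  have [->|_] := eqVneq i k; first by rewrite ltnS kx mulr1 subrr.
  by rewrite mulr0 subr0; case: ifP.
(* [p j] is the probability that the [n + 1] steps have sum [x] and exactly [j] of them equal [k]: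
   [M] generates these steps and [Q'] the others. *)
pose p j : R := ((Q' ^+ (n.+1 - j) * M ^+ j) *+ 'C(n.+1, j))`_x.
have p0 j : 0 <= p j.
  rewrite /p coefMn mulrn_wge0//.
  by apply: nonneg_coefsM; exact: nonneg_coefsX.
have pS : \sum_(j < n.+2) p j = a.
  by rewrite /a (@walkE _ _ x.+1)// -/Q QE exprDn coef_sum.
have pM : \sum_(j < n.+2) j%:R * p j = n.+1%:R * (mu k * walk mu n (x - k)).
  have -> : mu k * walk mu n (x - k) = (Q ^+ n * M)`_x.
    rewrite (@walkE _ _ x.+1) -/Q; last by lia.
    by rewrite /M -scalerAr coefZ coefMXn ltnNge kx.
  rewrite big_ord_recl /= mul0r add0r QE exprDn mulr_suml coef_sum mulr_sumr.
  apply: eq_bigr => i _; rewrite /p /bump /= add1n subSS !mulr_natl mulrnAl !coefMn -!mulrnA.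
  by rewrite [('C(n, i) * _)%N]mulnC (mul_bin_diag n.+1 i) mulnC exprSr mulrA.
(* The constraint on the sum is dropped: a coefficient of a polynomial with nonnegative coefficients
   is at most the value of the polynomial at 1. *)
have pv : \sum_(j < n.+2) p j * expR (t * j%:R) <= expR (n.+1%:R * (mu k * (expR t - 1))).
  have -> : \sum_(j < n.+2) p j * expR (t * j%:R) = ((Q' + expR t *: M) ^+ n.+1)`_x.
    rewrite exprDn coef_sum; apply: eq_bigr => j _; rewrite /p expRM_natr.
    by rewrite [(expR t *: M) ^+ j]exprZn -scalerAr !coefMn coefZ mulrnAl mulrC.
  apply: le_trans (coef_le_horner1 _ _) _.
    by apply: nonneg_coefsX => i; rewrite coefD coefZ addr_ge0 ?mulr_ge0 ?expR_ge0.
  rewrite expRM_natl horner_exp hornerD hornerZ [M.[1]]hornerZ hornerXn expr1n mulr1.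
  have Q1 : Q.[1] <= 1.
    rewrite horner_coef; under eq_bigr do rewrite expr1n mulr1.
    apply: le_trans (mu_sum x.+1).
    rewrite [leRHS](eq_bigr (fun i : 'I_x.+1 => Q`_i)); last by move=> i _; rewrite coef_step_poly.
    rewrite [leRHS](bigID (fun i : 'I_x.+1 => i < size Q)%N) /=.
    have sz : (size Q <= x.+1)%N by exact: size_poly.
    rewrite (big_ord_widen_cond _ xpredT (fun i => Q`_i) sz) lerDl.
    by rewrite sumr_ge0// => i _; rewrite coef_step_poly.
  have Q'1 : 0 <= Q'.[1].
    by rewrite (le_trans _ (coef_le_horner1 0 Q'0)).
  apply: lerXn2r; rewrite ?nnegrE ?expR_ge0 ?addr_ge0 ?mulr_ge0 ?expR_ge0//.
  apply: le_trans (expR_ge1Dx _); move: Q1; rewrite QE !hornerE expr1n mulr1; lra.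
(* [th] is the conditional mean of the count [j]; the tangent of the exponential at [t * th] yields
   Jensen's inequality. *)
pose th := (n.+1%:R * (mu k * walk mu n (x - k))) / a.
have jensen : a * expR (t * th) <= \sum_(j < n.+2) p j * expR (t * j%:R).
  have tang (j : 'I_n.+2) : p j * (expR (t * th) * (1 + t * (j%:R - th))) <= p j * expR (t * j%:R).
    apply: ler_wpM2l => //.
    have -> : t * j%:R = t * th + t * (j%:R - th) by ring.
    by rewrite expRD ler_wpM2l ?expR_ge0 ?expR_ge1Dx.
  apply: le_trans (ler_sum _ (fun j _ => tang j)).
  have -> : \sum_(j < n.+2) p j * (expR (t * th) * (1 + t * (j%:R - th))) =
     expR (t * th) * ((1 - t * th) * (\sum_(j < n.+2) p j) + t * \sum_(j < n.+2) j%:R * p j).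
    rewrite [(1 - _) * _]mulr_sumr [t * \sum_(_ < _) _]mulr_sumr -big_split /= mulr_sumr.
    by apply: eq_bigr => j _; ring.
  rewrite pS pM mulrC ler_wpM2l ?expR_ge0//.
  have -> : n.+1%:R * (mu k * walk mu n (x - k)) = th * a by rewrite /th divfK// gt_eqF.
  by have -> : (1 - t * th) * a + t * (th * a) = a by ring.
have : expR (t * th - dl * n.+1%:R) <= expR (n.+1%:R * (mu k * (expR t - 1))).
  apply: le_trans pv; apply: le_trans jensen.
  by rewrite addrC expRD ler_wpM2r ?expR_ge0.
rewrite ler_expR => h.
have n0 : 0 < n.+1%:R :> R by rewrite ltr0n.
rewrite -(ler_pM2l n0).
have -> : n.+1%:R * (t * (mu k * (walk mu n (x - k) / a))) = t * th.
  by rewrite /th; ring.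
by rewrite mulrDr [_ * dl]mulrC -lerBlDr.
Qed.

End walk_ratio.

Lemma cvg_sumr (R : realType) (I T : Type) (F : set_system T) (FF : Filter F) (r : seq I)
    (f : I -> T -> R) (a : I -> R) :
  (forall i, f i t @[t --> F] --> a i) ->
  \sum_(i <- r) f i t @[t --> F] --> \sum_(i <- r) a i.
Proof.
move=> fa; elim: r => [|i r IH].
  by under eq_fun do rewrite big_nil; rewrite big_nil; exact: cvg_cst.
by under eq_fun do rewrite big_cons; rewrite big_cons; exact: cvgD (fa i) IH.
Qed.

Lemma cauchy_product_ge (R : realType) (f g : nat -> R) a b :
  (forall i, 0 <= f i) -> (forall i, 0 <= g i) ->
  (\sum_(i < a.+1) f i) * (\sum_(j < b.+1) g j) <=
  \sum_(n < (a + b).+1) \sum_(i < n.+1) f i * g (n - i)%N.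
Proof.
move=> f0 g0; pose F := \poly_(i < a.+1) f i; pose G := \poly_(i < b.+1) g i.
have F1 : F.[1] = \sum_(i < a.+1) f i.
  by rewrite horner_poly; under eq_bigr do rewrite expr1n mulr1.
have G1 : G.[1] = \sum_(i < b.+1) g i.
  by rewrite horner_poly; under eq_bigr do rewrite expr1n mulr1.
rewrite -F1 -G1 -hornerM (@horner_coef_wide _ (a + b).+1); last first.
  have sF : (size F <= a.+1)%N by exact: size_poly.
  have sG : (size G <= b.+1)%N by exact: size_poly.
  apply: leq_trans (size_polyMleq _ _) _; apply: (@leq_trans (a.+1 + b.+1).-1); last by rewrite addSn addnS.
  by rewrite -!subn1 leq_sub2r ?leq_add.
apply: ler_sum => n _; rewrite expr1n mulr1 coefM; apply: ler_sum => i _.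
rewrite !coef_poly; do 2 case: ifP => _; rewrite ?mulr0 ?mul0r ?mulr_ge0//.
Qed.

(** * Generating function of tree sizes *)

Section generating.
Variables (R : realType) (mu : nat -> R).
Hypothesis mu_ge0 : forall k, 0 <= mu k.

Definition tree_gen (z : R) (N : nat) : R :=
  \sum_(n < N.+1) forest_mass mu n 1 * z ^+ n.

Lemma tree_gen_ge0 z N : 0 <= z -> 0 <= tree_gen z N.
Proof. by move=> z0; rewrite sumr_ge0// => n _; rewrite mulr_ge0 ?exprn_ge0 ?forest_mass_ge0. Qed.

Lemma tree_gen_exp z N k : 0 <= z ->
  tree_gen z N ^+ k <= \sum_(n < (k * N).+1) forest_mass mu n k * z ^+ n.
Proof.
move=> z0; have t0 n m : 0 <= forest_mass mu n m * z ^+ n.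
  by rewrite mulr_ge0 ?exprn_ge0 ?forest_mass_ge0.
elim: k => [|k IH].
  by rewrite expr0 mul0n big_ord_recl big_ord0 /= mulr1 addr0.
rewrite exprS; apply: (@le_trans _ _ (tree_gen z N *
    \sum_(n < (k * N).+1) forest_mass mu n k * z ^+ n)).
  by rewrite ler_wpM2l ?tree_gen_ge0.
apply: le_trans (@cauchy_product_ge R (fun i => forest_mass mu i 1 * z ^+ i)
  (fun i => forest_mass mu i k * z ^+ i) N (k * N) _ _) _ => //.
rewrite mulSn; apply: ler_sum => n _.
rewrite -[k.+1]add1n forest_mass_conv mulr_suml; apply: ler_sum => i _.
rewrite mulrACA -exprD subnKC//; have := ltn_ord i; lia.
Qed.

(** Truncated form of the functional equation [w = z * phi w], where [phi] is the generating
    function of [mu]: one inequality survives truncation, at the price of a larger cutoff on the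
    right. *)
Lemma tree_gen_step z N K : 0 <= z ->
  z * (\sum_(k < K) mu k * tree_gen z N ^+ k) <= tree_gen z (K * N).+1.
Proof.
move=> z0.
have t0 n m : 0 <= forest_mass mu n m * z ^+ n.
  by rewrite mulr_ge0 ?exprn_ge0 ?forest_mass_ge0.
apply: (@le_trans _ _ (z * \sum_(k < K) \sum_(n < (K * N).+1) mu k * forest_mass mu n k * z ^+ n)).
  apply: ler_wpM2l => //; apply: ler_sum => k _.
  under eq_bigr do rewrite -mulrA.
  rewrite -mulr_sumr ler_wpM2l// (le_trans (tree_gen_exp _ _ z0))//.
  have kK : ((k * N).+1 <= (K * N).+1)%N by rewrite ltnS leq_mul2r (ltnW (ltn_ord k)) orbT.
  rewrite (big_ord_widen_cond _ xpredT (fun n => forest_mass mu n k * z ^+ n) kK) big_mkcond /=.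
  by apply: ler_sum => n _; case: ifP.
rewrite exchange_big /= mulr_sumr /tree_gen [leRHS]big_ord_recl /= mul0r add0r.
apply: ler_sum => n _; rewrite -mulr_suml exprS mulrCA ler_wpM2r ?mulr_ge0 ?exprn_ge0//.
rewrite /bump /=.
rewrite -!(big_mkord xpredT (fun k => mu k * forest_mass mu n k)).
have [Kn|nK] := leqP K n.+1.
  rewrite [leRHS](big_cat_nat _ (n := K))//= lerDl sumr_ge0// => k _.
  by rewrite mulr_ge0 ?forest_mass_ge0.
rewrite (big_cat_nat _ (n := n.+1)) //=; last exact: ltnW.
rewrite [X in _ + X]big1_seq ?addr0// => k /andP[_].
by rewrite mem_index_iota => /andP[nk _]; rewrite forest_mass_gt ?mulr0.
Qed.

Lemma tree_gen_fixpoint z B : 0 <= z -> (forall N, tree_gen z N <= B) ->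
  exists w, [/\ forall N, tree_gen z N <= w, tree_gen z N @[N --> \oo] --> w &
    forall K, z * (\sum_(k < K) mu k * w ^+ k) <= w].
Proof.
move=> z0 wB.
have nd : nondecreasing_seq (tree_gen z).
  apply/nondecreasing_seqP => N; rewrite /tree_gen [leRHS]big_ord_recr lerDl.
  by rewrite mulr_ge0 ?exprn_ge0 ?forest_mass_ge0.
have cv : cvgn (tree_gen z).
  by apply: nondecreasing_is_cvgn => //; exists B => _ [N _ <-]; exact: wB.
have le N : tree_gen z N <= limn (tree_gen z) by exact: nondecreasing_cvgn_le.
exists (limn (tree_gen z)); split => // K.
have h : z * (\sum_(k < K) mu k * tree_gen z N ^+ k) @[N --> \oo] -->
    z * (\sum_(k < K) mu k * limn (tree_gen z) ^+ k).
  apply: cvgMl_tmp; apply: cvg_sumr => k; apply: cvgMl_tmp.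
  exact: (cvg_comp (tree_gen z) (fun y => y ^+ k) cv (@exprn_continuous R k _)).
rewrite -(cvg_lim _ h)//; apply: limr_le; first by apply/cvg_ex; eexists; exact: h.
by apply: nearW => N; rewrite (le_trans (tree_gen_step _ _ z0)).
Qed.

Hypothesis mu_sum1 : forall e, 0 < e -> exists K, 1 - e < \sum_(k < K) mu k.
Variable m : R.
Hypothesis m1 : m < 1.
Hypothesis mu_mean : forall K, \sum_(k < K) k%:R * mu k <= m.

(** A mean below 1 keeps [phi] strictly above the diagonal on [[0, 1)]: Bernoulli's inequality gives
    [phi w >= 1 - m * (1 - w)], which exceeds [w] by [(1 - m) * (1 - w)]. This excess is the error
    allowed for truncating [phi]. *)
Lemma fixpoint_ge1 w : 0 <= w <= 1 ->
  (forall K, \sum_(k < K) mu k * w ^+ k <= w) -> w = 1.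
Proof.
move=> /andP[w0 w1] h; apply/eqP; rewrite eq_le w1 /= leNgt; apply/negP => lt1.
have bern k : 1 - k%:R * (1 - w) <= w ^+ k.
  elim: k => [|k IH]; first by rewrite mul0r subr0 expr0.
  rewrite exprS; apply: (@le_trans _ _ (w * (1 - k%:R * (1 - w)))); last by rewrite ler_wpM2l.
  rewrite -subr_ge0 -natr1.
  have -> : w * (1 - k%:R * (1 - w)) - (1 - (k%:R + 1) * (1 - w)) = k%:R * (1 - w) ^+ 2 by ring.
  by rewrite mulr_ge0 ?ler0n ?sqr_ge0.
have e0 : 0 < (1 - m) * (1 - w) by rewrite mulr_gt0 ?subr_gt0.
have [K hK] := mu_sum1 e0.
have := h K; apply/negP; rewrite -ltNge.
apply: (@lt_le_trans _ _ (\sum_(k < K) mu k * (1 - k%:R * (1 - w)))); last first.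
  by apply: ler_sum => k _; rewrite ler_wpM2l ?bern.
have -> : \sum_(k < K) mu k * (1 - k%:R * (1 - w)) =
    \sum_(k < K) mu k - (1 - w) * \sum_(k < K) k%:R * mu k.
  by rewrite mulr_sumr -sumrB; apply: eq_bigr => k _; ring.
have := mu_mean K; rewrite -(ler_pM2l (_ : 0 < 1 - w)) ?subr_gt0//; nra.
Qed.

End generating.

(** * Ratio limits for the walk *)

(** Everything is expressed through finite partial sums, so that no series in [mu] has to be
    handled; [m] is an upper bound of the mean, and [step_heavy] is the absence of exponential
    moments. *)
Record step_law (R : realType) (mu : nat -> R) (m : R) : Prop := StepLaw {
  step_ge0 : forall k, 0 <= mu k ;
  step_sum_le1 : forall K, \sum_(k < K) mu k <= 1 ;
  step_sum1 : forall e, 0 < e -> exists K, 1 - e < \sum_(k < K) mu k ;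
  step_mean_lt1 : m < 1 ;
  step_mean : forall K, \sum_(k < K) k%:R * mu k <= m ;
  step_heavy : forall z B, 1 < z -> exists K, B < \sum_(k < K) mu k * z ^+ k ;
  step_gt0 : 0 < mu 0%N }.

Section walk_lower.
Variables (R : realType) (mu : nat -> R) (m : R).
Hypothesis law : step_law mu m.

Let mu_ge0 := step_ge0 law.

(** With steps 0 and 1 only, the exponential sums would be bounded. Such a [k] lifts a tree walk, of
    sum one less than its number of steps, to the diagonal. *)
Lemma big_step : exists2 k, (2 <= k)%N & 0 < mu k.
Proof.
apply: contrapT => h.
have mu0 k : (2 <= k)%N -> mu k = 0.
  move=> k2; apply/eqP; rewrite eq_le mu_ge0 andbT leNgt; apply/negP => kp.
  by apply: h; exists k.
have [K] := step_heavy law (mu 0%N + mu 1%N * 2) (ltr1n R 2).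
apply/negP; rewrite -leNgt.
rewrite -(big_mkord xpredT (fun k => mu k * 2 ^+ k)).
have K2 : (K <= K.+2)%N by lia.
apply: (@le_trans _ _ (\sum_(0 <= k < K.+2) mu k * 2 ^+ k)).
  rewrite [leRHS](big_cat_nat _ (n := K))//= lerDl sumr_ge0// => k _.
  by rewrite mulr_ge0 ?exprn_ge0.
rewrite big_nat_recl// big_nat_recl// big1 ?addr0 ?expr0 ?expr1 ?mulr1// => k _.
by rewrite mu0 ?mul0r.
Qed.

Lemma walk_gt0_zeros n : 0 < walk mu n 0.
Proof.
elim: n => [|n IH]; first by rewrite /= ltr01.
by rewrite /= big_ord_recl big_ord0 addr0 mulr_gt0 ?(step_gt0 law).
Qed.

Lemma tree_mass_le_walk n : forest_mass mu n 1 <= walk mu n n.-1.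
Proof.
case: n => [|n]; first by rewrite /= ler01.
have := @cycle_lemma R mu n.+1 1 isT; rewrite mul1r subn1 => <-.
by rewrite ler_peMl ?forest_mass_ge0// ler1n.
Qed.

(* Otherwise the generating function of tree sizes would converge at some
   [z > 1]; its value [w] would satisfy [z * phi w <= w]: either [w > 1] and
   [mu] has an exponential moment, or [w <= 1] and [w = 1] contradicts [z > 1]. *)
Lemma walk_diag_lower dl : 0 < dl ->
  exists2 N, (0 < N)%N & expR (- (dl * N%:R)) <= walk mu N N.
Proof.
move=> d0; apply: contrapT => h.
have {}h N : (0 < N)%N -> walk mu N N < expR (- (dl * N%:R)).
  by move=> N0; rewrite ltNge; apply/negP => le; apply: h; exists N.
have [k k2 kp] := big_step.
(* Positive thanks to one step [k] and [k - 2] zeros. These [k - 1] steps of sum [k], appended to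
   [n + 1] steps of sum [n], give [n + k] steps of sum [n + k], to which [h] applies. *)
pose C := walk mu k.-1 k.
have C0 : 0 < C.
  have := walk_add mu_ge0 k.-2 0 k; rewrite add0n (_ : k.-2.+1 = k.-1); last lia.
  by apply: lt_le_trans; rewrite mulr_gt0 ?walk_gt0_zeros.
(* Half of the decay rate: the tree masses are at most [C^-1 * z^-1 ^+ (2 * n)], so their generating
   function still converges geometrically at [z > 1]. *)
pose z := expR (dl / 2).
have z1 : 1 < z by rewrite -expR0 ltr_expR divr_gt0.
have z0 : 0 < z by exact: expR_gt0.
have an n : forest_mass mu n 1 <= C^-1 * z^-1 ^+ (2 * n).
  rewrite -ler_pdivrMl ?invr_gt0// invrK.
  case: n => [|n]; first by rewrite /= mulr0 exprn_ge0// invr_ge0 ltW.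
  apply: (@le_trans _ _ (C * walk mu n.+1 n)); first by rewrite ler_pM2l// tree_mass_le_walk.
  rewrite mulrC; apply: le_trans (walkD mu_ge0 _ _ _ _) _.
  have e : (n.+1 + k.-1 = n + k)%N by lia.
  rewrite e (le_trans (ltW (h _ _)))//; first by lia.
  rewrite /z -expRN -expRM_natl ler_expR natrM natrD.
  have : (1 : R) <= k%:R by rewrite ler1n; lia.
  rewrite -[n.+1%:R]natr1 => k1; have := mulr_ge0 (ltW d0) (_ : 0 <= k%:R - 1 :> R); rewrite subr_ge0 => /(_ k1); lra.
pose q := z^-1.
have q01 : 0 < q < 1 by rewrite invr_gt0 z0 invf_lt1.
have bd N : tree_gen mu z N <= C^-1 / (1 - q).
  apply: (@le_trans _ _ (C^-1 * \sum_(n < N.+1) q ^+ n)).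
    rewrite mulr_sumr; apply: ler_sum => n _.
    have -> : q ^+ n = q ^+ (2 * n) * z ^+ n.
      by rewrite mul2n -addnn exprD -mulrA -exprMn mulVf ?gt_eqF// expr1n mulr1.
    by rewrite mulrA ler_wpM2r ?exprn_ge0 ?(ltW z0).
  rewrite ler_wpM2l ?invr_ge0 ?(ltW C0)//.
  have q1 : 0 < 1 - q by rewrite subr_gt0; case/andP: q01.
  rewrite -[leRHS]mul1r ler_pdivlMr// -lerN2 -mulrN opprB mulrC -subrX1.
  by rewrite -[leLHS]add0r lerD2r exprn_ge0// ltW; case/andP: q01.
have [w [wge _ wfix]] := tree_gen_fixpoint mu_ge0 (ltW z0) bd.
have w0 : 0 < w.
  apply: lt_le_trans (wge 1%N).
  rewrite /tree_gen !big_ord_recl big_ord0 /= !addr0 mul0r add0r expr1.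
  by rewrite big_ord_recl big_ord0 addr0 /= mulr1 mulr_gt0 ?(step_gt0 law).
have wz K : \sum_(k < K) mu k * w ^+ k <= w / z.
  by rewrite ler_pdivlMr// mulrC.
have [w1|w1] := ltP 1 w.
  by have [K] := step_heavy law (w / z) w1; rewrite ltNge wz.
have wlt : w / z < w by rewrite ltr_pdivrMr// ltr_pMr.
have we : w = 1.
  apply: (fixpoint_ge1 mu_ge0 (step_sum1 law) (step_mean_lt1 law) (step_mean law)).
    by rewrite (ltW w0).
  by move=> K; rewrite (le_trans (wz K))// ltW.
have wz1 : 0 < 1 - w / z by rewrite subr_gt0 -we.
have [K] := step_sum1 law wz1.
rewrite opprB addrC subrK; apply/negP; rewrite -leNgt (le_trans _ (wz K))//.
by apply: ler_sum => i _; rewrite we expr1n mulr1.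
Qed.

Lemma expR_absorb (c dl : R) : 0 < c -> 0 < dl ->
  exists N, forall n, (N <= n)%N -> expR (- (dl * n%:R)) <= c.
Proof.
move=> c0 d0; pose B := (c * dl)^-1; exists (Num.bound B) => n nN.
have B0 : 0 < B by rewrite invr_gt0 mulr_gt0.
have Bn : B <= n%:R.
  by rewrite (le_trans (ltW (archi_boundP (ltW B0))))// ler_nat.
rewrite expRN -[leRHS]invrK lef_pV2 ?posrE ?expR_gt0 ?invr_gt0//.
have h := expR_ge1Dx (dl * n%:R).
apply: le_trans h; rewrite (@le_trans _ _ (dl * n%:R))//; last by rewrite lerDr.
by move: Bn; rewrite -(ler_pM2l d0); apply: le_trans; rewrite /B invfM mulrCA divff ?gt_eqF// mulr1.
Qed.

Lemma walk_diag_exp n j N x : walk mu n x * walk mu N N ^+ j <= walk mu (n + j * N) (x + j * N).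
Proof.
elim: j => [|j IH]; first by rewrite !addn0 mulr1.
rewrite exprSr mulrA !mulSn ![(N + _)%N]addnC !addnA.
by apply: le_trans (walkD mu_ge0 _ _ _ _); rewrite ler_wpM2r ?walk_ge0.
Qed.

(** Because of periodicity, each residue class modulo [N] is treated apart: one good size [n0] of
    the class is prolonged by blocks of [N] steps of sum [N]. The blocks cost half of the rate, and
    the other half absorbs the constant [walk mu n0 n0.-1]. *)
Lemma walk_lower dl : 0 < dl -> exists N0, forall n, (N0 <= n)%N ->
  0 < walk mu n n.-1 -> expR (- (dl * n%:R)) <= walk mu n n.-1.
Proof.
move=> d0; have d20 : 0 < dl / 2 by rewrite divr_gt0.
have [N N0 hN] := walk_diag_lower d20.
have res r : exists Nr, forall n, (Nr <= n)%N -> n = r %[mod N] ->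
    0 < walk mu n n.-1 -> expR (- (dl * n%:R)) <= walk mu n n.-1.
  have [[n0 [n00 nr np]]|no] := pselect (exists n0, [/\ (0 < n0)%N, n0 = r %[mod N] & 0 < walk mu n0 n0.-1]).
    have [N1 hN1] := expR_absorb np d20.
    exists (maxn n0 N1) => n; rewrite geq_max => /andP[n0n N1n] nr' _.
    have dv : (N %| n - n0)%N by rewrite -eqn_mod_dvd// nr' nr.
    have [j jE] := dvdnP dv.
    have -> : n = (n0 + j * N)%N by rewrite -jE subnKC.
    have -> : (n0 + j * N).-1 = (n0.-1 + j * N)%N by lia.
    apply: le_trans (walk_diag_exp _ _ _ _).
    have -> : expR (- (dl * (n0 + j * N)%:R)) = expR (- (dl / 2 * (n0 + j * N)%:R)) * expR (- (dl / 2 * (n0 + j * N)%:R)).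
      by rewrite -expRD; congr expR; field.
    rewrite ler_pM ?expR_ge0 ?hN1 -?jE ?subnKC//.
    apply: (@le_trans _ _ (expR (- (dl / 2 * N%:R)) ^+ j)).
      rewrite -expRM_natl ler_expR.
      have -> : (n%:R : R) = n0%:R + j%:R * N%:R by rewrite -natrM -natrD -jE subnKC.
      rewrite mulrN lerN2; have : (0 : R) <= n0%:R by []. nra.
    by rewrite lerXn2r ?nnegrE ?expR_ge0 ?walk_ge0.
  exists 1%N => n n1 nr np; exfalso; apply: no; exists n; split => //.
have [F hF] := choice res.
exists (\max_(r < N) F r) => n nF np.
apply: (hF (n %% N)%N) => //; last by rewrite modn_mod.
by apply: leq_trans nF; rewrite (leq_bigmax (Ordinal (ltn_pmod n N0))).
Qed.

End walk_lower.

Section asymptotics.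
Variables (R : realType) (mu : nat -> R) (m : R).
Hypothesis law : step_law mu m.

Let mu_ge0 := step_ge0 law.

(** [walk_tilt] at [t] and at [- t] bounds the ratio from above and from below. After division by
    [t * mu k], the second order terms of the exponentials cost at most [2 * t <= e / 2], and [dl]
    is chosen to cost exactly [e / 2]. *)
Lemma walk_ratio_near1 k (e : R) : 0 < mu k -> 0 < e ->
  exists2 dl, 0 < dl & forall n x, (k <= x)%N ->
    expR (- (dl * n.+1%:R)) <= walk mu n.+1 x ->
    `|walk mu n (x - k) - walk mu n.+1 x| <= e * walk mu n.+1 x.
Proof.
move=> kp e0; pose t : R := Num.min (e / 4) (1 / 2).
have t0 : 0 < t by rewrite lt_min !divr_gt0.
have te : t <= e / 4 by rewrite ge_min lexx.
have t2 : t <= 1 / 2 by rewrite ge_min lexx orbT.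
have tm : 0 < t * mu k by rewrite mulr_gt0.
exists (t * mu k * (e / 2)); first by rewrite mulr_gt0 ?divr_gt0.
move=> n x kx h; set W := walk mu n.+1 x in h *; set V := walk mu n _.
have W0 : 0 < W by apply: lt_le_trans h; exact: expR_gt0.
have up := walk_tilt mu_ge0 (step_sum_le1 law) t kx kp h.
have lo := walk_tilt mu_ge0 (step_sum_le1 law) (- t) kx kp h.
rewrite -/W -/V in up lo; pose r := V / W; rewrite -/r in up lo.
have Vr : V = r * W by rewrite /r divfK// gt_eqF.
have et1 : expR t <= 1 + t * (1 + 2 * t).
  have h1 : 1 - t <= expR (- t) by have := expR_ge1Dx (- t).
  have h2 : expR t * expR (- t) = 1 by rewrite -expRD subrr expR0.
  have h3 : expR t * (1 - t) <= 1 by rewrite -[leRHS]h2 ler_wpM2l ?expR_ge0.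
  have t1 : 0 < 1 - t by lra.
  rewrite -(ler_pM2r t1) (le_trans h3)//.
  have -> : (1 + t * (1 + 2 * t)) * (1 - t) = 1 + t ^+ 2 * (1 - 2 * t) by ring.
  by rewrite lerDl mulr_ge0 ?sqr_ge0//; lra.
have et2 : expR (- t) <= 1 - t * (1 - t).
  have h1 := expR_ge1Dx t.
  have h2 : expR t * expR (- t) = 1 by rewrite -expRD subrr expR0.
  have h3 : (1 + t) * expR (- t) <= 1 by rewrite -[leRHS]h2 ler_wpM2r ?expR_ge0.
  have t1 : 0 < 1 + t by lra.
  rewrite -(ler_pM2l t1) (le_trans h3)//.
  have -> : (1 + t) * (1 - t * (1 - t)) = 1 + t ^+ 3 by ring.
  by rewrite lerDl exprn_ge0// ltW.
have rup : r <= 1 + e.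
  have : t * mu k * r <= t * mu k * (1 + 2 * t + e / 2).
    have : mu k * (expR t - 1) <= mu k * (t * (1 + 2 * t)) by rewrite ler_wpM2l// lerBlDl.
    lra.
  by rewrite ler_pM2l//; lra.
have rlo : 1 - e <= r.
  have : t * mu k * (1 - t - e / 2) <= t * mu k * r.
    have : mu k * (expR (- t) - 1) <= mu k * (- (t * (1 - t))) by rewrite ler_wpM2l// lerBlDl.
    lra.
  by rewrite ler_pM2l//; lra.
rewrite Vr -[X in _ - X]mul1r -mulrBl normrM (gtr0_norm W0) ler_wpM2r ?(ltW W0)//.
by rewrite ler_norml; apply/andP; split; lra.
Qed.

(** By the cycle lemma, for [n > 0] the condition says that [forest_mass mu n 1] is positive: these
    are the possible sizes of a tree. *)
Definition tree_sizes : set_system nat := within [set n | 0 < walk mu n n.-1] \oo.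

#[local] Instance tree_sizes_filter : Filter tree_sizes.
Proof. exact: within_filter. Qed.

Lemma tree_sizes_good : \forall n \near tree_sizes, 0 < walk mu n n.-1.
Proof. exact: withinT. Qed.

Lemma tree_sizes_large N : \forall n \near tree_sizes, (N <= n)%N.
Proof. by apply: cvg_within; exact: nbhs_infty_ge. Qed.

Lemma tree_sizes_lower dl : 0 < dl ->
  \forall n \near tree_sizes, expR (- (dl * n%:R)) <= walk mu n n.-1.
Proof.
move=> d0; have [N hN] := walk_lower law d0.
near=> n; apply: hN; first by near: n; exact: tree_sizes_large.
by near: n; exact: tree_sizes_good.
Unshelve. all: by end_near. Qed.

(* [walk (u n) (v n)] is asymptotic to [walk n (n - 1)], with [u n] close to [n]. *)
Definition walk_equiv (u v : nat -> nat) : Prop :=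
  (exists C, \forall n \near tree_sizes, (n <= u n + C)%N) /\
  forall e : R, 0 < e -> \forall n \near tree_sizes,
    `|walk mu (u n) (v n) - walk mu n n.-1| <= e * walk mu n n.-1.

Lemma walk_equiv_id : walk_equiv id predn.
Proof.
split; first by exists 0%N; apply: nearW => n; rewrite addn0.
by move=> e e0; apply: nearW => n; rewrite subrr normr0 mulr_ge0 ?walk_ge0// ltW.
Qed.

(** Half of the rate goes into the lower bound at [n]; the other half absorbs [c], which accounts
    for the bounded gap between [n] and [u n] and for a ratio of at least [1 / 2]. *)
Lemma walk_equiv_lower u v (dl : R) : 0 < dl -> walk_equiv u v ->
  \forall n \near tree_sizes, expR (- (dl * (u n)%:R)) <= walk mu (u n) (v n).
Proof.
move=> d0 [[C uC] uv]; have d20 : 0 < dl / 2 by rewrite divr_gt0.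
pose c : R := expR (- (dl / 2 * C%:R)) / 2.
have c0 : 0 < c by rewrite divr_gt0 ?expR_gt0.
have [N hN] := expR_absorb c0 d20.
near=> n.
have An : 0 < walk mu n n.-1 by near: n; exact: tree_sizes_good.
have h2 : `|walk mu (u n) (v n) - walk mu n n.-1| <= 1 / 2 * walk mu n n.-1.
  by near: n; apply: uv; rewrite divr_gt0.
have lo : expR (- (dl / 2 * n%:R)) <= walk mu n n.-1.
  by near: n; exact: tree_sizes_lower.
have nC : (n <= u n + C)%N by near: n.
have uN : (N <= u n)%N.
  have : (N + C <= n)%N by near: n; exact: tree_sizes_large.
  by move: nC; clear; lia.
have hW : 1 / 2 * walk mu n n.-1 <= walk mu (u n) (v n).
  by move: h2; rewrite ler_norml; lra.
apply: le_trans hW.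
apply: (@le_trans _ _ (1 / 2 * expR (- (dl / 2 * n%:R)))); last by rewrite ler_wpM2l.
have -> : expR (- (dl * (u n)%:R)) = expR (- (dl / 2 * (u n)%:R)) * expR (- (dl / 2 * (u n)%:R)).
  by rewrite -expRD; congr expR; field.
apply: (@le_trans _ _ (c * expR (- (dl / 2 * (u n)%:R)))).
  by rewrite ler_wpM2r ?expR_ge0 ?hN.
rewrite /c mulrAC -expRD mulrC mul1r ler_wpM2l// ler_expR -opprD -mulrDr lerN2.
by rewrite ler_wpM2l ?(ltW d20)// -natrD ler_nat addnC.
Unshelve. all: by end_near. Qed.

Lemma walk_equiv_near u v u' v' : walk_equiv u v ->
  (\forall n \near tree_sizes, u n = u' n /\ v n = v' n) -> walk_equiv u' v'.
Proof.
move=> [[C uC] uv] e; split.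
  exists C; near=> n; have [<- _] : u n = u' n /\ v n = v' n by near: n; exact: e.
  by near: n.
move=> x x0; near=> n; have [<- <-] : u n = u' n /\ v n = v' n by near: n.
by near: n; exact: uv.
Unshelve. all: by end_near. Qed.

Lemma walk_equiv_del u v k : walk_equiv u v -> 0 < mu k ->
  (\forall n \near tree_sizes, (0 < u n)%N /\ (k <= v n)%N) ->
  walk_equiv (fun n => (u n).-1) (fun n => v n - k)%N.
Proof.
move=> uvE kp h; have [[C uC] uv] := uvE; split.
  exists C.+1; near=> n; have : (n <= u n + C)%N by near: n.
  lia.
move=> e e0; pose e' := Num.min (e / 3) 1.
have e'0 : 0 < e' by rewrite lt_min divr_gt0 ?ltr01.
have e'e : e' <= e / 3 by rewrite ge_min lexx.
have e'1 : e' <= 1 by rewrite ge_min lexx orbT.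
have [dl d0 hd] := walk_ratio_near1 kp e'0.
near=> n.
have An : 0 < walk mu n n.-1 by near: n; exact: tree_sizes_good.
have lo : expR (- (dl * (u n)%:R)) <= walk mu (u n) (v n).
  by near: n; exact: walk_equiv_lower.
have [un kv] : (0 < u n)%N /\ (k <= v n)%N by near: n.
have h1 : `|walk mu (u n) (v n) - walk mu n n.-1| <= e' * walk mu n n.-1.
  by near: n; apply: uv.
move: (hd (u n).-1 (v n) kv); rewrite prednK// => /(_ lo) h2.
move: h1 h2; rewrite !ler_norml.
set W' := walk _ _ (_ - _); set W := walk _ (u n) _; set A := walk _ n _.
rewrite -/A in An.
move=> /andP[a1 a2] /andP[b1 b2].
have W0 : 0 <= W by exact: walk_ge0.
have h3 : e' * W <= 2 * (e' * A).
  have : e' * W <= e' * ((1 + e') * A) by rewrite ler_wpM2l ?(ltW e'0)//; lra.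
  have : e' * (e' * A) <= 1 * (e' * A) by rewrite ler_wpM2r// mulr_ge0 ?(ltW e'0) ?(ltW An).
  lra.
have h4 : 3 * (e' * A) <= e * A by rewrite mulrA ler_wpM2r ?(ltW An)//; lra.
by apply/andP; split; lra.
Unshelve. all: by end_near. Qed.

(** [walk_ratio_near1] asks for a lower bound on the longer walk, which is here the unknown one.
    [walk_add] provides it, the factor [mu k] being absorbed by half of the rate. *)
Lemma walk_equiv_add u v k : walk_equiv u v -> 0 < mu k ->
  walk_equiv (fun n => (u n).+1) (fun n => v n + k)%N.
Proof.
move=> uvE kp; have [[C uC] uv] := uvE; split.
  exists C; near=> n; have : (n <= u n + C)%N by near: n.
  lia.
move=> e e0; pose e' := Num.min (e / 5) (1 / 2).
have e'0 : 0 < e' by rewrite lt_min !divr_gt0.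
have e'e : e' <= e / 5 by rewrite ge_min lexx.
have e'1 : e' <= 1 / 2 by rewrite ge_min lexx orbT.
have [dl d0 hd] := walk_ratio_near1 kp e'0.
have [C' uC'] : exists C', \forall n \near tree_sizes, (n <= u n + C')%N by exists C.
have d20 : 0 < dl / 2 by rewrite divr_gt0.
have [N hN] := expR_absorb kp d20.
near=> n.
have An : 0 < walk mu n n.-1 by near: n; exact: tree_sizes_good.
have lo : expR (- (dl / 2 * (u n)%:R)) <= walk mu (u n) (v n).
  by near: n; exact: walk_equiv_lower.
have h1 : `|walk mu (u n) (v n) - walk mu n n.-1| <= e' * walk mu n n.-1.
  by near: n; apply: uv.
have uN : (N <= (u n))%N.
  have : (n <= u n + C)%N by near: n.
  have : (N + C <= n)%N by near: n; exact: tree_sizes_large.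
  by clear; lia.
have W'lo := walk_add mu_ge0 (u n) (v n) k.
have lo' : expR (- (dl * (u n).+1%:R)) <= walk mu (u n).+1 (v n + k).
  apply: le_trans W'lo.
  apply: (@le_trans _ _ (expR (- (dl / 2 * (u n)%:R)) * expR (- (dl / 2 * (u n)%:R)))).
    rewrite -expRD ler_expR -natr1; lra.
  by rewrite ler_pM ?expR_ge0 ?hN.
have kx : (k <= v n + k)%N by rewrite leq_addl.
have := hd (u n) (v n + k)%N kx lo'; rewrite addnK => h2.
move: h1 h2; rewrite !ler_norml.
set W' := walk _ _ (_ + _); set W := walk _ (u n) _; set A := walk _ n _.
rewrite -/A in An.
move=> /andP[a1 a2] /andP[b1 b2].
have W0 : 0 <= W' by exact: walk_ge0.
have h3 : W' <= 2 * W.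
  have : e' * W' <= 1 / 2 * W' by rewrite ler_wpM2r.
  lra.
have h5 : e' * W' <= e' * (2 * ((1 + e') * A)) by rewrite ler_wpM2l ?(ltW e'0)//; lra.
have h6 : e' * (e' * A) <= 1 / 2 * (e' * A) by rewrite ler_wpM2r// mulr_ge0 ?(ltW e'0) ?(ltW An).
have h4 : 5 * (e' * A) <= e * A by rewrite mulrA ler_wpM2r ?(ltW An)//; lra.
by apply/andP; split; lra.
Unshelve. all: by end_near. Qed.

Lemma walk_equiv_adds st : all (fun k => 0 < mu k) st ->
  walk_equiv (fun n => n + size st)%N (fun n => n.-1 + sumn st)%N.
Proof.
elim: st => [_|k st IH /= /andP[kp /IH h]].
  apply: walk_equiv_near walk_equiv_id _.
  by apply: nearW => n; rewrite !addn0.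
apply: walk_equiv_near (walk_equiv_add h kp) _.
by apply: nearW => n; split; lia.
Qed.

(** The form in which the ratio limits are used: finitely many steps of positive mass are exchanged
    for others. *)
Lemma walk_equiv_dels st st' : all (fun k => 0 < mu k) st -> all (fun k => 0 < mu k) st' ->
  walk_equiv (fun n => n + size st - size st')%N (fun n => n.-1 + sumn st - sumn st')%N.
Proof.
move=> stp; elim: st' => [_|k st' IH /= /andP[kp /IH h]].
  apply: walk_equiv_near (walk_equiv_adds stp) _.
  by apply: nearW => n; rewrite !subn0.
apply: walk_equiv_near (walk_equiv_del h kp _) _.
  near=> n; have : (k + sumn st' + size st' < n)%N by near: n; exact: tree_sizes_large.
  lia.
by apply: nearW => n; split; lia.
Unshelve. all: by end_near. Qed.

Lemma walk_steps n x : 0 < walk mu n x ->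
  exists st, [/\ size st = n, sumn st = x & all (fun k => 0 < mu k) st].
Proof.
elim: n x => [|n IH] x /=.
  by case: eqP => [->|_]; rewrite ?ltxx// => _; exists [::].
move=> h; have [k] : exists k : 'I_x.+1, 0 < mu k * walk mu n (x - k).
  apply: contrapT => no; move: h; rewrite big1 ?ltxx// => k _.
  apply/eqP; rewrite eq_le mulr_ge0 ?walk_ge0// andbT leNgt; apply/negP => p.
  by apply: no; exists k.
have [->|mk] := eqVneq (mu k) 0; first by rewrite mul0r ltxx.
have mkp : 0 < mu k by rewrite lt_def mk mu_ge0.
rewrite pmulr_rgt0// => /IH[st [sz sm al]].
exists ((k : nat) :: st); split; rewrite /= ?sz ?sm ?mkp//.
have := ltn_ord k; lia.
Qed.

(* The conditional mean of one step given [N + 1] steps of sum [N + S + 1] is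
   about 1; bounded steps only account for [m] of it. *)
Lemma bulk_lower s S M (e : R) : 0 < e ->
  walk_equiv (fun n => (n - s).+1) (fun n => n - s + S.+1)%N ->
  \forall n \near tree_sizes, 1 - m - e <=
    \sum_(M <= k < (n - s).+1) mu (S.+1 + k) * forest_mass mu (n - s) k / forest_mass mu n 1.
Proof.
move=> e0 uvE; have [_ uv] := uvE.
have m1 := step_mean_lt1 law.
have m0 : 0 <= m by have := step_mean law 0; rewrite big_ord0.
(* The final bound is [(1 - e') ^+ 2 * (1 - m - e')], at least [1 - m - 3 * e']; the other two
   bounds on [e'] keep its factors nonnegative. *)
pose e' := Num.min (e / 3) (Num.min (1 / 2) (1 - m)).
have e'0 : 0 < e' by rewrite !lt_min !divr_gt0 ?subr_gt0.
have e'e : e' <= e / 3 by rewrite ge_min lexx.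
have e'1 : e' <= 1 / 2 by rewrite !ge_min lexx orbT.
have e'm : e' <= 1 - m by rewrite !ge_min lexx !orbT.
(* Beyond [M'], the size [S.+1 + k] of the step, which enters the conditional mean, may be replaced
   by the [k] of the cycle lemma. *)
have [M' [MM' M'k]] : exists M', (M <= M')%N /\ forall k, (M' <= k)%N ->
    (1 - e') * (S.+1 + k)%:R <= k%:R :> R.
  pose B : R := S.+1%:R / e'.
  exists (maxn M (Num.bound B)); split; first exact: leq_maxl.
  move=> k; rewrite geq_max => /andP[_ Bk].
  have B0 : 0 <= B by rewrite divr_ge0// ltW.
  have Bk' : B <= k%:R by rewrite (le_trans (ltW (archi_boundP B0)))// ler_nat.
  have h : S.+1%:R <= k%:R * e' by rewrite -ler_pdivrMr.
  have S0 : (0 : R) <= S.+1%:R by [].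
  have h' : 0 <= e' * S.+1%:R by rewrite mulr_ge0// ltW.
  by rewrite natrD; lra.
pose J := (S.+1 + M')%N.
have smallJ : \forall n \near tree_sizes, forall j, (j < J)%N -> 0 < mu j ->
    walk mu (n - s) (n - s + S.+1 - j) <= (1 + e') * walk mu (n - s).+1 (n - s + S.+1).
  have hj j : \forall n \near tree_sizes, 0 < mu j ->
      walk mu (n - s) (n - s + S.+1 - j) <= (1 + e') * walk mu (n - s).+1 (n - s + S.+1).
    have [jp|jn] := ltP 0 (mu j); last by apply: nearW.
    have [dl d0 hd] := walk_ratio_near1 jp e'0.
    near=> n => _.
    have lo : expR (- (dl * (n - s).+1%:R)) <= walk mu (n - s).+1 (n - s + S.+1).
      by near: n; exact: (walk_equiv_lower d0 uvE).
    have jn : (j <= n - s + S.+1)%N.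
      have : (j + s <= n)%N by near: n; exact: tree_sizes_large.
      by clear; lia.
    by have := hd _ _ jn lo; rewrite ler_norml; lra.
  elim: J => [|J' IH]; first by apply: nearW.
  near=> n => j; rewrite ltnS leq_eqVlt => /orP[/eqP ->|]; first by near: n.
  by move: j; near: n.
near=> n.
have An : 0 < walk mu n n.-1 by near: n; exact: tree_sizes_good.
have hJ : forall j, (j < J)%N -> 0 < mu j ->
    walk mu (n - s) (n - s + S.+1 - j) <= (1 + e') * walk mu (n - s).+1 (n - s + S.+1).
  by near: n.
have : `|walk mu (n - s).+1 (n - s + S.+1) - walk mu n n.-1| <= e' * walk mu n n.-1.
  by near: n; exact: uv.
have nlarge : (s + J < n)%N by near: n; exact: tree_sizes_large.
have sn : (s < n)%N by apply: leq_ltn_trans nlarge; exact: leq_addr.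
have n0 : (0 < n)%N by exact: leq_ltn_trans sn.
move: hJ; set N := (n - s)%N; have N0 : (0 < N)%N by rewrite subn_gt0.
have JN : (J <= N)%N by move: nlarge; rewrite /N; clear; lia.
set Y := walk mu N.+1 _; set A := walk mu n _ => hJ; rewrite ler_norml => /andP[YA _].
rewrite -/A in An.
have Y0 : 0 <= Y by exact: walk_ge0.
have nN : (N <= n)%N by rewrite /N leq_subr.
(* The cycle lemma for [k] trees with [N] vertices and for one tree with [n] vertices; the quotient
   [n / N] that appears is at least 1. *)
have cN k : (k <= N)%N -> k%:R * walk mu N (N - k) / A <= forest_mass mu N k / forest_mass mu n 1.
  move=> kN; have NR : 0 < N%:R :> R by rewrite ltr0n.
  have nR : 0 < n%:R :> R by rewrite ltr0n.
  have -> : forest_mass mu n 1 = A / n%:R.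
    have := @cycle_lemma R mu n 1 n0; rewrite mul1r subn1 -/A => <-.
    by rewrite mulrAC divff ?mul1r ?gt_eqF.
  rewrite -cycle_lemma// invf_div mulrA ler_wpM2r ?invr_ge0 ?(ltW An)//.
  by rewrite mulrC ler_wpM2l ?forest_mass_ge0// ler_nat.
apply: (@le_trans _ _ (\sum_(M' <= k < N.+1) (1 - e') * ((S.+1 + k)%:R * mu (S.+1 + k) * walk mu N (N - k)) / A)).
  have -> : \sum_(M' <= k < N.+1) (1 - e') * ((S.+1 + k)%:R * mu (S.+1 + k) * walk mu N (N - k)) / A =
    (1 - e') * (\sum_(J <= j < (N + S.+1).+1) j%:R * mu j * walk mu N (N + S.+1 - j)) / A.
    rewrite -mulr_suml -mulr_sumr; congr (_ * _ / _).
    rewrite /J [(S.+1 + M')%N]addnC big_addn -addSn addnK.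
    by apply: eq_bigr => k _; rewrite [(k + _)%N]addnC subnDr || rewrite [(k + S.+1)%N]addnC [(N + S.+1)%N]addnC subnDl.
  set tail := \sum_(J <= j < _) _.
  have tailE : \sum_(0 <= j < J) j%:R * mu j * walk mu N (N + S.+1 - j) + tail =
      \sum_(k < (N + S.+1).+1) k%:R * mu k * walk mu N (N + S.+1 - k).
    rewrite -(big_mkord xpredT (fun k => k%:R * mu k * walk mu N (N + S.+1 - k))).
    by rewrite -(big_cat_nat _ (n := J))// (leq_trans JN)// -addnS leq_addr.
  (* The conditional mean of a step is [(N + S.+1) / N.+1], hence at least 1. *)
  have tot : Y <= \sum_(k < (N + S.+1).+1) k%:R * mu k * walk mu N (N + S.+1 - k).
    have N1 : 0 < N.+1%:R :> R by [].
    by rewrite -(ler_pM2l N1) walk_mean -/Y ler_wpM2r// ler_nat addnS ltnS leq_addr.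
  have small : \sum_(0 <= j < J) j%:R * mu j * walk mu N (N + S.+1 - j) <= (m + e') * Y.
    apply: (@le_trans _ _ (\sum_(0 <= j < J) j%:R * mu j * ((1 + e') * Y))).
      rewrite !big_nat; apply: ler_sum => j /andP[_ jJ].
      have [muj|muj] := ltP 0 (mu j); first by rewrite ler_wpM2l ?mulr_ge0 ?hJ.
      have -> : mu j = 0 by apply/eqP; rewrite eq_le muj mu_ge0.
      by rewrite mulr0 !mul0r.
    rewrite -mulr_suml mulrA ler_wpM2r// big_mkord.
    have h1 := step_mean law J; have e1 : 0 <= 1 + e' by lra.
    have := ler_wpM2r e1 h1; move=> h2; apply: le_trans h2 _.
    have : m * e' <= 1 * e' by rewrite ler_wpM2r ?(ltW e'0) ?(ltW m1).
    lra.
  have tl : (1 - m - e') * Y <= tail by lra.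
  have tl2 : (1 - m - e') * ((1 - e') * A) <= tail.
    by apply: le_trans tl; rewrite ler_wpM2l//; lra.
  rewrite ler_pdivlMr//.
  apply: (@le_trans _ _ ((1 - e') * ((1 - m - e') * ((1 - e') * A)))); last first.
    by rewrite ler_wpM2l//; lra.
  rewrite !mulrA ler_wpM2r ?(ltW An)//.
  have q1 : 0 <= 1 - m - e' by lra.
  have q2 : 0 <= (1 - m - e') * e' ^+ 2 by rewrite mulr_ge0 ?sqr_ge0.
  have q3 : (1 - m - e') * e' <= 1 * e' by rewrite ler_wpM2r ?(ltW e'0)//; lra.
  have -> : (1 - e') * (1 - m - e') * (1 - e') =
    (1 - m - e') - 2 * ((1 - m - e') * e') + (1 - m - e') * e' ^+ 2 by ring.
  lra.
rewrite [leRHS](big_cat_nat _ (n := M')) //=; last first.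
  by rewrite leqW// (leq_trans _ JN)// leq_addl.
rewrite -[leLHS]add0r lerD//.
  by rewrite sumr_ge0// => k _; rewrite divr_ge0 ?mulr_ge0 ?forest_mass_ge0.
rewrite !big_nat; apply: ler_sum => k /andP[M'k' kN].
rewrite -[leRHS]mulrA; apply: (@le_trans _ _ (mu (S.+1 + k) * (k%:R * walk mu N (N - k) / A))); last first.
  by rewrite ler_wpM2l// cN.
have -> : (1 - e') * ((S.+1 + k)%:R * mu (S.+1 + k) * walk mu N (N - k)) / A =
  ((1 - e') * (S.+1 + k)%:R) * (mu (S.+1 + k) * (walk mu N (N - k) / A)) by ring.
have -> : mu (S.+1 + k) * (k%:R * walk mu N (N - k) / A) =
  k%:R * (mu (S.+1 + k) * (walk mu N (N - k) / A)) by ring.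
by rewrite ler_wpM2r ?M'k// mulr_ge0// divr_ge0 ?walk_ge0// ltW.
Unshelve. all: by end_near. Qed.

End asymptotics.

(** * Weights and enumeration of plane trees *)

Lemma plane_tree_nested_ind (P : plane_tree -> Prop) :
  (forall ts, (forall t, t \in ts -> P t) -> P (Node ts)) -> forall t, P t.
Proof.
move=> H; fix IH 1 => -[ts]; apply: H.
elim: ts => [t0 t00|t ts IHs t']; first by discriminate t00.
rewrite in_cons; case: eqP => [-> _|_ /IHs//]; exact: IH.
Qed.

Definition forest_size (ts : seq plane_tree) : nat := sumn (map nb_vertices ts).

Lemma forest_size_cat ts ts' : forest_size (ts ++ ts') = (forest_size ts + forest_size ts')%N.
Proof. by rewrite /forest_size map_cat sumn_cat. Qed.

Definition child_addresses (ls : seq int) (ts : seq plane_tree) : seq address :=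
  flatten [seq [seq lv.1 :: u | u <- lv.2] | lv <- zip ls (map vertices ts)].

Lemma vertices_Node ts :
  vertices (Node ts) = [::] :: child_addresses [seq Posz j | j <- iota 1 (size ts)] ts.
Proof.
rewrite /=; congr cons; rewrite /child_addresses; congr flatten.
elim: ts 1%N => [//|t ts IH] j /=; by rewrite IH.
Qed.

Lemma nb_vertices_Node ts : nb_vertices (Node ts) = (forest_size ts).+1.
Proof.
rewrite /nb_vertices vertices_Node /=; congr S; rewrite /child_addresses /forest_size.
elim: ts 1%N => [//|t ts IH] j /=; by rewrite size_cat size_map IH.
Qed.

Lemma nb_vertices_gt0 t : (0 < nb_vertices t)%N.
Proof. by case: t => ts; rewrite nb_vertices_Node. Qed.

Lemma forest_size_ge ts : (size ts <= forest_size ts)%N.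
Proof.
elim: ts => [//|t ts IH]; rewrite /forest_size /=.
have := nb_vertices_gt0 t; rewrite /forest_size in IH; lia.
Qed.

Section weights.
Variables (R : realType) (rho_w rho_b : nat -> R).

Local Notation color_law := (color_law rho_w rho_b).

Definition tree_weight (h : nat) (t : plane_tree) : R :=
  \prod_(u <- vertices t) color_law (h + size u) (nb_children t u).

Definition forest_weight (h : nat) (ts : seq plane_tree) : R :=
  \prod_(t <- ts) tree_weight h t.

Lemma prod_child_addresses (F : address -> R) j ts :
  \prod_(u <- child_addresses [seq Posz i | i <- iota j (size ts)] ts) F u =
  \prod_(i < size ts) \prod_(u <- vertices (nth leaf ts i)) F (Posz (j + i) :: u).
Proof.
elim: ts j => [|t ts IH] j; first by rewrite big_nil big_ord0.
rewrite /child_addresses /= big_cat /= big_map big_ord_recl /= addn0; congr (_ * _).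
rewrite -/(child_addresses _ ts) IH; apply: eq_bigr => i _.
by apply: eq_bigr => u _; rewrite /bump /= addSnnS.
Qed.

Lemma tree_weight_Node h ts :
  tree_weight h (Node ts) = color_law h (size ts) * forest_weight h.+1 ts.
Proof.
rewrite /tree_weight vertices_Node big_cons /= addn0; congr (_ * _).
rewrite prod_child_addresses /forest_weight (big_nth leaf) big_mkord.
by apply: eq_bigr => i _; apply: eq_bigr => u _; rewrite add1n /= addSnnS.
Qed.

Lemma tree_weight_leaf h : tree_weight h leaf = color_law h 0.
Proof. by rewrite tree_weight_Node /forest_weight big_nil mulr1. Qed.

Lemma tree_weightSS h t : tree_weight h.+2 t = tree_weight h t.
Proof. by apply: eq_bigr => u _; rewrite /Defs.color_law !addSn /= negbK. Qed.

Lemma forest_weightSS h ts : forest_weight h.+2 ts = forest_weight h ts.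
Proof. by apply: eq_bigr => u _; rewrite tree_weightSS. Qed.

Lemma forest_weight_cat h ts ts' :
  forest_weight h (ts ++ ts') = forest_weight h ts * forest_weight h ts'.
Proof. exact: big_cat. Qed.

Lemma forest_weight_cons h t ts :
  forest_weight h (t :: ts) = tree_weight h t * forest_weight h ts.
Proof. exact: big_cons. Qed.

Lemma GW_weight t : GW rho_w rho_b t = tree_weight 0 t.
Proof.
rewrite /GW /tree_weight [RHS](bigID (fun u => ~~ odd (size u))) /=; congr (_ * _).
  by apply: eq_bigr => u /negbTE ou; rewrite /Defs.color_law add0n ou.
apply: eq_big => [u|u]; first by rewrite negbK.
by move=> ou; rewrite /Defs.color_law add0n ou.
Qed.

End weights.

(* The inverse of [graft k] is the step of the Janson-Stefansson bijection: in a
   white forest whose first tree is not a leaf, the first black child of its root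
   is replaced by its [k] white subtrees, put in front of the forest. *)
Definition graft (k : nat) (f : seq plane_tree) : seq plane_tree :=
  Node (Node (take k f) :: children (nth leaf f k)) :: drop k.+1 f.

(** The recursion of [forest_mass]: a step 0 puts a leaf in front, a step [k + 1] is a graft with
    parameter [k]. *)
Fixpoint forests (n m : nat) : seq (seq plane_tree) :=
  match n, m with
  | 0%N, _ => if m == 0%N then [:: [::]] else [::]
  | _.+1, 0%N => [::]
  | n'.+1, m'.+1 => [seq leaf :: f | f <- forests n' m'] ++
      flatten [seq [seq graft k f | f <- forests n' (m'.+1 + k)] | k <- iota 0 n']
  end.

Lemma split_graft k f : (k < size f)%N ->
  f = take k f ++ Node (children (nth leaf f k)) :: drop k.+1 f.
Proof.
move=> kf; rewrite -[LHS](cat_take_drop k); congr (_ ++ _).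
by rewrite (drop_nth leaf)//; case: nth.
Qed.

Lemma forest_size_graft k f : (k < size f)%N -> forest_size (graft k f) = (forest_size f).+1.
Proof.
move=> kf; rewrite [in RHS](split_graft kf) forest_size_cat.
rewrite /graft /forest_size /= !nb_vertices_Node /forest_size /= nb_vertices_Node /forest_size; lia.
Qed.

Lemma graft_cat ws rest f :
  graft (size ws) (ws ++ Node rest :: f) = Node (Node ws :: rest) :: f.
Proof. by rewrite /graft take_size_cat// nth_cat ltnn subnn /= drop_cat ltnNge leqnSn /= subSn// subnn /= drop0. Qed.

Lemma mem_forests n m f : (f \in forests n m) = (size f == m) && (forest_size f == n).
Proof.
elim: n m f => [|n IH] m f.
  case: m f => [|m] [|t f] //=; rewrite in_nil; apply/esym/negbTE.
  by have := nb_vertices_gt0 t; rewrite negb_and /forest_size /=; lia.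
case: m => [|m] /=.
  by case: f => [|t f] //; rewrite /forest_size.
rewrite mem_cat; apply/orP/idP.
  case=> [/mapP[g]|/flatten_mapP[k _ /mapP[g]]]; rewrite IH => /andP[/eqP sg /eqP fg] ->.
    by rewrite /= sg /forest_size /= nb_vertices_Node add1n -/(forest_size g) fg !eqxx.
  rewrite forest_size_graft ?sg ?fg ?eqxx ?andbT /= ?size_drop ?sg; lia.
case: f => [//|[[|[ws] rest]] f] /andP[/= /eqP[sf] /eqP].
  rewrite /forest_size /= nb_vertices_Node add1n => -[nf]; left.
  by apply: map_f; rewrite IH sf eqxx -nf eqxx.
rewrite -graft_cat => fs; right; apply/flatten_mapP; exists (size ws).
  rewrite mem_iota; move: fs; rewrite forest_size_graft; last by rewrite size_cat /=; lia.
  rewrite forest_size_cat => -[<-]; have := forest_size_ge ws.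
  have e : forest_size (Node rest :: f) = (nb_vertices (Node rest) + forest_size f)%N by [].
  by rewrite e; have := nb_vertices_gt0 (Node rest); lia.
apply: map_f; rewrite IH size_cat /= sf addnC addSnnS eqxx /=.
by move: fs; rewrite forest_size_graft ?size_cat /=; [case=> ->|lia].
Qed.

Lemma uniq_forests n m : uniq (forests n m).
Proof.
elim: n m => [|n IH] [|m] //=.
rewrite cat_uniq map_inj_uniq ?IH; last by move=> f g [].
rewrite /=; apply/andP; split.
  apply/hasPn => f /flatten_mapP[k _ /mapP[g _ ->]].
  by apply/negP => /mapP[g' _].
have gsz k f : f \in forests n (m.+1 + k) -> (k < size f)%N.
  by rewrite mem_forests => /andP[/eqP -> _]; rewrite addSn ltnS leq_addl.
(* [k] is read off as the degree of the first black child of the first root. *)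
have ginj k k' f f' : f \in forests n (m.+1 + k) -> f' \in forests n (m.+1 + k') ->
    graft k f = graft k' f' -> k = k' /\ f = f'.
  move=> /gsz kf /gsz kf' [e1 e2 e3].
  have kk : k = k' by have := congr1 size e1; rewrite !size_takel// ltnW.
  subst k'; split => //; rewrite (split_graft kf) (split_graft kf').
  by rewrite e1 e2 e3.
elim: (iota 0 n) (iota_uniq 0 n) => [//|k ks IHk] /= /andP[kks uks].
rewrite cat_uniq IHk// andbT; apply/andP; split.
  by rewrite map_inj_in_uniq ?IH// => f g ff fg /(ginj _ _ _ _ ff fg)[].
apply/hasPn => f /flatten_mapP[k' k'ks /mapP[g gin ->]].
apply/negP => /mapP[g' g'in e].
have [kk _] := ginj _ _ _ _ gin g'in e.
by move: kks; rewrite -kk k'ks.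
Qed.

Section forest_sums.
Variables (R : realType) (rho_w rho_b : nat -> R) (p : R).
Hypothesis geom_w : forall k, rho_w k = (1 - p) * p ^+ k.

Definition step_of (k : nat) : R := if k is k'.+1 then p * rho_b k' else 1 - p.

(** Grafting gives a white root one more child, which multiplies its geometric weight by [p]
    whatever its degree, and creates a black vertex of weight [rho_b k]. *)
Lemma forest_weight_graft k f : (k < size f)%N ->
  forest_weight rho_w rho_b 0 (graft k f) = step_of k.+1 * forest_weight rho_w rho_b 0 f.
Proof.
move=> kf; rewrite [in RHS](split_graft kf) forest_weight_cat /graft !forest_weight_cons.
rewrite !tree_weight_Node forest_weight_cons tree_weight_Node forest_weightSS.
by rewrite size_takel ?(ltnW kf)// /color_law /= !geom_w exprS; ring.
Qed.

Lemma sum_forests n m :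
  \sum_(f <- forests n m) forest_weight rho_w rho_b 0 f = forest_mass step_of n m.
Proof.
elim: n m => [|n IH] [|m] //=; rewrite ?big_nil//.
  by rewrite big_seq1 /forest_weight big_nil.
rewrite big_cat /= big_map big_ord_recl /= addn0 -IH mulr_sumr; congr (_ + _).
  apply: eq_bigr => f _; rewrite forest_weight_cons tree_weight_leaf.
  by rewrite /color_law /= geom_w expr0 mulr1.
rewrite big_flatten /= big_map -{1}(subn0 n) -/(index_iota 0 n) big_mkord.
apply: eq_bigr => k _; rewrite big_map /bump /= add1n -addSnnS -IH mulr_sumr.
rewrite big_seq [RHS]big_seq; apply: eq_bigr => f.
rewrite mem_forests => /andP[/eqP sf _].
by rewrite forest_weight_graft// sf addSn ltnS leq_addl.
Qed.

End forest_sums.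

(** * Patterns around the vertex of infinite degree *)

(* A pattern describes the tree up to [u_infty]: the left and right siblings of
   each vertex of the spine, with their descendants, and the first and last
   children of [u_infty], with their descendants. *)
Definition context := seq (seq plane_tree * seq plane_tree).
Definition pattern : Type := (context * (seq plane_tree * seq plane_tree))%type.

Fixpoint fill (c : context) (t : plane_tree) : plane_tree :=
  if c is lr :: c' then Node (lr.1 ++ fill c' t :: lr.2) else t.

Definition plug (pt : pattern) (f : seq plane_tree) : plane_tree :=
  fill pt.1 (Node (pt.2.1 ++ f ++ pt.2.2)).

Definition context_size (c : context) : nat :=
  sumn [seq (forest_size lr.1 + forest_size lr.2).+1 | lr <- c].

(** The outer successor counts the filled vertex itself. *)
Definition pattern_size (pt : pattern) : nat :=
  (context_size pt.1 + forest_size pt.2.1 + forest_size pt.2.2).+1.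

Lemma nb_vertices_fill c t : nb_vertices (fill c t) = (context_size c + nb_vertices t)%N.
Proof.
elim: c => [//|lr c IH] /=; rewrite nb_vertices_Node forest_size_cat.
by rewrite {2}/forest_size /= IH -/(forest_size _) /context_size /=; lia.
Qed.

Lemma nb_vertices_plug pt f : nb_vertices (plug pt f) = (pattern_size pt + forest_size f)%N.
Proof. by rewrite nb_vertices_fill nb_vertices_Node !forest_size_cat /pattern_size; lia. Qed.

Fixpoint degrees_below (M : nat) (t : plane_tree) : bool :=
  let: Node ts := t in (size ts < M)%N && all (degrees_below M) ts.

Definition context_below (M : nat) (c : context) : bool :=
  all (fun lr => [&& (size lr.1 + size lr.2).+1 < M, all (degrees_below M) lr.1
                   & all (degrees_below M) lr.2])%N c.

Lemma degrees_below_le M M' t : (M <= M')%N -> degrees_below M t -> degrees_below M' t.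
Proof.
move=> MM; elim/plane_tree_nested_ind: t => ts IH /= /andP[sz /allP al].
by rewrite (leq_trans sz MM); apply/allP => t tin; apply: IH => //; exact: al.
Qed.

Lemma degrees_below_forest ts : exists M, all (degrees_below M) ts.
Proof.
have one t : exists M, degrees_below M t.
  elim/plane_tree_nested_ind: t => ts' IH.
  have [M hM] : exists M, all (degrees_below M) ts'.
    elim: ts' IH => [|t ts' IH'] IH; first by exists 0%N.
    have [M1 h1] := IH t (mem_head _ _).
    have [M2 h2] : exists M, all (degrees_below M) ts'.
      by apply: IH' => t' t'in; apply: IH; rewrite in_cons t'in orbT.
    exists (maxn M1 M2); rewrite /= (degrees_below_le (leq_maxl _ _) h1).
    by apply: sub_all h2 => t'; apply: degrees_below_le; exact: leq_maxr.
  exists (maxn (size ts').+1 M); rewrite /= leq_maxl.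
  by apply: sub_all hM => t'; apply: degrees_below_le; exact: leq_maxr.
elim: ts => [|t ts [M2 h2]]; first by exists 0%N.
have [M1 h1] := one t.
exists (maxn M1 M2); rewrite /= (degrees_below_le (leq_maxl _ _) h1).
by apply: sub_all h2 => t'; apply: degrees_below_le; exact: leq_maxr.
Qed.

Definition pattern_below (M : nat) (pt : pattern) : bool :=
  [&& context_below M pt.1, all (degrees_below M) pt.2.1 & all (degrees_below M) pt.2.2].

Lemma context_below_le M M' c : (M <= M')%N -> context_below M c -> context_below M' c.
Proof.
move=> MM; apply: sub_all => lr /and3P[h1 h2 h3]; apply/and3P; split.
- exact: leq_trans MM.
- by apply: sub_all h2 => t; exact: degrees_below_le.
- by apply: sub_all h3 => t; exact: degrees_below_le.
Qed.

Lemma pattern_below_le M M' pt : (M <= M')%N -> pattern_below M pt -> pattern_below M' pt.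
Proof.
move=> MM /and3P[h1 h2 h3]; apply/and3P; split; first exact: context_below_le h1.
- by apply: sub_all h2 => t; exact: degrees_below_le.
- by apply: sub_all h3 => t; exact: degrees_below_le.
Qed.

Lemma patterns_below (pts : seq pattern) : exists M, all (pattern_below M) pts.
Proof.
have one pt : exists M, pattern_below M pt.
  case: pt => c [lt rt].
  have [M1 h1] := degrees_below_forest (lt ++ rt).
  have [M2 h2] : exists M, context_below M c.
    elim: c => [|[l r] c [M2 h2]]; first by exists 0%N.
    have [M3 h3] := degrees_below_forest (l ++ r).
    exists (maxn M2 (maxn M3 (size l + size r).+2)).
    rewrite /= (context_below_le (leq_maxl _ _) h2) andbT; apply/and3P; split; first by lia.
      move: h3; rewrite all_cat => /andP[h3 _].
      by apply: sub_all h3 => t; apply: degrees_below_le; lia.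
    move: h3; rewrite all_cat => /andP[_ h3].
    by apply: sub_all h3 => t; apply: degrees_below_le; lia.
  exists (maxn M1 M2); rewrite /pattern_below /= (context_below_le (leq_maxr _ _) h2) /=.
  rewrite -all_cat; apply: sub_all h1 => t; apply: degrees_below_le; exact: leq_maxl.
elim: pts => [|pt pts [M2 h2]]; first by exists 0%N.
have [M1 h1] := one pt.
exists (maxn M1 M2); rewrite /= (pattern_below_le (leq_maxl _ _) h1).
by apply: sub_all h2 => t'; apply: pattern_below_le; exact: leq_maxr.
Qed.

Lemma fill_not_below M c ts : (M <= size ts)%N -> ~~ degrees_below M (fill c (Node ts)).
Proof.
move=> Mts; elim: c => [|lr c IH] /=; first by rewrite ltnNge Mts.
by rewrite negb_and all_cat /= negb_and [X in _ || (_ || X)]negb_and IH !orbT.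
Qed.

(** The pivot is the first entry that violates [P]. With [P] bounding the degrees by [M], this finds
    the child through which the spine continues. *)
Lemma cat_cons_inj (T : Type) (P : pred T) (l l' r r' : seq T) x x' :
  all P l -> all P l' -> ~~ P x -> ~~ P x' ->
  l ++ x :: r = l' ++ x' :: r' -> [/\ l = l', x = x' & r = r'].
Proof.
elim: l l' => [|y l IH] [|y' l'] /=.
- by move=> _ _ _ _ [-> ->].
- by move=> _ /andP[Py' _] nx _ [e _]; move: nx; rewrite e Py'.
- by move=> /andP[Py _] _ _ nx' [e _]; move: nx'; rewrite -e Py.
- by move=> /andP[_ h] /andP[_ h'] nx nx' [-> e]; have [-> -> ->] := IH _ h h' nx nx' e.
Qed.

(* The filling has at least [M] children, more than any vertex of the pattern:
   this is how the filled vertex is recognized. *)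
Lemma plug_inj M pt pt' f f' : pattern_below M pt -> pattern_below M pt' ->
  size pt.2.1 = size pt'.2.1 -> size pt.2.2 = size pt'.2.2 ->
  (M <= size f)%N -> (M <= size f')%N ->
  plug pt f = plug pt' f' -> pt = pt' /\ f = f'.
Proof.
case: pt pt' => [c [lt rt]] [c' [lt' rt']] /and3P[/= cb lb rb] /and3P[/= cb' lb' rb'] /= sl sr Mf Mf'.
have big g g' g'' : (M <= size g)%N -> (M <= size (g' ++ g ++ g''))%N.
  by rewrite !size_cat; lia.
rewrite /plug /=; elim: c c' cb cb' => [|[l r] c IH] [|[l' r'] c'] /=.
- move=> _ _ [] /eqP; rewrite eqseq_cat// => /andP[/eqP -> /eqP e].
  have : (size f + size rt = size f' + size rt')%N by rewrite -!size_cat e.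
  rewrite sr => /addIn sf.
  by move/eqP: e; rewrite eqseq_cat// => /andP[/eqP -> /eqP ->].
- move=> _ /andP[/and3P[/= h _ _] _] [] /(congr1 size); rewrite /= !size_cat /=; lia.
- move=> /andP[/and3P[/= h _ _] _] _ [] /(congr1 size); rewrite /= !size_cat /=; lia.
- move=> /andP[/and3P[_ lb1 rb1] cb] /andP[/and3P[_ lb1' rb1'] cb'] [] e.
  have [] := cat_cons_inj lb1 lb1' _ _ e; try by apply: fill_not_below; exact: big.
  by move=> -> /(IH _ cb cb')[[-> -> ->] ->] ->.
Qed.

Section pattern_weights.
Variables (R : realType) (rho_w rho_b : nat -> R).

Local Notation color_law := (color_law rho_w rho_b).
Local Notation tree_weight := (tree_weight rho_w rho_b).
Local Notation forest_weight := (forest_weight rho_w rho_b).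

Fixpoint context_weight (h : nat) (c : context) : R :=
  if c is lr :: c' then
    color_law h (size lr.1 + size lr.2).+1 * forest_weight h.+1 lr.1 * forest_weight h.+1 lr.2 *
    context_weight h.+1 c'
  else 1.

Definition pattern_weight (pt : pattern) : R :=
  context_weight 0 pt.1 * (forest_weight 0 pt.2.1 * forest_weight 0 pt.2.2).

Lemma tree_weight_fill h c t :
  tree_weight h (fill c t) = context_weight h c * tree_weight (h + size c) t.
Proof.
elim: c h => [|lr c IH] h /=; first by rewrite mul1r addn0.
rewrite tree_weight_Node forest_weight_cat forest_weight_cons IH size_cat /= addnS addSnnS.
by ring.
Qed.

Lemma tree_weight_odd h t : odd h -> tree_weight h t = tree_weight 1 t.
Proof.
rewrite -[h]odd_double_half => oh; rewrite oddD odd_double addbF in oh.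
have -> : odd h = true by case: (odd h) oh.
elim: h./2 => [//|k IH]; by rewrite doubleS !addnS tree_weightSS.
Qed.

Lemma tree_weight_plug pt f : odd (size pt.1) ->
  tree_weight 0 (plug pt f) =
  pattern_weight pt * (rho_b (size pt.2.1 + size pt.2.2 + size f)%N * forest_weight 0 f).
Proof.
move=> od; rewrite tree_weight_fill tree_weight_odd// tree_weight_Node !forest_weight_cat.
rewrite !forest_weightSS !size_cat /pattern_weight /color_law /=.
by rewrite [(size f + _)%N]addnC addnA; ring.
Qed.

Hypothesis rho_ge0 : forall h k, 0 <= color_law h k.

Lemma tree_weight_ge0 h t : 0 <= tree_weight h t.
Proof. exact: prodr_ge0. Qed.

Lemma forest_weight_ge0 h f : 0 <= forest_weight h f.
Proof. by apply: prodr_ge0 => t _; exact: tree_weight_ge0. Qed.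

Lemma context_weight_ge0 h c : 0 <= context_weight h c.
Proof.
elim: c h => [|lr c IH] h; first exact: ler01.
by rewrite /= !mulr_ge0 ?forest_weight_ge0.
Qed.

Lemma pattern_weight_ge0 pt : 0 <= pattern_weight pt.
Proof. by rewrite !mulr_ge0 ?forest_weight_ge0 ?context_weight_ge0. Qed.

Variables (p m : R).
Hypothesis p0 : 0 < p.
Hypothesis geom_w : forall k, rho_w k = (1 - p) * p ^+ k.
Let mu := step_of rho_b p.
Hypothesis law : step_law mu m.

Lemma big_child (S : nat) : exists k, 0 < rho_b (S + k)%N.
Proof.
apply: contrapT => h.
have z k : (S.+1 <= k)%N -> mu k = 0.
  case: k => [//|k]; rewrite ltnS /mu /= => Sk.
  have -> : rho_b k = 0; last by rewrite mulr0.
  apply/eqP; rewrite eq_le (rho_ge0 1 k) andbT leNgt; apply/negP => kp.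
  by apply: h; exists (k - S)%N; rewrite subnKC.
have [K] := step_heavy law (\sum_(0 <= k < S.+1) mu k * 2 ^+ k) (ltr1n R 2).
apply/negP; rewrite -leNgt -(big_mkord xpredT (fun k => mu k * 2 ^+ k)).
have [KS|SK] := leqP K S.+1.
  rewrite [leRHS](big_cat_nat _ (n := K))//= lerDl sumr_ge0// => k _.
  by rewrite mulr_ge0 ?exprn_ge0 ?(step_ge0 law).
rewrite (big_cat_nat _ (n := S.+1))//=; last exact: ltnW.
rewrite [X in _ + X]big1_seq ?addr0// => k /andP[_].
by rewrite mem_index_iota => /andP[Sk _]; rewrite z ?mul0r.
Qed.

(** Closing the pattern with [k] leaves, where [rho_b (S + k)] is positive, gives a tree of positive
    weight with [s + k] vertices, hence a list [st] of [s + k] steps of positive mass and sum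
    [s + k - 1]. Adding one step [(S + k).+1] and [k] zeros and removing [st] leads from [n] steps
    of sum [n - 1] to [n - s + 1] steps of sum [n - s + S + 1]. *)
Lemma pattern_steps pt : odd (size pt.1) -> 0 < pattern_weight pt ->
  walk_equiv mu (fun n => (n - pattern_size pt).+1)
    (fun n => n - pattern_size pt + (size pt.2.1 + size pt.2.2).+1)%N.
Proof.
move=> od Wp; set s := pattern_size pt; set S := (size _ + size _)%N.
have [k kp] := big_child S.
pose t := plug pt (nseq k leaf).
have fsz : forest_size (nseq k leaf) = k.
  by elim: k {kp t} => [//|k IH]; rewrite /forest_size /= -/(forest_size _) IH.
have tp : 0 < tree_weight 0 t.
  rewrite tree_weight_plug// pmulr_rgt0// size_nseq pmulr_rgt0//.
  rewrite /forest_weight big_nseq; elim: (k) => [|k' IH] /=; first by rewrite ltr01.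
  rewrite pmulr_rgt0// tree_weight_leaf /color_law /=.
  by have := step_gt0 law; rewrite /mu /= geom_w expr0 mulr1.
have tn : nb_vertices t = (s + k)%N by rewrite nb_vertices_plug fsz.
have : 0 < forest_mass mu (s + k) 1.
  rewrite -(sum_forests rho_b geom_w).
  have tin : [:: t] \in forests (s + k) 1 by rewrite mem_forests /forest_size /= tn addn0 !eqxx.
  rewrite (big_rem _ tin) /= ltr_pwDl//.
    by rewrite /forest_weight big_seq1.
  by rewrite sumr_ge0// => f _; exact: forest_weight_ge0.
move=> /lt_le_trans /(_ (tree_mass_le_walk law _)) /(walk_steps law)[st [sz sm al]].
have Sp : 0 < mu (S + k).+1 by rewrite mulr_gt0.
have addp : all (fun j => 0 < mu j) ((S + k).+1 :: nseq k 0%N).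
  by rewrite /= Sp /= all_nseq (step_gt0 law) orbT.
apply: walk_equiv_near (walk_equiv_dels law addp al) _.
near=> n; have : (s + k < n)%N by near: n; exact: tree_sizes_large.
rewrite sz /= size_nseq sumn_nseq mul0n => sn.
have sm' : (sumn st).+1 = (s + k)%N by rewrite sm.
clear -sn sm'; lia.
Unshelve. all: by end_near. Qed.

(** With [k] trees filled in, the filled vertex is black with weight [rho_b (S + k)], that is,
    [mu (S + k).+1 / p]; this is the origin of the division by [p]. The rest is [bulk_lower], except
    for patterns of weight 0, to which [pattern_steps] does not apply. *)
Lemma pattern_lower pt M (e : R) : odd (size pt.1) -> 0 < e ->
  \forall n \near tree_sizes mu, pattern_weight pt * ((1 - m) / p) - e <=
    (\sum_(M <= k < (n - pattern_size pt).+1)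
      \sum_(f <- forests (n - pattern_size pt) k) tree_weight 0 (plug pt f)) / forest_mass mu n 1.
Proof.
move=> od e0; have W0 := pattern_weight_ge0 pt.
set W := pattern_weight pt in W0 *.
have [W0'|Wp] := eqVneq W 0.
  apply: nearW => n; rewrite W0' mul0r add0r; apply: (@le_trans _ _ 0); first by rewrite oppr_le0 ltW.
  rewrite divr_ge0 ?forest_mass_ge0 ?sumr_ge0//; last by move=> k; exact: (step_ge0 law).
  by move=> k _; rewrite sumr_ge0// => f _; exact: tree_weight_ge0.
have {}Wp : 0 < W by rewrite lt_def Wp.
have Wq : 0 <= W / p by rewrite divr_ge0 ?(ltW p0).
have e0' : 0 < e * p / W by apply: divr_gt0 => //; apply: mulr_gt0.
have := bulk_lower law M e0' (pattern_steps od Wp).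
apply: filterS => n h.
set s := pattern_size pt in h *; set S := (size pt.2.1 + size pt.2.2)%N in h *.
have -> : W * ((1 - m) / p) - e = W / p * (1 - m - e * p / W) by field; rewrite !gt_eqF.
apply: le_trans (ler_wpM2l Wq h) _.
rewrite mulr_sumr mulr_suml; apply: ler_sum => k _.
rewrite mulrA ler_wpM2r ?invr_ge0 ?forest_mass_ge0//; first by move=> j; exact: (step_ge0 law).
rewrite -(sum_forests rho_b geom_w) [W / p * _]mulrC [mu _]/= mulr_sumr mulr_suml.
rewrite big_seq [leRHS]big_seq. apply: ler_sum => f; rewrite mem_forests => /andP[/eqP sf _].
rewrite tree_weight_plug// sf -/S -/W.
have pn0 : p != 0 by rewrite gt_eqF.
rewrite le_eqVlt; apply/orP; left; apply/eqP; by field.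
Qed.

End pattern_weights.

(** * The limit tree on a pattern *)

Lemma mem_zip1 (S T : eqType) (s : seq S) (t : seq T) x y : (x, y) \in zip s t -> x \in s.
Proof.
elim: s t => [|x' s IH] [|y' t] //=; rewrite !in_cons xpair_eqE.
by case/orP => [/andP[-> //]|/IH ->]; rewrite orbT.
Qed.

Section branch.
Variable V : eqType.
Implicit Types (ls : seq int) (As : seq (seq (address * V))).

Definition branch ls As : seq (address * V) :=
  flatten [seq [seq (lA.1 :: a.1, a.2) | a <- lA.2] | lA <- zip ls As].

Lemma mem_branch ls As l A a : (l, A) \in zip ls As -> a \in A ->
  (l :: a.1, a.2) \in branch ls As.
Proof. by move=> lA aA; apply/flatten_mapP; exists (l, A) => //; apply/mapP; exists a. Qed.

Lemma branch_cat ls ls' As As' : size ls = size As ->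
  branch (ls ++ ls') (As ++ As') = branch ls As ++ branch ls' As'.
Proof. by move=> sz; rewrite /branch zip_cat// map_cat flatten_cat. Qed.

Lemma branch_uniq ls As : uniq ls -> all (fun A => uniq (map fst A)) As ->
  uniq (map fst (branch ls As)).
Proof.
elim: ls As => [|l ls IH] [|A As] //= /andP[lls uls] /andP[uA uAs].
rewrite /branch /= map_cat cat_uniq -/(branch ls As) IH// andbT; apply/andP; split.
  rewrite -map_comp (eq_map (g := cons l \o fst))// map_comp map_inj_uniq//.
  by move=> u v [].
apply/hasPn => u /mapP[a /flatten_mapP[[l' A'] lA' /mapP[b _ ->]] ->] /=.
apply/negP => /mapP[c /mapP[e _ ->] [e1 _]]; subst l'.
by move: lls; rewrite (mem_zip1 lA').
Qed.

Lemma prod_branch (R : realType) ls As (F : address * V -> R) : size ls = size As ->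
  \prod_(a <- branch ls As) F a =
  \prod_(lA <- zip ls As) \prod_(a <- lA.2) F (lA.1 :: a.1, a.2).
Proof.
move=> sz; rewrite /branch big_flatten big_map; apply: eq_bigr => lA _.
by rewrite big_map.
Qed.

End branch.

Definition child_labels (j n : nat) : seq int := [seq Posz i | i <- iota j n].

(* The labels [-n, ..., -1], in planar order. *)
Definition right_labels (n : nat) : seq int := [seq - Posz i | i <- rev (iota 1 n)].

Lemma size_child_labels j n : size (child_labels j n) = n.
Proof. by rewrite size_map size_iota. Qed.

Lemma size_right_labels n : size (right_labels n) = n.
Proof. by rewrite size_map size_rev size_iota. Qed.

Lemma uniq_child_labels j n : uniq (child_labels j n).
Proof. by rewrite map_inj_uniq ?iota_uniq// => x y []. Qed.

Lemma uniq_right_labels n : uniq (right_labels n).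
Proof. by rewrite map_inj_uniq ?rev_uniq ?iota_uniq// => x y /oppr_inj[]. Qed.

Lemma mem_child_labels j n l : l \in child_labels j n -> exists2 i, l = Posz i & (j <= i < j + n)%N.
Proof. by case/mapP => i; rewrite mem_iota => h ->; exists i. Qed.

Lemma mem_right_labels n l : l \in right_labels n -> exists2 i, l = - Posz i & (1 <= i < 1 + n)%N.
Proof. by case/mapP => i; rewrite mem_rev mem_iota => h ->; exists i. Qed.

Definition tree_degrees (t : plane_tree) : seq (address * nat) :=
  [seq (v, nb_children t v) | v <- vertices t].

Lemma tree_degrees_Node ts : tree_degrees (Node ts) =
  ([::], size ts) :: branch (child_labels 1 (size ts)) (map tree_degrees ts).
Proof.
rewrite /tree_degrees vertices_Node map_cons /=; congr cons.
rewrite /child_addresses /branch map_flatten -map_comp; congr flatten.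
have zipm (T U W : Type) (f : U -> W) (s : seq T) (s' : seq U) :
    zip s (map f s') = [seq (x.1, f x.2) | x <- zip s s'].
  by elim: s s' => [|x s IH] [|y s'] //=; rewrite IH.
rewrite /child_labels -/(child_labels 1 (size ts)) !zipm -!map_comp.
apply: (eq_in_map _ _ _).1 => -[l t] lt /=; rewrite -!map_comp; apply: eq_map => v /=.
congr (_, _); move: lt; rewrite /child_labels.
suff gen j ts' : (forall i, nth leaf ts (j + i) = nth leaf ts' i) ->
    (l, t) \in zip [seq Posz i | i <- iota j.+1 (size ts')] ts' ->
    nb_children (Node ts) (l :: v) = nb_children t v by apply: (gen 0%N).
elim: ts' j => [//|t' ts' IH] j h; rewrite /= in_cons xpair_eqE => /orP[/andP[/eqP -> /eqP ->]|].
  by have /= := h 0%N; rewrite addn0 => ->.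
by apply: IH => i; rewrite addSnnS h.
Qed.

Lemma vertices_uniq t : uniq (vertices t).
Proof.
have e (t' : plane_tree) : map fst (tree_degrees t') = vertices t'.
  by rewrite /tree_degrees -map_comp map_id.
rewrite -e; elim/plane_tree_nested_ind: t => ts IH.
rewrite tree_degrees_Node /= branch_uniq ?uniq_child_labels ?andbT//.
  by apply/negP => /mapP[a /flatten_mapP[lA _ /mapP[b _ ->]]].
by rewrite all_map; apply/allP => t tin /=; exact: IH.
Qed.

Lemma tree_degrees_uniq t : uniq (map fst (tree_degrees t)).
Proof. by rewrite -map_comp map_id; exact: vertices_uniq. Qed.

(* The degrees prescribed by a pattern off the spine, by address relative to the
   bottom of the spine. *)
Fixpoint pattern_degrees (c : context) (lr : seq plane_tree * seq plane_tree) :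
    seq (address * nat) :=
  if c is lr' :: c' then
    branch (child_labels 1 (size lr'.1 + size lr'.2).+1)
      (map tree_degrees lr'.1 ++ pattern_degrees c' lr :: map tree_degrees lr'.2)
  else
    branch (child_labels 1 (size lr.1) ++ right_labels (size lr.2))
      (map tree_degrees lr.1 ++ map tree_degrees lr.2).

Lemma pattern_degrees_uniq c lr : uniq (map fst (pattern_degrees c lr)).
Proof.
have au ts : all (fun A : seq (address * nat) => uniq (map fst A)) (map tree_degrees ts).
  by rewrite all_map; apply/allP => t _; exact: tree_degrees_uniq.
elim: c => [|lr' c IH] /=.
  rewrite branch_uniq ?all_cat ?au// cat_uniq uniq_child_labels uniq_right_labels andbT.
  apply/hasPn => l /mem_right_labels[i -> hi]; apply/negP => /mem_child_labels[j]; lia.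
by rewrite branch_uniq ?uniq_child_labels// all_cat /= !au IH.
Qed.

Definition context_steps (c : context) : seq (nat * nat) :=
  [seq ((size lr.1 + size lr.2).+1, (size lr.1).+1) | lr <- c].

(** [pt.1] describes all spine vertices but the top one, hence the successor. The conditions bear on
    finitely many sources, each being assigned one value, so that independence gives the probability
    as a product. *)
Definition on_pattern (L : nat) (S : nat -> nat * nat) (xi : address -> nat) (pt : pattern) : Prop :=
  [/\ (2 * L = (size pt.1).+1)%N,
      forall h, (h < size pt.1)%N -> S h = nth (0, 0)%N (context_steps pt.1) h &
      forall a, a \in pattern_degrees pt.1 pt.2 -> xi a.1 = a.2].

Lemma mem_zip_map (S T U : eqType) (f : T -> U) (s : seq S) (t : seq T) x y :
  (x, y) \in zip s t -> (x, f y) \in zip s (map f t).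
Proof.
elim: s t => [|x' s IH] [|y' t] //=; rewrite !in_cons !xpair_eqE.
by case/orP => [/andP[-> /eqP ->]|/IH ->]; rewrite ?eqxx ?orbT.
Qed.

Lemma keep_lr_middle (T : Type) r (lt f rt : seq T) : size lt = r -> size rt = r ->
  keep_lr r (lt ++ f ++ rt) = lt ++ rt.
Proof.
move=> slt srt; rewrite /keep_lr !size_cat slt srt; case: leqP => sf.
  by have -> : f = [::] by apply: size0nil; lia.
rewrite take_size_cat// catA drop_cat size_cat slt ifN; last by lia.
by congr (_ ++ _); rewrite (_ : (_ - _ - _ = 0)%N) ?drop0//; lia.
Qed.

(** * Balls of the limit tree on a pattern *)

Section on_pattern_ball.
Variables (L : nat) (S : nat -> nat * nat) (xi : address -> nat).

Let T := spine_tree L S xi.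

Definition on_spine (u : address) : bool := (size u < 2 * L)%N && (u == spine S (size u)).

Lemma spine_treeE u : in_tree T u ->
  T u = if on_spine u then
          if (size u).+1 == (2 * L)%N then None else Some (S (size u)).1
        else Some (xi u).
Proof. by rewrite in_tree_prune /= /prune => ->. Qed.

Definition off_spine (u : address) : Prop := forall v, ~~ on_spine (u ++ v).

Lemma off_spine_rcons u l : off_spine u -> off_spine (rcons u l).
Proof. by move=> ou v; rewrite cat_rcons. Qed.

Lemma size_spine h : size (spine S h) = h.
Proof. by rewrite size_map size_iota. Qed.

Lemma spine_rcons h : spine S h.+1 = rcons (spine S h) (Posz (S h).2).
Proof. by rewrite /spine -addn1 iotaD map_cat cats1. Qed.

(** The spine has [(S i).2] as its entry at position [i]; at the top, the length of the address
    already excludes it from the spine. *)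
Lemma spine_child_off i l :
  ((i.+1 < 2 * L)%N -> l != Posz (S i).2) -> off_spine (rcons (spine S i) l).
Proof.
move=> h v; rewrite /on_spine negb_and -leqNgt.
set w := rcons _ _ ++ v; have sw : size w = (i.+1 + size v)%N.
  by rewrite size_cat size_rcons size_spine.
have [lt|] := ltnP (size w) (2 * L); last by [].
rewrite /=; apply/negP => /eqP /(congr1 (fun s => nth 0 s i)).
rewrite /w nth_cat size_rcons size_spine ltnSn nth_rcons size_spine ltnn eqxx.
by rewrite -/w sw /spine (nth_map 0%N) ?size_iota ?nth_iota ?add0n; lia.
Qed.

Lemma map_branch_ball r h u ls ts : size ls = size ts ->
  (forall l t, (l, t) \in zip ls ts -> lr_ball_at r h T (rcons u l) = keep_ball r h t) ->
  [seq lr_ball_at r h T (rcons u l) | l <- ls] = [seq keep_ball r h t | t <- ts].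
Proof.
elim: ls ts => [|l ls IH] [|t ts] //= [sz] H.
rewrite (H l t) ?mem_head//; congr cons; apply: IH => // l' t' lt.
by apply: H; rewrite in_cons lt orbT.
Qed.

Lemma off_spine_ball r h u t : in_tree T u -> off_spine u ->
  (forall a, a \in tree_degrees t -> xi (u ++ a.1) = a.2) ->
  lr_ball_at r h T u = keep_ball r h t.
Proof.
elim: h u t => [//|h IH] u [ts] uT ou xiu.
have Tu : T u = Some (size ts).
  rewrite spine_treeE// ifN; last by have := ou [::]; rewrite cats0.
  have := xiu ([::], size ts); rewrite cats0 => ->//.
  by rewrite tree_degrees_Node mem_head.
rewrite /= -/T [prune _ u]Tu; congr Node.
rewrite ball_labels_fin -!keep_lr_map; congr keep_lr.
apply: map_branch_ball => [|l t lt]; first by rewrite size_child_labels.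
have lin := mem_zip1 lt.
apply: IH => [||a aT].
- rewrite in_tree_rcons uT [T u]Tu /=.
  by have [i -> hi] := mem_child_labels lin; lia.
- exact: off_spine_rcons.
rewrite cat_rcons; apply: (xiu (l :: a.1, a.2)).
rewrite tree_degrees_Node in_cons; apply/orP; right.
exact: mem_branch (mem_zip_map tree_degrees lt) aT.
Qed.

Lemma forest_ball r h u ls ts : size ls = size ts ->
  (forall l, l \in ls -> in_tree T (rcons u l) /\ off_spine (rcons u l)) ->
  (forall a, a \in branch ls (map tree_degrees ts) -> xi (u ++ a.1) = a.2) ->
  [seq lr_ball_at r h T (rcons u l) | l <- ls] = [seq keep_ball r h t | t <- ts].
Proof.
move=> sz lu xiu; apply: map_branch_ball => // l t lt.
have [lT lo] := lu _ (mem_zip1 lt).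
apply: off_spine_ball => // a aT; rewrite cat_rcons; apply: (xiu (l :: a.1, a.2)).
exact: mem_branch (mem_zip_map tree_degrees lt) aT.
Qed.

(** Induction along the spine. At its top, the vertex of infinite degree shows the labels
    [1, ..., r, -r, ..., -1], while [keep_lr] erases the filling [f] of the finite vertex: both
    leave the subtrees [lt ++ rt]. *)
Lemma spine_ball r h i c lt rt f : in_tree T (spine S i) ->
  (i + (size c).+1 = 2 * L)%N -> size lt = r -> size rt = r ->
  (forall j, (j < size c)%N -> S (i + j) = nth (0, 0)%N (context_steps c) j) ->
  (forall a, a \in pattern_degrees c (lt, rt) -> xi (spine S i ++ a.1) = a.2) ->
  lr_ball_at r h T (spine S i) = keep_ball r h (fill c (Node (lt ++ f ++ rt))).
Proof.
move=> + + slt srt.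
elim: c i h => [|[l rr] c IH] i [//|h] iT /= iL Sc xic.
  have Tu : T (spine S i) = None.
    rewrite spine_treeE// /on_spine size_spine eqxx andbT ifT; last by lia.
    by rewrite ifT//; apply/eqP; lia.
  rewrite -/T [prune _ _]Tu; congr Node.
  rewrite keep_lr_middle//.
  have -> : ball_labels r None = child_labels 1 r ++ right_labels r by [].
  have szl : size (child_labels 1 r ++ right_labels r) = size (lt ++ rt).
    by rewrite !size_cat size_child_labels size_right_labels slt srt.
  apply: forest_ball => // [l|a].
    move=> lin; split.
      rewrite in_tree_rcons iT [T _]Tu /=; move: lin; rewrite mem_cat => /orP[].
        by case/mem_child_labels => j ->; lia.
      by case/mem_right_labels => j ->; lia.
    by apply: spine_child_off; lia.
  by move=> aB; apply: xic; rewrite /= slt srt -map_cat.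
have Si := Sc 0%N isT; rewrite addn0 /= in Si.
have Tu : T (spine S i) = Some (size l + size rr).+1.
  rewrite spine_treeE// /on_spine size_spine eqxx andbT ifT; last by lia.
  by rewrite ifN ?Si//; lia.
rewrite -/T [prune _ _]Tu; congr Node.
rewrite ball_labels_fin -!keep_lr_map; congr keep_lr.
have lab : child_labels 1 (size l + size rr).+1 =
    child_labels 1 (size l) ++ Posz (size l).+1 :: child_labels (size l).+2 (size rr).
  by rewrite /child_labels -addnS iotaD map_cat /= add1n.
have labT k : (0 < k)%N -> (k <= (size l + size rr).+1)%N ->
    in_tree T (rcons (spine S i) (Posz k)).
  by move=> k0 kl; rewrite in_tree_rcons iT [T _]Tu /=; lia.
have offT k : k != (size l).+1 -> off_spine (rcons (spine S i) (Posz k)).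
  by move=> kl; apply: spine_child_off => _; rewrite Si /=; apply: contra kl => /eqP[->].
rewrite -/(child_labels 1 _) lab !map_cat /=; congr (_ ++ _ :: _).
- apply: forest_ball; first by rewrite size_child_labels.
    move=> l' /mem_child_labels[k -> hk]; split; first by apply: labT; lia.
    by apply: offT; lia.
  move=> a aB; apply: xic; rewrite /= lab branch_cat ?size_child_labels ?size_map//.
  by rewrite mem_cat aB.
- have -> : rcons (spine S i) (Posz (size l).+1) = spine S i.+1 by rewrite spine_rcons Si.
  apply: IH => [|||a aP].
  + by rewrite spine_rcons Si /=; apply: labT; lia.
  + by lia.
  + by move=> j jc; rewrite addSnnS Sc.
  rewrite spine_rcons Si cat_rcons; apply: (xic (_ :: a.1, a.2)).
  rewrite /= lab branch_cat ?size_child_labels ?size_map// mem_cat; apply/orP; right.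
  by apply: mem_branch aP; rewrite mem_head.
apply: forest_ball; first by rewrite size_child_labels.
  move=> l' /mem_child_labels[k -> hk]; split; first by apply: labT; lia.
  by apply: offT; lia.
move=> a aB; apply: xic; rewrite /= lab branch_cat ?size_child_labels ?size_map//.
by rewrite mem_cat; apply/orP; right; rewrite /branch /= mem_cat aB orbT.
Qed.

Lemma on_pattern_ball r pt f : on_pattern L S xi pt ->
  size pt.2.1 = r -> size pt.2.2 = r ->
  lr_ball r T = lr_ball r (embed (plug pt f)).
Proof.
case: pt => c [lt rt] [/= L2 Sc xic] slt srt.
by rewrite lr_ball_embed; apply: (@spine_ball r _ 0) => //; rewrite add0n -L2.
Qed.

Lemma tree_degrees_inj u t t' :
  (forall a, a \in tree_degrees t -> xi (u ++ a.1) = a.2) ->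
  (forall a, a \in tree_degrees t' -> xi (u ++ a.1) = a.2) -> t = t'.
Proof.
elim/plane_tree_nested_ind: t u t' => ts IH u [ts'] h h'.
have sz : size ts = size ts'.
  have := h ([::], size ts); rewrite /= tree_degrees_Node mem_head => /(_ isT) <-.
  by have := h' ([::], size ts'); rewrite /= tree_degrees_Node mem_head => /(_ isT) <-.
congr Node.
have {}h a : a \in branch (child_labels 1 (size ts)) (map tree_degrees ts) -> xi (u ++ a.1) = a.2.
  by move=> aB; apply: h; rewrite tree_degrees_Node in_cons aB orbT.
have {}h' a : a \in branch (child_labels 1 (size ts)) (map tree_degrees ts') -> xi (u ++ a.1) = a.2.
  by move=> aB; apply: h'; rewrite tree_degrees_Node in_cons -sz aB orbT.
move: (child_labels _ _) (size_child_labels 1 (size ts)) h h' => ls.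
elim: ts ts' sz ls IH => [|t ts IHt] [|t' ts'] //= [sz] [//|l ls] IH [szl] h h'.
congr cons.
  apply: (IH t (mem_head _ _) (rcons u l)) => a aT; rewrite cat_rcons.
    by apply: (h (l :: a.1, a.2)); apply: mem_branch aT; rewrite mem_head.
  by apply: (h' (l :: a.1, a.2)); apply: mem_branch aT; rewrite mem_head.
apply: (IHt _ sz ls) => // [t0 t0in|a aB|a aB].
- by apply: IH; rewrite in_cons t0in orbT.
- by apply: h; rewrite /branch /= mem_cat aB orbT.
- by apply: h'; rewrite /branch /= mem_cat aB orbT.
Qed.

Lemma forest_degrees_inj u ls ts ts' : size ls = size ts -> size ts = size ts' ->
  (forall a, a \in branch ls (map tree_degrees ts) -> xi (u ++ a.1) = a.2) ->
  (forall a, a \in branch ls (map tree_degrees ts') -> xi (u ++ a.1) = a.2) -> ts = ts'.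
Proof.
elim: ts ts' ls => [|t ts IH] [|t' ts'] //= [//|l ls] [szl] [sz] h h'.
congr cons.
  apply: (@tree_degrees_inj (rcons u l)) => a aT; rewrite cat_rcons.
    by apply: (h (l :: a.1, a.2)); apply: mem_branch aT; rewrite mem_head.
  by apply: (h' (l :: a.1, a.2)); apply: mem_branch aT; rewrite mem_head.
apply: (IH _ ls) => // a aB.
- by apply: h; rewrite /branch /= mem_cat aB orbT.
- by apply: h'; rewrite /branch /= mem_cat aB orbT.
Qed.

(** Disjointness of the pattern events: the spine steps give the numbers of siblings on each side,
    and then [xi] determines every subtree. At the top, the numbers of subtrees are fixed by the
    last two hypotheses. *)
Lemma on_pattern_inj pt pt' : on_pattern L S xi pt -> on_pattern L S xi pt' ->
  size pt.2.1 = size pt'.2.1 -> size pt.2.2 = size pt'.2.2 -> pt = pt'.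
Proof.
case: pt pt' => c [lt rt] [c' [lt' rt']] [/= L2 Sc xic] [/= L2' Sc' xic'] sl sr.
have szc : size c = size c' by lia.
suff gen i u : (forall j, (j < size c)%N -> S (i + j) = nth (0, 0)%N (context_steps c) j) ->
    (forall j, (j < size c')%N -> S (i + j) = nth (0, 0)%N (context_steps c') j) ->
    (forall a, a \in pattern_degrees c (lt, rt) -> xi (u ++ a.1) = a.2) ->
    (forall a, a \in pattern_degrees c' (lt', rt') -> xi (u ++ a.1) = a.2) ->
    (c, (lt, rt)) = (c', (lt', rt')) by exact: (gen 0%N [::]).
elim: c c' szc i u {L2 L2' Sc Sc' xic xic'} => [|[l r] c IH] [|[l' r'] c'] //= => [_|[szc]] i u Sc Sc' h h'.
  have e : lt ++ rt = lt' ++ rt'.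
    apply: (@forest_degrees_inj u (child_labels 1 (size lt) ++ right_labels (size rt))).
    - by rewrite !size_cat size_child_labels size_right_labels.
    - by rewrite !size_cat sl sr.
    - by rewrite map_cat.
    - by rewrite map_cat sl sr.
  by move/eqP: e; rewrite eqseq_cat// => /andP[/eqP -> /eqP ->].
have := Sc 0%N isT; rewrite (Sc' 0%N isT) /= => -[e1 e2].
have sll : size l = size l' by [].
have srr : size r = size r' by move: e1; rewrite e2; lia.
have lab : child_labels 1 (size l + size r).+1 =
    child_labels 1 (size l) ++ Posz (size l).+1 :: child_labels (size l).+2 (size r).
  by rewrite /child_labels -addnS iotaD map_cat /= add1n.
rewrite -sll -srr in h'.
have split3 (cc : context) (lr : seq plane_tree * seq plane_tree) (l0 r0 : seq plane_tree) a :
    size l0 = size l ->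
    [\/ a \in branch (child_labels 1 (size l)) (map tree_degrees l0),
       exists2 b, b \in pattern_degrees cc lr & a = (Posz (size l).+1 :: b.1, b.2) |
       a \in branch (child_labels (size l).+2 (size r)) (map tree_degrees r0)] ->
    a \in branch (child_labels 1 (size l + size r).+1)
       (map tree_degrees l0 ++ pattern_degrees cc lr :: map tree_degrees r0).
  move=> sl0 H; rewrite lab branch_cat ?size_child_labels ?size_map//.
  rewrite mem_cat /branch /= mem_cat; apply/orP.
  case: H => [->|[b bP ->]|aB]; [by left|right|by right; rewrite aB orbT].
  by apply/orP; left; apply/mapP; exists b.
have -> : l = l'.
  apply: (@forest_degrees_inj u (child_labels 1 (size l))) => // [|a aB|a aB].
  - by rewrite size_child_labels.
  - by apply/h/split3 => //; constructor 1.
  - by apply/h'/split3 => //; constructor 1.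
have -> : r = r'.
  apply: (@forest_degrees_inj u (child_labels (size l).+2 (size r))) => // [|a aB|a aB].
  - by rewrite size_child_labels.
  - by apply/h/split3 => //; constructor 3.
  - by apply/h'/split3 => //; constructor 3.
suff [-> -> ->] : (c, (lt, rt)) = (c', (lt', rt')) by [].
apply: (IH _ szc i.+1 (rcons u (Posz (size l).+1))).
- by move=> j jc; rewrite addSnnS Sc.
- by move=> j jc; rewrite addSnnS Sc'.
- move=> a aP; rewrite cat_rcons; apply: (h (_ :: a.1, a.2)); apply: split3 => //.
  by constructor 2; exists a.
- move=> a aP; rewrite cat_rcons; apply: (h' (_ :: a.1, a.2)); apply: split3 => //.
  by constructor 2; exists a.
Qed.

End on_pattern_ball.

(** A pattern has a ball of its own, which the empty filling may represent. *)
Lemma plug_ball r pt f f' : size pt.2.1 = r -> size pt.2.2 = r ->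
  lr_ball r (embed (plug pt f)) = lr_ball r (embed (plug pt f')).
Proof.
case: pt => c [lt rt] /= slt srt; rewrite !lr_ball_embed /plug /=.
elim: c (2 * r)%N => [|lr c IH] [|h] //=; first by rewrite !keep_lr_middle.
by rewrite -!keep_lr_map !map_cat /= IH.
Qed.

(** * Probability of a pattern for the limit tree *)

Section pattern_event.
Context {R : realType} (rho_w rho_b : nat -> R).
Local Notation color_law := (color_law rho_w rho_b).
Local Notation forest_weight := (forest_weight rho_w rho_b).

Definition degrees_weight (h : nat) (A : seq (address * nat)) : R :=
  \prod_(a <- A) color_law (h + size a.1) a.2.

Lemma degrees_weight_tree h t : degrees_weight h (tree_degrees t) = tree_weight rho_w rho_b h t.
Proof. by rewrite /degrees_weight big_map. Qed.

Lemma degrees_weight_branch h ls As : size ls = size As ->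
  degrees_weight h (branch ls As) = \prod_(A <- As) degrees_weight h.+1 A.
Proof.
move=> sz; rewrite /degrees_weight prod_branch//.
elim: ls As sz => [|l ls IH] [|A As] //= sz; rewrite ?big_nil// !big_cons IH; last by case: sz.
by congr (_ * _); apply: eq_bigr => a _; rewrite /= addSnnS.
Qed.

Lemma degrees_weight_forest h ts :
  \prod_(A <- map tree_degrees ts) degrees_weight h A = forest_weight h ts.
Proof. by rewrite big_map; apply: eq_bigr => t _; exact: degrees_weight_tree. Qed.

Context {d} {Om : measurableType d} (P : probability Om R).
Variables (L : Om -> nat) (S : nat -> Om -> nat * nat) (xi : address -> Om -> nat).
Hypothesis source_law : limit_source rho_w rho_b P L S xi.

Definition pattern_event (pt : pattern) : set Om :=
  [set w | on_pattern (L w) (S ^~ w) (xi ^~ w) pt].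

Let sources (pt : pattern) : seq source :=
  (None : source) :: [seq Some (inl h) : source | h <- iota 0 (size pt.1)] ++
  [seq Some (inr a.1) : source | a <- pattern_degrees pt.1 pt.2].

Let lookup (s : seq (address * nat)) (u : address) : nat := nth 0%N (map snd s) (index u (map fst s)).

Let lookupP s a : uniq (map fst s) -> a \in s -> lookup s a.1 = a.2.
Proof.
rewrite /lookup; elim: s => [//|b s IH] /= /andP[bs us]; rewrite in_cons => /orP[/eqP ->|as_].
  by rewrite eqxx.
have ne : b.1 != a.1 by apply: contra bs => /eqP ->; exact: map_f.
by rewrite (negbTE ne); exact: IH.
Qed.

Let values (pt : pattern) (i : source) : set (source_type i) :=
  match i with
  | None => [set (size pt.1).+1./2]
  | Some (inl h) => [set nth (0, 0)%N (context_steps pt.1) h]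
  | Some (inr u) => [set lookup (pattern_degrees pt.1 pt.2) u]
  end.

Let pattern_eventE pt : odd (size pt.1) -> pattern_event pt =
  \bigcap_(i in [set` sources pt]) (source_family L S xi i @^-1` @values pt i).
Proof.
move=> od; have Lc : (2 * ((size pt.1).+1./2) = (size pt.1).+1)%N.
  by rewrite mul2n -[RHS]odd_double_half /= od.
have du := pattern_degrees_uniq pt.1 pt.2.
apply/seteqP; split => w /=.
  move=> [wL wS wx] [[h|u]|] /=.
  - rewrite in_cons /= mem_cat => /orP[/mapP[h' + [->]]|/mapP[]//].
    by rewrite mem_iota => hh; apply: wS.
  - rewrite in_cons /= mem_cat => /orP[/mapP[]//|/mapP[a aP [->]]].
    by rewrite wx// lookupP.
  - by move=> _; lia.
move=> H; split.
- by have := H None (mem_head _ _); rewrite /= => ->; rewrite Lc.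
- move=> h hc; apply: (H (Some (inl h))); rewrite /= in_cons /= mem_cat; apply/orP; left.
  by apply: map_f; rewrite mem_iota.
- move=> a aP; have := H (Some (inr a.1)); rewrite /= => -> //; first exact: lookupP.
  by rewrite in_cons /= mem_cat; apply/orP; right; apply: map_f.
Qed.

Let uniq_sources pt : uniq (sources pt).
Proof.
rewrite /= cat_uniq; apply/and4P; split.
- rewrite mem_cat negb_or; apply/andP; split; apply/negP => /mapP[x _]; discriminate.
- by rewrite map_inj_uniq ?iota_uniq// => x y [].
- by apply/hasPn => i /mapP[a _ ->]; apply/negP => /mapP[h _].
rewrite (map_comp (fun u => Some (inr u) : source) fst) map_inj_uniq ?pattern_degrees_uniq//.
by move=> x y [].
Qed.

Let value_event pt i : measurable (source_family L S xi i @^-1` @values pt i).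
Proof.
case: source_law => hL hS hx _; case: i => [[h|u]|] /=.
- by case: (hS h (nth (0, 0)%N (context_steps pt.1) h)).
- by case: (hx u (lookup (pattern_degrees pt.1 pt.2) u)).
- by case: (hL (size pt.1).+1./2).
Qed.

Lemma measurable_pattern_event pt : odd (size pt.1) -> measurable (pattern_event pt).
Proof.
move=> od; rewrite pattern_eventE// bigcap_seq; apply: bigsetI_measurable => i _.
exact: value_event.
Qed.

Variables mw mb : R.
Hypothesis mean_w : mean rho_w = mw%:E.
Hypothesis mean_b : mean rho_b = mb%:E.
Hypothesis mw0 : mw != 0.
Hypothesis mb0 : mb != 0.

Let mean_at (h : nat) : R := if odd h then mb else mw.

(** The size bias by the degree and the uniform choice of the rank cancel: the offspring law divided
    by its mean remains. *)
Lemma spine_step_lawE h l r :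
  spine_step_law rho_w rho_b h ((l + r).+1, l.+1) = color_law h (l + r).+1 / mean_at h.
Proof.
rewrite /spine_step_law /= ltnS leq_addr /size_biased mulrAC [_%:R * _]mulrC mulfK ?pnatr_eq0//.
by rewrite /Defs.color_law /mean_at; case: odd; rewrite ?mean_w ?mean_b.
Qed.

Lemma pattern_degrees_weight h c lr :
  (\prod_(j < size c) spine_step_law rho_w rho_b (h + j) (nth (0, 0)%N (context_steps c) j)) *
  degrees_weight h (pattern_degrees c lr) =
  context_weight rho_w rho_b h c / (\prod_(j < size c) mean_at (h + j)) *
  (forest_weight (h + size c).+1 lr.1 * forest_weight (h + size c).+1 lr.2).
Proof.
elim: c h => [|[l r] c IH] h /=.
  rewrite !big_ord0 divr1 !mul1r degrees_weight_branch; last first.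
    by rewrite !size_cat !size_map size_iota size_rev size_iota.
  by rewrite big_cat /= !degrees_weight_forest addn0.
rewrite !big_ord_recl /= !addn0 spine_step_lawE degrees_weight_branch; last first.
  by rewrite size_child_labels size_cat /= !size_map addnS.
rewrite big_cat big_cons /= !degrees_weight_forest.
have -> : \prod_(i < size c) spine_step_law rho_w rho_b (h + bump 0 i)
    (nth (0, 0)%N (context_steps c) i) =
  \prod_(i < size c) spine_step_law rho_w rho_b (h.+1 + i) (nth (0, 0)%N (context_steps c) i).
  by apply: eq_bigr => i _; rewrite /bump add1n addSnnS.
have -> : \prod_(i < size c) mean_at (h + bump 0 i) = \prod_(i < size c) mean_at (h.+1 + i).
  by apply: eq_bigr => i _; rewrite /bump add1n addSnnS.
have {}IH := IH h.+1; rewrite invfM addnS -addSn.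
set X := \prod_(i < size c) spine_step_law _ _ _ _ in IH *.
set Y := degrees_weight _ (pattern_degrees _ _) in IH *.
transitivity (color_law h (size l + size r).+1 / mean_at h * forest_weight h.+1 l *
  forest_weight h.+1 r * (X * Y)); first by ring.
by rewrite IH; ring.
Qed.

Lemma prod_mean_at k : \prod_(j < (2 * k).+1) mean_at j = mw * (mw * mb) ^+ k.
Proof.
elim: k => [|k IH]; first by rewrite muln0 big_ord_recl big_ord0 expr0.
have -> : (2 * k.+1).+1 = (2 * k).+3 by lia.
rewrite 2!big_ord_recr /= IH /mean_at exprSr /= mul2n odd_double /=; ring.
Qed.

(** For [2 * k + 1] spine vertices below the top, the length has probability
    [(1 - mw * mb) * (mw * mb) ^+ k], and the spine steps contribute the denominator
    [mw * (mw * mb) ^+ k]. The powers cancel, so the prefactor is common to all patterns. *)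
Lemma pattern_event_prob pt : odd (size pt.1) ->
  P (pattern_event pt) = ((1 - mw * mb) / mw * pattern_weight rho_w rho_b pt)%:E.
Proof.
move=> od; case: (source_law) => hL hS hx indep.
rewrite pattern_eventE// indep; last exact: uniq_sources.
rewrite /sources big_cons big_cat !big_map /=.
rewrite (hL _).2.
have -> : (\prod_(h <- iota 0 (size pt.1)) P (S h @^-1` [set nth (0, 0)%N (context_steps pt.1) h]))%E =
  (\prod_(j < size pt.1) spine_step_law rho_w rho_b (0 + j) (nth (0, 0)%N (context_steps pt.1) j))%:E.
  rewrite -(big_mkord xpredT (fun j => spine_step_law rho_w rho_b (0 + j) (nth (0, 0)%N (context_steps pt.1) j))).
  rewrite (big_morph EFin EFinM (erefl _)) /index_iota subn0.
  by apply: eq_bigr => h _; rewrite (hS h _).2.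
have -> : (\prod_(a <- pattern_degrees pt.1 pt.2)
    P (xi a.1 @^-1` [set lookup (pattern_degrees pt.1 pt.2) a.1]))%E =
  (degrees_weight 0 (pattern_degrees pt.1 pt.2))%:E.
  rewrite /degrees_weight (big_morph EFin EFinM (erefl _)) big_seq [RHS]big_seq.
  apply: eq_bigr => a aP; rewrite (hx a.1 _).2 lookupP//.
  exact: pattern_degrees_uniq.
rewrite -!EFinM pattern_degrees_weight; congr EFin.
have [k kE] : exists k, size pt.1 = (2 * k).+1.
  by exists (size pt.1)./2; rewrite mul2n -[LHS]odd_double_half od.
have kU : (size pt.1).+1./2 = k.+1 by rewrite kE; lia.
rewrite /= in kU; rewrite kU.
have -> : \prod_(j < size pt.1) mean_at (0 + j) = mw * (mw * mb) ^+ k by rewrite kE prod_mean_at.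
have fW ts : forest_weight (0 + size pt.1).+1 ts = forest_weight 0 ts.
  rewrite kE add0n; elim: (k) => [|k' IH]; first by rewrite muln0 forest_weightSS.
  by rewrite -IH mulnS !addSn add0n !forest_weightSS.
rewrite !fW /spine_length_law mean_w mean_b -EFinM /pattern_weight /=.
have mk : (mw * mb) ^+ k != 0 by rewrite expf_neq0// mulf_neq0.
by field; rewrite mk mw0.
Qed.

End pattern_event.

(** * Total mass of the patterns *)

Lemma uniq_flatten_key (I T : eqType) (key : T -> I) (F : I -> seq T) (s : seq I) :
  uniq s -> (forall i, uniq (F i)) -> (forall i x, x \in F i -> key x = i) ->
  uniq (flatten [seq F i | i <- s]).
Proof.
move=> + uF kF; elim: s => [//|i s IH] /= /andP[is_ us].
rewrite cat_uniq uF IH// andbT; apply/hasPn => x /flatten_mapP[j js xj].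
by apply/negP => xi; move: is_; rewrite -(kF _ _ xi) (kF _ _ xj) js.
Qed.

Section enumerations.
Variable T : eqType.
Implicit Types A : seq T.

Fixpoint sequences (d : nat) A : seq (seq T) :=
  if d is d'.+1 then [seq x :: s | x <- A, s <- sequences d' A] else [:: [::]].

Lemma size_sequences d A s : s \in sequences d A -> size s = d.
Proof.
elim: d s => [|d IH] s /=; first by rewrite inE => /eqP ->.
by case/allpairsP => -[x s'] [/= _ /IH <- ->].
Qed.

Lemma uniq_sequences d A : uniq A -> uniq (sequences d A).
Proof.
move=> uA; elim: d => [//|d IH] /=; apply: allpairs_uniq => //.
by move=> [x s] [x' s'] _ _ /= [-> ->].
Qed.

Lemma sum_sequences (R : realType) (F : T -> R) d A :
  \sum_(s <- sequences d A) \prod_(x <- s) F x = (\sum_(x <- A) F x) ^+ d.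
Proof.
elim: d => [|d IH]; first by rewrite big_seq1 big_nil.
rewrite /= big_allpairs_dep exprS -IH mulr_suml; apply: eq_bigr => x _.
by rewrite mulr_sumr; apply: eq_bigr => s _; rewrite big_cons.
Qed.

(** The [d + 1] ways of cutting a sequence of length [d] are the ranks of the spine child among
    [d + 1] children; they produce the factor [d.+1] of a mean. *)
Definition sequences_split (N : nat) A : seq (seq T * seq T) :=
  flatten [seq flatten [seq [seq (take i s, drop i s) | s <- sequences d A] | i <- iota 0 d.+1]
          | d <- iota 0 N].

Lemma uniq_sequences_split N A : uniq A -> uniq (sequences_split N A).
Proof.
move=> uA; pose G d i := [seq (take i s, drop i s) | s <- sequences d A].
have uG d i : uniq (G d i).
  rewrite map_inj_uniq ?uniq_sequences// => s s' [e1 e2].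
  by rewrite -(cat_take_drop i s) e1 e2 cat_take_drop.
apply: (@uniq_flatten_key _ _ (fun x : seq T * seq T => (size x.1 + size x.2)%N)) => [|d|d x].
- exact: iota_uniq.
- have -> : [seq [seq (take i s, drop i s) | s <- sequences d A] | i <- iota 0 d.+1] =
      [seq (if (i <= d)%N then G d i else [::]) | i <- iota 0 d.+1].
    by apply: (eq_in_map _ _ _).1 => i; rewrite mem_iota add0n ltnS => /andP[_ ->].
  apply: (@uniq_flatten_key _ _ (fun x : seq T * seq T => size x.1)) => [|i|i x].
  + exact: iota_uniq.
  + by case: ifP.
  case: ifP => // id_ /mapP[s /size_sequences sd ->] /=.
  by rewrite size_takel// sd.
case/flatten_mapP => i _ /mapP[s /size_sequences sd ->] /=.
by rewrite -size_cat cat_take_drop.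
Qed.

Lemma sum_sequences_split (R : realType) (a : nat -> R) (F : T -> R) N A :
  \sum_(x <- sequences_split N A)
    a (size x.1 + size x.2)%N * ((\prod_(y <- x.1) F y) * (\prod_(y <- x.2) F y)) =
  \sum_(d < N) d.+1%:R * a d * (\sum_(x <- A) F x) ^+ d.
Proof.
rewrite big_flatten big_map -[in LHS](subn0 N) -/(index_iota 0 N) big_mkord.
apply: eq_bigr => d _; rewrite big_flatten big_map.
transitivity (\sum_(i <- iota 0 d.+1) a d * (\sum_(x <- A) F x) ^+ d); last first.
  by rewrite big_const_seq count_predT size_iota iter_addr addr0 mulr_natl -mulrnAl.
apply: eq_bigr => i _; rewrite big_map -sum_sequences mulr_sumr big_seq [RHS]big_seq.
apply: eq_bigr => s /size_sequences sd /=.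
by rewrite -size_cat cat_take_drop sd -big_cat cat_take_drop.
Qed.

End enumerations.

(** An Abel limit with moving cutoff: finitely many terms give the lower bound by continuity, and
    [th N <= 1] gives the upper bound [s]. *)
Lemma cvg_power_sum (R : realType) (a : nat -> R) (s : R) (th : nat -> R) :
  (forall d, 0 <= a d) -> \sum_(d < K) a d @[K --> \oo] --> s ->
  th N @[N --> \oo] --> (1 : R) -> (forall N, 0 <= th N <= 1) ->
  \sum_(d < N) a d * th N ^+ d @[N --> \oo] --> s.
Proof.
move=> a0 as_ th1 th01.
have nd : nondecreasing_seq (fun K => \sum_(d < K) a d).
  by apply/nondecreasing_seqP => K; rewrite big_ord_recr /= lerDl.
have ub K : \sum_(d < K) a d <= s.
  by rewrite -(cvg_lim _ as_)//; apply: nondecreasing_cvgn_le => //; apply/cvg_ex; exists s.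
apply/cvgrPdist_le => e e0.
have e20 : 0 < e / 2 by rewrite divr_gt0.
have [K hK] : exists K, s - e / 2 <= \sum_(d < K) a d.
  have /cvgrPdist_le/(_ _ e20)[K _ hK] := as_.
  by exists K; have := hK K (leqnn K); rewrite ler_norml => /=; lra.
have cK : \sum_(d < K) a d * th N ^+ d @[N --> \oo] --> \sum_(d < K) a d.
  apply: cvg_sumr => d; rewrite -[X in _ --> X]mulr1; apply: cvgMl_tmp.
  rewrite -(expr1n _ d); exact: (cvg_comp th (fun y => y ^+ d) th1 (@exprn_continuous R d _)).
have /cvgrPdist_le/(_ _ e20) hc := cK.
near=> N.
have KN : (K <= N)%N by near: N; exact: nbhs_infty_ge.
have h1 : `|\sum_(d < K) a d - \sum_(d < K) a d * th N ^+ d| <= e / 2 by near: N.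
have [t0 t1] : 0 <= th N /\ th N <= 1 by have /andP[] := th01 N.
have le1 : \sum_(d < K) a d * th N ^+ d <= \sum_(d < N) a d * th N ^+ d.
  rewrite -!(big_mkord xpredT (fun d => a d * th N ^+ d)).
  rewrite [leRHS](big_cat_nat _ (n := K))//= lerDl sumr_ge0// => d _.
  by rewrite mulr_ge0 ?exprn_ge0.
have le2 : \sum_(d < N) a d * th N ^+ d <= s.
  apply: le_trans (ub N); apply: ler_sum => d _.
  by rewrite ler_piMr ?exprn_ile1.
move: h1; rewrite !ler_norml => /andP[_ h1]; apply/andP; split; lra.
Unshelve. all: by end_near. Qed.

Definition trees_of_size (n : nat) : seq plane_tree := map (head leaf) (forests n 1).

Lemma mem_trees_of_size n t : (t \in trees_of_size n) = (nb_vertices t == n).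
Proof.
apply/mapP/eqP => [[f]|nt].
  rewrite mem_forests => /andP[]; case: f => [//|t' [|//]] _ /eqP fs ->.
  by rewrite -fs /forest_size /= addn0.
by exists [:: t] => //; rewrite mem_forests /forest_size /= addn0 nt !eqxx.
Qed.

Lemma uniq_trees_of_size n : uniq (trees_of_size n).
Proof.
rewrite map_inj_in_uniq ?uniq_forests// => f f'; rewrite !mem_forests.
by case: f => [//|t [|//]]; case: f' => [//|t' [|//]] /= _ _ ->.
Qed.

Lemma sum_trees_of_size (R : realType) (rho_w rho_b : nat -> R) n :
  \sum_(t <- trees_of_size n) tree_weight rho_w rho_b 0 t =
  \sum_(f <- forests n 1) forest_weight rho_w rho_b 0 f.
Proof.
rewrite big_map big_seq [RHS]big_seq; apply: eq_bigr => f; rewrite mem_forests.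
by case: f => [//|t [|//]] _; rewrite /forest_weight big_seq1.
Qed.

Section total_mass.
Variables (R : realType) (rho_w rho_b : nat -> R) (p m mw mb : R).
Hypothesis rho_w_ge0 : forall k, 0 <= rho_w k.
Hypothesis rho_b_ge0 : forall k, 0 <= rho_b k.
Hypothesis rho_b_sum : \sum_(k < K) rho_b k @[K --> \oo] --> (1 : R).
Hypothesis rho_w_mean : \sum_(k < K) k.+1%:R * rho_w k.+1 @[K --> \oo] --> mw.
Hypothesis rho_b_mean : \sum_(k < K) k.+1%:R * rho_b k.+1 @[K --> \oo] --> mb.
Hypothesis geom_w : forall k, rho_w k = (1 - p) * p ^+ k.
Hypothesis law : step_law (step_of rho_b p) m.

Local Notation mu := (step_of rho_b p).
Local Notation tree_weight := (tree_weight rho_w rho_b).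
Local Notation forest_weight := (forest_weight rho_w rho_b).
Local Notation context_weight := (context_weight rho_w rho_b).

Let mu_ge0 := step_ge0 law.

Let color_ge0 h k : 0 <= color_law rho_w rho_b h k.
Proof. by rewrite /color_law; case: odd. Qed.

(** First passages at distinct times are disjoint; the induction on the horizon conditions on the
    first step. *)
Lemma sum_forest_mass_le1 N k : \sum_(n < N) forest_mass mu n k <= 1.
Proof.
elim: N k => [|N IH] k; first by rewrite big_ord0.
rewrite big_ord_recl; under eq_bigr do rewrite lift0; case: k => [|k].
  by rewrite big1 ?addr0.
rewrite add0r.
under eq_bigr => n _.
  rewrite (_ : forest_mass mu n.+1 k.+1 = \sum_(j < N) mu j * forest_mass mu n (k + j)); last first.
    rewrite /= -!(big_mkord xpredT (fun j => mu j * forest_mass mu n (k + j))).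
    have nN := ltn_ord n.
    rewrite [RHS](big_cat_nat _ (n := n.+1))//= [X in _ = _ + X]big1_seq ?addr0// => j /andP[_].
    by rewrite mem_index_iota => /andP[nj _]; rewrite forest_mass_gt ?mulr0//; lia.
  over.
rewrite exchange_big /=; apply: le_trans (step_sum_le1 law N).
by apply: ler_sum => j _; rewrite -mulr_sumr ler_piMr.
Qed.

Let A N : seq plane_tree := flatten [seq trees_of_size n | n <- iota 0 N.+1].
Let th N := \sum_(t <- A N) tree_weight 0 t.

Let thE N : th N = tree_gen mu 1 N.
Proof.
rewrite /th big_flatten big_map -[N.+1]subn0 -/(index_iota 0 N.+1) big_mkord.
apply: eq_bigr => n _; rewrite expr1n mulr1 -(sum_forests rho_b geom_w).
exact: sum_trees_of_size.
Qed.

Let uniq_A N : uniq (A N).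
Proof.
apply: (@uniq_flatten_key _ _ nb_vertices); first exact: iota_uniq.
  by move=> n; exact: uniq_trees_of_size.
by move=> n t; rewrite mem_trees_of_size => /eqP.
Qed.

Let th01 N : 0 <= th N <= 1.
Proof.
rewrite thE tree_gen_ge0//= /tree_gen.
under eq_bigr do rewrite expr1n mulr1.
exact: sum_forest_mass_le1.
Qed.

(** Almost sure extinction: at [z = 1] the limit [w] satisfies [phi w <= w], which forces
    [w = 1]. *)
Let th_cvg : th N @[N --> \oo] --> (1 : R).
Proof.
have bd N : tree_gen mu 1 N <= 1 by have := th01 N; rewrite thE => /andP[].
have [w [wge wcvg wfix]] := tree_gen_fixpoint mu_ge0 ler01 bd.
under eq_fun do rewrite thE; suff w1 : w = 1 by rewrite w1 in wcvg.
apply: (fixpoint_ge1 mu_ge0 (step_sum1 law) (step_mean_lt1 law) (step_mean law)).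
  rewrite (le_trans _ (wge 0%N)) ?tree_gen_ge0//=.
  rewrite -(cvg_lim _ wcvg)//; apply: limr_le; first by apply/cvg_ex; exists w.
  exact: nearW.
by move=> K; rewrite -[leLHS]mul1r.
Qed.

Let B N : seq plane_tree := flatten [seq map Node (sequences d (A N)) | d <- iota 0 N].
Let bh N := \sum_(t <- B N) tree_weight 1 t.

Let uniq_B N : uniq (B N).
Proof.
apply: (@uniq_flatten_key _ _ (size \o children)); first exact: iota_uniq.
  by move=> n; rewrite map_inj_uniq ?uniq_sequences// => s s' [].
by move=> d t /mapP[s /size_sequences sd ->].
Qed.

Let bhE N : bh N = \sum_(d < N) rho_b d * th N ^+ d.
Proof.
rewrite /bh big_flatten big_map -[X in iota 0 X]subn0 -/(index_iota 0 N) big_mkord.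
apply: eq_bigr => d _; rewrite big_map -sum_sequences mulr_sumr big_seq [RHS]big_seq.
apply: eq_bigr => s /size_sequences sd.
by rewrite tree_weight_Node forest_weightSS sd.
Qed.

Let bh_cvg : bh N @[N --> \oo] --> (1 : R).
Proof. by under eq_fun do rewrite bhE; exact: cvg_power_sum. Qed.

Let bh01 N : 0 <= bh N <= 1.
Proof.
rewrite bhE sumr_ge0 /=; last first.
  by move=> d _; rewrite mulr_ge0 ?exprn_ge0//; case/andP: (th01 N).
have nd : nondecreasing_seq (fun K => \sum_(d < K) rho_b d).
  by apply/nondecreasing_seqP => K; rewrite big_ord_recr /= lerDl.
have ub K : \sum_(d < K) rho_b d <= 1.
  by rewrite -(cvg_lim _ rho_b_sum)//; apply: nondecreasing_cvgn_le => //; apply/cvg_ex; exists 1.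
apply: le_trans (ub N); apply: ler_sum => d _.
by have /andP[t0 t1] := th01 N; rewrite ler_piMr ?exprn_ile1.
Qed.

Let MW N := \sum_(x <- sequences_split N (B N))
  rho_w (size x.1 + size x.2).+1 * (forest_weight 1 x.1 * forest_weight 1 x.2).
Let MB N := \sum_(x <- sequences_split N (A N))
  rho_b (size x.1 + size x.2).+1 * (forest_weight 0 x.1 * forest_weight 0 x.2).

Let MW_cvg : MW N @[N --> \oo] --> mw.
Proof.
under eq_fun do rewrite /MW (sum_sequences_split (fun d => rho_w d.+1) (tree_weight 1)).
by apply: (@cvg_power_sum _ (fun d => d.+1%:R * rho_w d.+1) mw bh) => // d; rewrite mulr_ge0.
Qed.

Let MB_cvg : MB N @[N --> \oo] --> mb.
Proof.
under eq_fun do rewrite /MB (sum_sequences_split (fun d => rho_b d.+1) (tree_weight 0)).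
by apply: (@cvg_power_sum _ (fun d => d.+1%:R * rho_b d.+1) mb th) => // d; rewrite mulr_ge0.
Qed.

Let CW N := sequences_split N (B N).
Let CB N := sequences_split N (A N).

(** White and black spine vertices alternate, and the last one is white because the top of the
    spine, which is not listed, is black. *)
Fixpoint contexts (ws bs : seq (seq plane_tree * seq plane_tree)) (k : nat) : seq context :=
  if k is k'.+1 then
    [seq x :: c | x <- ws, c <- [seq y :: c' | y <- bs, c' <- contexts ws bs k']]
  else [seq [:: x] | x <- ws].

Lemma size_contexts ws bs k c : c \in contexts ws bs k -> size c = (2 * k).+1.
Proof.
elim: k c => [|k IH] c /=; first by case/mapP => x _ ->.
case/allpairsP => -[x c1] [/= _ /allpairsP[[y c2] [/= _ /IH sc ->]] ->] /=.
by rewrite (_ : size c2 = (2 * k).+1)//; lia.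
Qed.

Lemma uniq_contexts ws bs k : uniq ws -> uniq bs -> uniq (contexts ws bs k).
Proof.
move=> uw ub; elim: k => [|k IH] /=; first by rewrite map_inj_uniq// => x y [].
apply: allpairs_uniq => //; last by move=> [x s] [x' s'] _ _ /= [-> ->].
by apply: allpairs_uniq => // -[x s] [x' s'] _ _ /= [-> ->].
Qed.

Lemma context_weightSS h c : context_weight h.+2 c = context_weight h c.
Proof.
elim: c h => [//|x c IH] h /=.
by rewrite IH !forest_weightSS /color_law /= negbK.
Qed.

Let sum_contexts N k : \sum_(c <- contexts (CW N) (CB N) k) context_weight 0 c =
  MW N ^+ k.+1 * MB N ^+ k.
Proof.
elim: k => [|k IH] /=.
  rewrite big_map expr1 expr0 mulr1; apply: eq_bigr => x _.
  by rewrite /= mulr1 /color_law /= mulrA.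
rewrite big_allpairs_dep /=.
transitivity (MW N * (MB N * (MW N ^+ k.+1 * MB N ^+ k))); last by rewrite !exprS; ring.
rewrite mulr_suml; apply: eq_bigr => x _.
rewrite big_allpairs_dep /= -IH !mulr_suml mulr_sumr; apply: eq_bigr => y _.
rewrite !mulr_sumr; apply: eq_bigr => c _.
by rewrite context_weightSS !forest_weightSS /color_law /=; ring.
Qed.

Let patterns r N J : seq pattern :=
  flatten [seq [seq (c, lr) | c <- contexts (CW N) (CB N) k,
    lr <- [seq (lt, rt) | lt <- sequences r (A N), rt <- sequences r (A N)]] | k <- iota 0 J].

Let sum_patterns r N J : \sum_(pt <- patterns r N J) pattern_weight rho_w rho_b pt =
  \sum_(k < J) MW N ^+ k.+1 * MB N ^+ k * (th N ^+ r * th N ^+ r).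
Proof.
rewrite big_flatten big_map -[X in iota 0 X]subn0 -/(index_iota 0 J) big_mkord.
apply: eq_bigr => k _; rewrite big_allpairs_dep -sum_contexts mulr_suml.
apply: eq_bigr => c _; rewrite big_allpairs_dep -[in RHS]sum_sequences mulr_suml mulr_sumr.
apply: eq_bigr => lt _; rewrite !mulr_sumr; apply: eq_bigr => rt _.
by [].
Qed.

Hypothesis mw0 : 0 < mw.
Hypothesis m01 : 0 <= mw * mb < 1.

(** As the cutoff [N] on trees and degrees grows, the enumerated patterns have masses tending to
    [1 - (mw * mb) ^+ J], a geometric sum over the spine length; what is missing belongs to longer
    spines. *)
Lemma total_mass r (e : R) : 0 < e -> exists pts : seq pattern,
  [/\ uniq pts,
      forall pt, pt \in pts -> [/\ odd (size pt.1), size pt.2.1 = r & size pt.2.2 = r] &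
      1 - e <= \sum_(pt <- pts) (1 - mw * mb) / mw * pattern_weight rho_w rho_b pt].
Proof.
move=> e0; have e20 : 0 < e / 2 by rewrite divr_gt0.
have [m0 m1] : 0 <= mw * mb /\ mw * mb < 1 by case/andP: m01.
have [J hJ] : exists J, (mw * mb) ^+ J <= e / 2.
  have mc : (mw * mb) ^+ J @[J --> \oo] --> (0 : R) by apply: cvg_expr; rewrite ger0_norm.
  have /cvgrPdist_le/(_ _ e20)[J _ h] := mc.
  by exists J; have := h J (leqnn J); rewrite /= sub0r normrN => /(le_trans (ler_norm _)).
have exprc (u : nat -> R) (l : R) k : u N @[N --> \oo] --> l -> u N ^+ k @[N --> \oo] --> l ^+ k.
  by move=> ul; exact: (cvg_comp u (fun y => y ^+ k) ul (@exprn_continuous R k _)).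
have cv : (1 - mw * mb) / mw * (\sum_(k < J) MW N ^+ k.+1 * MB N ^+ k * (th N ^+ r * th N ^+ r))
    @[N --> \oo] --> (1 - mw * mb) / mw * (\sum_(k < J) mw ^+ k.+1 * mb ^+ k * (1 ^+ r * 1 ^+ r)).
  apply: cvgMl_tmp; apply: cvg_sumr => k.
  by apply: cvgM; apply: cvgM; exact: exprc.
have lim : (1 - mw * mb) / mw * (\sum_(k < J) mw ^+ k.+1 * mb ^+ k * (1 ^+ r * 1 ^+ r)) =
    1 - (mw * mb) ^+ J.
  have -> : 1 - (mw * mb) ^+ J = (1 - mw * mb) * \sum_(i < J) (mw * mb) ^+ i.
    by rewrite -opprB subrX1 -mulNr opprB.
  rewrite -mulrA mulr_sumr; congr (_ * _); apply: eq_bigr => k _.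
  by rewrite !expr1n !mulr1 exprS exprMn mulrA mulKf// gt_eqF.
rewrite lim in cv; have /cvgrPdist_le/(_ _ e20)[N _ hN] := cv.
exists (patterns r N J); split.
- apply: (@uniq_flatten_key _ _ (fun pt : pattern => (size pt.1)./2)) => [|k|k pt].
  + exact: iota_uniq.
  + apply: allpairs_uniq; last by move=> [x s] [x' s'] _ _ /= [-> ->].
      by apply: uniq_contexts; exact: uniq_sequences_split.
    apply: allpairs_uniq; try exact: uniq_sequences.
    by move=> [x s] [x' s'] _ _ /= [-> ->].
  case/allpairsP => -[c lr] [/= /size_contexts sc _ ->] /=.
  by rewrite (_ : size c = (2 * k).+1)//; lia.
- move=> pt /flatten_mapP[k _ /allpairsP[[c lr] [/= /size_contexts sc]]].
  case/allpairsP => -[lt rt] [/= /size_sequences sl /size_sequences sr -> ->] /=.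
  by split => //; rewrite sc; lia.
rewrite -mulr_sumr sum_patterns.
by have := hN N (leqnn N); rewrite /= ler_norml => /andP[_]; lra.
Qed.

End total_mass.

(** * Measurability *)

Lemma plane_tree_countable : exists e : plane_tree -> nat, injective e.
Proof.
pose fix enc (t : plane_tree) : GenTree.tree nat :=
  let: Node ts := t in GenTree.Node 0 (map enc ts).
exists (pickle \o enc); apply: inj_comp; first exact: (pcan_inj pickleK).
elim/plane_tree_nested_ind => ts IH [ts'] /= [] e; congr Node.
elim: ts ts' IH e => [|t ts IHt] [|t' ts'] //= IH [e1 e2]; congr cons.
  by apply: IH e1; exact: mem_head.
by apply: IHt e2 => t0 t0in; apply: IH; rewrite in_cons t0in orbT.
Qed.

Section discrete_measurability.
Context {d : measure_display} {Om : measurableType d}.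

Definition discretely_measurable (E : Type) (g : Om -> E) : Prop :=
  forall A : set E, measurable (g @^-1` A).

(** Decomposition over the countably many values of [a]. The remaining expression may depend on this
    value, as the children shown in a ball depend on the degree. *)
Lemma discretely_measurable_dep (E1 E2 : Type) (e : E1 -> nat) (a : Om -> E1) (F : E1 -> Om -> E2) :
  injective e -> (forall x, measurable (a @^-1` [set x])) ->
  (forall x, discretely_measurable (F x)) ->
  discretely_measurable (fun w => F (a w) w).
Proof.
move=> ei ma mF A.
have -> : (fun w => F (a w) w) @^-1` A =
    \bigcup_n [set w | e (a w) = n /\ A (F (a w) w)].
  by apply/seteqP; split => [w Aw|w [n _ [_ Aw]]]; [exists (e (a w))|].
apply: bigcupT_measurable => n.
have [[x xn]|no] := pselect (exists x, e x = n).
  have -> : [set w | e (a w) = n /\ A (F (a w) w)] = a @^-1` [set x] `&` F x @^-1` A.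
    apply/seteqP; split => w /=; last by move=> [-> Aw].
    by move=> [en Aw]; have aw : a w = x; [apply: ei; rewrite en|rewrite -aw].
  by apply: measurableI; [exact: ma|exact: mF].
have -> : [set w | e (a w) = n /\ A (F (a w) w)] = set0.
  by apply/seteqP; split => // w /= [h _]; apply: no; exists (a w).
exact: measurable0.
Qed.

Lemma discretely_measurable_countable (E : Type) (e : E -> nat) (g : Om -> E) :
  injective e -> (forall x, measurable (g @^-1` [set x])) -> discretely_measurable g.
Proof.
move=> ei mg; apply: (@discretely_measurable_dep E E e g (fun x _ => x)) => // x A.
have [Ax|nAx] := pselect (A x).
  by rewrite (_ : _ @^-1` _ = setT)//; apply/seteqP; split.
by rewrite (_ : _ @^-1` _ = set0)//; apply/seteqP; split.
Qed.

Lemma discretely_measurable_comp (E1 E2 : Type) (h : E1 -> E2) (g : Om -> E1) :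
  discretely_measurable g -> discretely_measurable (h \o g).
Proof. by move=> mg A; rewrite comp_preimage; exact: mg. Qed.

Lemma discretely_measurable_comp2 (E1 : countType) (E2 E3 : Type) (h : E1 -> E2 -> E3)
    (a : Om -> E1) (b : Om -> E2) :
  discretely_measurable a -> discretely_measurable b ->
  discretely_measurable (fun w => h (a w) (b w)).
Proof.
move=> ma mb; apply: (@discretely_measurable_dep _ _ pickle a (fun x w => h x (b w))).
- exact: (pcan_inj pickleK).
- by move=> x; exact: ma.
- by move=> x; exact: (discretely_measurable_comp (h x) mb).
Qed.

Lemma measurable_fun_discrete (R : realType) (E : Type) (h : E -> R) (g : Om -> E) :
  discretely_measurable g -> measurable_fun setT (h \o g).
Proof. by move=> mg _ A mA; rewrite setTI comp_preimage; exact: mg. Qed.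

Variables (L : Om -> nat) (S : nat -> Om -> nat * nat) (xi : address -> Om -> nat).
Hypothesis mL : discretely_measurable L.
Hypothesis mS : forall h, discretely_measurable (S h).
Hypothesis mxi : forall u, discretely_measurable (xi u).

Lemma discretely_measurable_spine h :
  discretely_measurable (fun w => spine (S ^~ w) h).
Proof.
elim: h => [|h IH].
  by move=> A; apply: (discretely_measurable_comp (fun=> [::]) mL).
under eq_fun do rewrite spine_rcons.
exact: (discretely_measurable_comp2 (fun s x => rcons s (Posz x.2)) IH (mS h)).
Qed.

Let deg (u : address) (w : Om) : option nat :=
  if (size u < 2 * L w)%N && (u == spine (S ^~ w) (size u)) then
    if (size u).+1 == (2 * L w)%N then None else Some (S (size u) w).1
  else Some (xi u w).

Let mdeg u : discretely_measurable (deg u).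
Proof.
have h1 := discretely_measurable_comp2 pair mL (discretely_measurable_spine (size u)).
have h2 := discretely_measurable_comp2 pair (mS (size u)) (mxi u).
exact: (discretely_measurable_comp2 (fun x y =>
  if (size u < 2 * x.1)%N && (u == x.2) then
    if (size u).+1 == (2 * x.1)%N then None else Some y.1.1
  else Some y.2) h1 h2).
Qed.

Lemma discretely_measurable_in_tree u :
  discretely_measurable (fun w => in_tree (deg ^~ w) u).
Proof.
elim/last_ind: u => [|u l IH].
  by move=> A; apply: (discretely_measurable_comp (fun=> true) mL).
under eq_fun do rewrite in_tree_rcons.
exact: (discretely_measurable_comp2 (fun (b : bool) k => b && child_label k l) IH (mdeg u)).
Qed.

Lemma discretely_measurable_degree u :
  discretely_measurable (fun w => limit_tree L S xi w u).
Proof.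
exact: (discretely_measurable_comp2 (fun (b : bool) k => if b then k else Some 0%N)
  (discretely_measurable_in_tree u) (mdeg u)).
Qed.

Lemma discretely_measurable_ball_at r h u :
  discretely_measurable (fun w => lr_ball_at r h (limit_tree L S xi w) u).
Proof.
elim: h u => [|h IH] u.
  by move=> A; apply: (discretely_measurable_comp (fun=> leaf) mL).
have [e ei] := plane_tree_countable.
have ms (ls : seq int) : discretely_measurable
    (fun w => [seq lr_ball_at r h (limit_tree L S xi w) (rcons u l) | l <- ls]).
  elim: ls => [|l ls IHl]; first by move=> A; apply: (discretely_measurable_comp (fun=> [::]) mL).
  apply: (@discretely_measurable_dep _ _ e _ (fun t w => t ::
    [seq lr_ball_at r h (limit_tree L S xi w) (rcons u l) | l <- ls]) ei) => [x|x].
    exact: IH.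
  exact: (discretely_measurable_comp (cons x) IHl).
have mlab := discretely_measurable_comp (ball_labels r) (discretely_measurable_degree u).
apply: (discretely_measurable_comp Node).
apply: (@discretely_measurable_dep _ _ pickle _ (fun ls w =>
  [seq lr_ball_at r h (limit_tree L S xi w) (rcons u l) | l <- ls])) => [|x|x].
- exact: (pcan_inj pickleK).
- exact: mlab.
- exact: ms.
Qed.

Lemma discretely_measurable_ball r :
  discretely_measurable (fun w => lr_ball r (limit_tree L S xi w)).
Proof. exact: discretely_measurable_ball_at. Qed.

End discrete_measurability.

(** * The step distribution *)

Lemma nneseries_cvg (R : realType) (f : nat -> R) (s : R) : (forall k, 0 <= f k) ->
  (\sum_(0 <= k <oo) (f k)%:E = s%:E)%E -> \sum_(k < K) f k @[K --> \oo] --> s.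
Proof.
move=> f0 fs.
have cv : (\sum_(0 <= k < n) (f k)%:E)%E @[n --> \oo] --> s%:E.
  by rewrite -fs; apply: is_cvg_nneseries => n _ _; rewrite lee_fin.
have /fine_cvg := cv; apply: cvg_trans; apply: near_eq_cvg; near=> n.
by rewrite /= sumEFin /= big_mkord.
Unshelve. all: by end_near. Qed.

Lemma psum_le_lim (R : realType) (f : nat -> R) (s : R) K : (forall k, 0 <= f k) ->
  \sum_(k < K) f k @[K --> \oo] --> s -> \sum_(k < K) f k <= s.
Proof.
move=> f0 fs; have nd : nondecreasing_seq (fun K => \sum_(k < K) f k).
  by apply/nondecreasing_seqP => N; rewrite big_ord_recr /= lerDl.
rewrite -(cvg_lim _ fs)//.
by apply: (@nondecreasing_cvgn_le _ (fun K => \sum_(k < K) f k)) => //; apply/cvg_ex; exists s.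
Qed.

Lemma mean_fin (R : realType) (rho : nat -> R) (s : R) : (forall k, 0 <= rho k) ->
  mean rho = s%:E -> \sum_(k < K) k.+1%:R * rho k.+1 @[K --> \oo] --> s.
Proof.
move=> r0 ms; have h0 k : 0 <= k%:R * rho k by rewrite mulr_ge0.
have := nneseries_cvg h0 ms; rewrite -(cvg_shiftS (fun K => \sum_(k < K) k%:R * rho k)) /=.
by under eq_fun do rewrite big_ord_recl mul0r add0r.
Qed.

Section offspring_pair.
Variables (R : realType) (rho_w rho_b : nat -> R) (p : R).
Hypothesis pmf_w : is_pmf rho_w.
Hypothesis pmf_b : is_pmf rho_b.
Hypothesis subcrit : subcritical rho_w rho_b.
Hypothesis p01 : 0 < p < 1.
Hypothesis geom_w : forall k, rho_w k = (1 - p) * p ^+ k.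
Hypothesis heavy_b : no_exponential_moment rho_b.

Let p0 : 0 < p. Proof. by case/andP: p01. Qed.
Let p1 : p < 1. Proof. by case/andP: p01. Qed.
Let w0 : forall k, 0 <= rho_w k := pmf_w.1.
Let b0 : forall k, 0 <= rho_b k := pmf_b.1.

Lemma exponential_sum_unbounded z B : 1 < z -> exists K, B < \sum_(k < K) rho_b k * z ^+ k.
Proof.
move=> z1; have z0 : 0 < z by apply: lt_trans z1.
have s0 : 0 < ln z by rewrite ln_gt0.
apply: contrapT => no.
have le K : \sum_(k < K) rho_b k * z ^+ k <= B.
  by rewrite leNgt; apply/negP => lt; apply: no; exists K.
have := heavy_b s0.
have : (\sum_(0 <= k <oo) (expR (ln z * k%:R) * rho_b k)%:E <= B%:E)%E.
  apply: lime_le.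
    by apply: is_cvg_nneseries => n _ _; rewrite lee_fin mulr_ge0 ?expR_ge0.
  apply: nearW => K; rewrite sumEFin lee_fin big_mkord; apply: le_trans (le K).
  apply: ler_sum => k _; rewrite mulrC expRM_natr lnK//.
by move=> h1 h2; rewrite h2 in h1.
Qed.

(** Both means are positive, and then a product below 1 excludes [+oo]. The mean of [rho_b] is
    positive because a law concentrated at 0 has exponential moments. *)
Lemma offspring_means : exists mw mb : R,
  [/\ mean rho_w = mw%:E, mean rho_b = mb%:E, 0 < mw & 0 < mb].
Proof.
have term (rho : nat -> R) k : (forall k, 0 <= rho k) -> ((k%:R * rho k)%:E <= mean rho)%E.
  move=> r0; have h0 n : (0 <= (n%:R * rho n)%:E)%E by rewrite lee_fin mulr_ge0.
  have := @nneseries_lim_ge R (fun k => (k%:R * rho k)%:E) xpredT 0%N k.+1 (fun n _ _ => h0 n).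
  by apply: le_trans; rewrite big_nat_recr//= leeDr// sume_ge0.
have mw_gt0 : (0 < mean rho_w)%E.
  apply: lt_le_trans (term _ 1%N w0); rewrite lte_fin mul1r geom_w expr1.
  by rewrite mulr_gt0 ?subr_gt0.
have [k k1 kp] : exists2 k, (0 < k)%N & 0 < rho_b k.
  apply: contrapT => no; have z k : (0 < k)%N -> rho_b k = 0.
    move=> k1; apply/eqP; rewrite eq_le b0 andbT leNgt; apply/negP => kp.
    by apply: no; exists k.
  have [[|K]] := exponential_sum_unbounded (rho_b 0%N) (ltr1n R 2).
    by rewrite big_ord0 ltNge b0.
  rewrite big_ord_recl expr0 mulr1 big1 ?addr0 ?ltxx// => i _.
  by rewrite lift0 z ?mul0r.
have mb_gt0 : (0 < mean rho_b)%E.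
  by apply: lt_le_trans (term _ k b0); rewrite lte_fin mulr_gt0 ?ltr0n.
move: subcrit; rewrite /subcritical.
case: (mean rho_w) mw_gt0 => [mw||]//; case: (mean rho_b) mb_gt0 => [mb||]//.
- by rewrite !lte_fin => mb0 mw0 _; exists mw, mb.
- by rewrite lte_fin => _ mw0; rewrite gt0_muley ?lte_fin.
- by rewrite lte_fin => mb0 _; rewrite gt0_mulye ?lte_fin.
Qed.

Variables mw mb : R.
Hypothesis mean_w : mean rho_w = mw%:E.
Hypothesis mean_b : mean rho_b = mb%:E.
Hypothesis mw_gt0 : 0 < mw.
Hypothesis mb_gt0 : 0 < mb.

Let cvg_mean_w := mean_fin w0 mean_w.
Let cvg_mean_b := mean_fin b0 mean_b.
Let cvg_w := nneseries_cvg w0 pmf_w.2.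
Let cvg_b := nneseries_cvg b0 pmf_b.2.

Lemma mean_product : mw * mb < 1.
Proof. by move: subcrit; rewrite /subcritical mean_w mean_b -EFinM lte_fin. Qed.

(* [rho_w (k + 1) = p * rho_w k] gives [mw = p * (mw + 1)]. *)
Lemma mean_geometric : mw * (1 - p) = p.
Proof.
have h0 k : 0 <= k%:R * rho_w k by rewrite mulr_ge0.
have c1 := nneseries_cvg h0 mean_w.
have c2 : \sum_(k < K) k.+1%:R * rho_w k.+1 @[K --> \oo] --> p * (mw + 1).
  have -> : (fun K => \sum_(k < K) k.+1%:R * rho_w k.+1) =
      (fun K => p * (\sum_(k < K) k%:R * rho_w k + \sum_(k < K) rho_w k)).
    apply/funext => K; rewrite -big_split mulr_sumr /=; apply: eq_bigr => k _.
    by rewrite !geom_w exprS -natr1; ring.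
  by apply: cvgMl_tmp; exact: cvgD.
have : mw = p * (mw + 1) by rewrite -(cvg_lim _ c2)// (cvg_lim _ cvg_mean_w).
by move=> e; rewrite mulrBr mulr1 {1}e; ring.
Qed.

(** By [mw * (1 - p) = p], the condition [p * (1 + mb) < 1] is the same as [mw * mb < 1]. *)
Lemma offspring_step_law : step_law (step_of rho_b p) (p * (1 + mb)).
Proof.
have mu0 k : 0 <= step_of rho_b p k.
  by case: k => [|k] /=; rewrite ?subr_ge0 ?(ltW p1)// mulr_ge0// ltW.
have sb K := psum_le_lim K b0 cvg_b.
have h0 k : 0 <= k%:R * rho_b k by rewrite mulr_ge0.
have sm K := psum_le_lim K h0 (nneseries_cvg h0 mean_b).
have sumS K : \sum_(k < K.+1) step_of rho_b p k = 1 - p + p * \sum_(k < K) rho_b k.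
  rewrite big_ord_recl /=; congr (_ + _); rewrite mulr_sumr; apply: eq_bigr => k _.
  by rewrite /bump.
split => //.
- case=> [|K]; first by rewrite big_ord0.
  rewrite sumS; have : p * \sum_(k < K) rho_b k <= p * 1 by rewrite ler_wpM2l// ltW.
  lra.
- move=> e e0; have ep : 0 < e / p / 2 by rewrite !divr_gt0.
  have /cvgrPdist_le/(_ _ ep)[K _ h] := cvg_b.
  exists K.+1; rewrite sumS; have := h K (leqnn K).
  rewrite /= ler_norml => /andP[_ h1].
  have : p * (1 - e / p / 2) <= p * \sum_(k < K) rho_b k by rewrite ler_wpM2l ?(ltW p0)//; lra.
  have -> : p * (1 - e / p / 2) = p - e / 2 by field; rewrite gt_eqF.
  lra.
- have e := mean_geometric.
  have : (1 - p) * (mw * mb) < (1 - p) * 1 by rewrite ltr_pM2l ?subr_gt0 ?mean_product.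
  by rewrite mulrA [(1 - p) * mw]mulrC e; lra.
- case=> [|K]; first by rewrite big_ord0 mulr_ge0 ?addr_ge0// ltW.
  rewrite big_ord_recl mul0r add0r.
  have -> : \sum_(i < K) (lift ord0 i)%:R * step_of rho_b p (lift ord0 i) =
      p * (\sum_(i < K) rho_b i + \sum_(i < K) i%:R * rho_b i).
    rewrite -big_split mulr_sumr; apply: eq_bigr => i _ /=.
    by rewrite /bump add1n -natr1; ring.
  by rewrite ler_wpM2l ?(ltW p0)// lerD.
- move=> z B z1; have [K hK] := exponential_sum_unbounded (B / p) z1.
  exists K.+1; rewrite big_ord_recl expr0 mulr1 /=.
  have z0 : 0 < z by apply: lt_trans z1.
  have : p * (B / p) < p * \sum_(k < K) rho_b k * z ^+ k by rewrite ltr_pM2l.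
  rewrite mulrCA divff ?gt_eqF// mulr1 => /lt_le_trans; apply.
  rewrite -[leLHS]add0r lerD ?subr_ge0 ?(ltW p1)//.
  rewrite mulr_sumr; apply: ler_sum => k _.
  rewrite /bump add1n exprS mulrA ler_wpM2l ?mulr_ge0 ?(ltW p0)//.
  by rewrite ler_peMl ?exprn_ge0 ?(ltW z0)// ltW.
- by rewrite /= subr_gt0.
Qed.

Lemma GW_sizeE n : GW_size rho_w rho_b n = (forest_mass (step_of rho_b p) n 1)%:E.
Proof.
have set_trees : [set t | nb_vertices t = n] = [set` trees_of_size n].
  by apply/seteqP; split => t /=; rewrite mem_trees_of_size => /eqP.
rewrite /GW_size set_trees esum_fset.
- rewrite -fsbig_seq ?uniq_trees_of_size// sumEFin; congr EFin.
  rewrite -(sum_forests rho_b geom_w) -sum_trees_of_size.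
  by apply: eq_bigr => t _; rewrite GW_weight.
- exact: finite_seq.
- move=> t _; rewrite lee_fin GW_weight; apply: tree_weight_ge0 => h k.
  by rewrite /color_law; case: odd.
Qed.

End offspring_pair.

(** * Convergence in distribution *)

Section bounded_integrals.
Context {d : measure_display} {Om : measurableType d} {R : realType} (P : probability Om R).

Lemma bounded_integrable (f : Om -> R) (C : R) : measurable_fun setT f ->
  (forall w, `|f w| <= C) -> P.-integrable setT (EFin \o f).
Proof.
move=> mf fC; apply: measurable_bounded_integrable => //.
  by rewrite (le_lt_trans (probability_le1 P _))// ltry.
exists C; split; first exact: num_real.
by move=> M CM w _ /=; rewrite (le_trans (fC w))// ltW.
Qed.

Lemma expectation_bounded (f : Om -> R) (C : R) : measurable_fun setT f ->
  (forall w, `|f w| <= C) -> ('E_P[f] = (\int[P]_w f w)%R%:E)%E.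
Proof.
move=> mf fC; rewrite unlock /Rintegral fineK//.
exact/integrable_fin_num/(bounded_integrable mf fC).
Qed.

Lemma Rintegral_probability_cst (c : R) : \int[P]_w c = c.
Proof.
rewrite Rintegral_cst// -[RHS]mulr1; congr (_ * _).
have PT : P setT = 1%E := probability_setT P.
by transitivity (fine (P setT)) => //; rewrite PT.
Qed.

Lemma Rintegral_simple (I : eqType) (s : seq I) (A : I -> set Om) (a : I -> R) (c : R) :
  (forall i, i \in s -> measurable (A i)) ->
  P.-integrable setT (EFin \o (fun w => c + \sum_(i <- s) a i * \1_(A i) w)) /\
  \int[P]_w (c + \sum_(i <- s) a i * \1_(A i) w) = c + \sum_(i <- s) a i * fine (P (A i)).
Proof.
elim: s => [|i s IH] mA.
  rewrite big_nil addr0; split.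
    under eq_fun do rewrite big_nil addr0.
    exact: finite_measure_integrable_cst.
  under eq_Rintegral do rewrite big_nil addr0.
  exact: Rintegral_probability_cst.
have [int eq] := IH (fun j js => mA j (mem_behead (s := i :: s) js)).
have mi : measurable (A i) by apply: mA; exact: mem_head.
have inti := integrable_indic P mi.
have intZ : P.-integrable setT (EFin \o (fun w => a i * \1_(A i) w)).
  exact: (integrableZl measurableT (a i) inti).
have e : (fun w => c + \sum_(j <- i :: s) a j * \1_(A j) w) =
    (fun w => a i * \1_(A i) w + (c + \sum_(j <- s) a j * \1_(A j) w)).
  by apply/funext => w; rewrite big_cons addrCA.
rewrite e; split; first exact: (integrableD measurableT intZ int).
rewrite RintegralD// eq RintegralZl// big_cons [RHS]addrCA; congr (_ * _ + _).
by rewrite /Rintegral integral_indic// setIT.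
Qed.

Lemma sum_indic_unique (I : eqType) (s : seq I) (A : I -> set Om) (a : I -> R) w : uniq s ->
  (forall i j, i \in s -> j \in s -> A i w -> A j w -> i = j) ->
  (exists i, [/\ i \in s, A i w & \sum_(j <- s) a j * \1_(A j) w = a i]) \/
  \sum_(j <- s) a j * \1_(A j) w = 0.
Proof.
move=> us h; have [[i is_ Ai]|no] := pselect (exists2 i, i \in s & A i w).
  left; exists i; split => //; rewrite (bigD1_seq i)//= indicE mem_set// mulr1.
  rewrite big1_seq ?addr0// => j /andP[ji js]; rewrite indicE memNset ?mulr0// => Aj.
  by move: ji; rewrite (h i j) ?eqxx.
right; rewrite big1_seq// => j /andP[_ js]; rewrite indicE memNset ?mulr0// => Aj.
by apply: no; exists j.
Qed.

Lemma Rintegral_affine (f : Om -> R) (a b C : R) : measurable_fun setT f ->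
  (forall w, `|f w| <= C) -> \int[P]_w (a + b * f w) = a + b * \int[P]_w f w.
Proof.
move=> mf fC; have int := bounded_integrable mf fC.
rewrite RintegralD//; last 2 first.
- exact: (finite_measure_integrable_cst P a measurableT).
- exact: (integrableZl measurableT b int).
by rewrite RintegralZl// Rintegral_probability_cst.
Qed.

End bounded_integrals.

Lemma filter_forall_in (T : Type) (F : set_system T) (I : eqType) (s : seq I) (A : I -> set T) :
  Filter F -> (forall i, i \in s -> F (A i)) -> F [set x | forall i, i \in s -> A i x].
Proof.
move=> FF; elim: s => [|i s IH] h; first exact: filterS filterT.
have Fi := h i (mem_head _ _).
have Fs := IH (fun j js => h j (mem_behead (s := i :: s) js)).
apply: filterS (filterI Fi Fs) => x [Ai As] j; rewrite in_cons => /orP[/eqP->//|]; exact: As.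
Qed.

Section ball_inf.
Context {R : realType} (g : localstar R -> R).
Hypothesis g_ge0 : forall t, 0 <= g t.

(** Composed with [lr_ball r], the largest minorant of [g] that depends only on the ball of radius
    [r]; as balls are finite plane trees, it takes countably many values. *)
Definition ball_inf (r : nat) (b : plane_tree) : R :=
  inf [set g t | t in [set t : localstar R | lr_ball r t = b]].

Lemma ball_inf_le r t : ball_inf r (lr_ball r t) <= g t.
Proof. by apply: ge_inf; [exists 0 => _ [t' _ <-]|exists t]. Qed.

Lemma ball_inf_ge r t (x : R) : (forall t', lr_ball r t' = lr_ball r t -> x <= g t') ->
  x <= ball_inf r (lr_ball r t).
Proof. by move=> h; apply: lb_le_inf => [|_ [t' /= e <-]]; [exists (g t), t|exact: h]. Qed.

Lemma ball_inf_ge0 r t : 0 <= ball_inf r (lr_ball r t).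
Proof. exact: ball_inf_ge. Qed.

Lemma ball_inf_cvg t : continuous g -> ball_inf r (lr_ball r t) @[r --> \oo] --> g t.
Proof.
move=> gc; apply/cvgrPdist_le => e e0.
have /cvgrPdist_lt/(_ _ e0)/nbhs_ballP[dl /= d0 hd] := gc t.
have [n] := @ltr_add_invr R 0 _ d0; rewrite add0r => nd.
exists n => // r /= nr.
have lo : g t - e <= ball_inf r (lr_ball r t).
  apply: ball_inf_ge => t' e'; have : ball (t : localstar R) dl (t' : localstar R).
    rewrite ballEmdist /=; apply: le_lt_trans nd.
    apply: (@dstar_le R t t' n); symmetry; exact: lr_ball_le e'.
  by move/hd; rewrite /= ltr_norml => /andP[_]; lra.
by have := ball_inf_le r t; rewrite ler_norml; lra.
Qed.

End ball_inf.

Section convergence.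
Variables (R : realType) (rho_w rho_b : nat -> R) (p : R).
Hypothesis pmf_w : is_pmf rho_w.
Hypothesis pmf_b : is_pmf rho_b.
Hypothesis subcrit : subcritical rho_w rho_b.
Hypothesis p01 : 0 < p < 1.
Hypothesis geom_w : forall k, rho_w k = (1 - p) * p ^+ k.
Hypothesis heavy_b : no_exponential_moment rho_b.
Variables (dk : nat -> measure_display) (Omk : forall k : nat, measurableType (dk k)).
Variables (Pk : forall k : nat, probability (Omk k) R) (T : forall k : nat, Omk k -> plane_tree).
Hypothesis lawT : forall k : nat, (0 < GW_size rho_w rho_b k)%E ->
  has_law (Pk k) (@T k) (GW_cond rho_w rho_b k).
Variables (d : measure_display) (Om : measurableType d) (P : probability Om R).
Variables (L : Om -> nat) (S : nat -> Om -> nat * nat) (xi : address -> Om -> nat).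
Hypothesis lawT_lim : limit_source rho_w rho_b P L S xi.

Let X := limit_tree L S xi.
Let G : set_system nat := within [set k : nat | (0 < GW_size rho_w rho_b k)%E] \oo.

#[local] Instance conditioning_filter : Filter G.
Proof. exact: within_filter. Qed.

(** If trees with [k] vertices have positive mass, then [walk mu k k.-1] is positive, so the
    asymptotics of the walk hold along the conditioning. *)
Lemma tree_sizes_conditioning (Q : set nat) : tree_sizes (step_of rho_b p) Q -> G Q.
Proof.
have /andP[p0 p1] := p01.
have [mw [mb [mean_w mean_b mw0 mb0]]] := offspring_means pmf_w pmf_b subcrit p01 geom_w heavy_b.
have law := offspring_step_law pmf_w pmf_b subcrit p01 geom_w heavy_b mean_w mean_b mb0.
rewrite /tree_sizes /G /within /=; apply: filterS => n h.
rewrite (GW_sizeE pmf_w pmf_b geom_w) lte_fin => n0; apply: h.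
exact: lt_le_trans n0 (tree_mass_le_walk law n).
Qed.

Lemma limit_ball_measurable r : discretely_measurable (fun w => lr_ball r (X w)).
Proof.
case: lawT_lim => hL hS hx _; apply: discretely_measurable_ball => [|h|u].
- apply: (@discretely_measurable_countable _ _ nat id) => // x; exact: (hL x).1.
- apply: (@discretely_measurable_countable _ _ (nat * nat)%type pickle) => [|x].
    exact: (pcan_inj pickleK).
  exact: (hS h x).1.
- apply: (@discretely_measurable_countable _ _ nat id) => // x; exact: (hx u x).1.
Qed.

Lemma conditioned_tree_measurable k : (0 < GW_size rho_w rho_b k)%E ->
  discretely_measurable (@T k).
Proof.
have [e ei] := plane_tree_countable.
move=> /lawT h; apply: (discretely_measurable_countable ei) => t; exact: (h t).1.
Qed.

(** A pointwise limit of functions of balls, which avoids a sigma-algebra on [localstar]. *)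
Lemma continuous_limit_measurable (g : localstar R -> R) C : continuous g ->
  (forall t, 0 <= g t <= C) -> measurable_fun setT (g \o X).
Proof.
move=> gc g0C; have g0 t : 0 <= g t by case/andP: (g0C t).
apply: (@measurable_fun_cvg _ _ _ _ (fun r w => ball_inf g r (lr_ball r (X w)))) => [r|w _].
  exact: (measurable_fun_discrete (ball_inf g r) (limit_ball_measurable r)).
exact: (@ball_inf_cvg _ g g0 (X w) gc).
Qed.

Lemma ball_inf_integral (g : localstar R -> R) C (e : R) : continuous g ->
  (forall t, 0 <= g t <= C) -> 0 < e -> exists r,
    \int[P]_w g (X w) <= \int[P]_w ball_inf g r (lr_ball r (X w)) + e.
Proof.
move=> gc g0C e0; have g0 t : 0 <= g t by case/andP: (g0C t).
have mg := continuous_limit_measurable gc g0C.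
pose f_ r w := ball_inf g r (lr_ball r (X w)).
have mf r : measurable_fun setT (f_ r).
  by apply: measurable_fun_discrete; exact: limit_ball_measurable.
have fC r w : `|f_ r w| <= C.
  rewrite ger0_norm ?ball_inf_ge0// (le_trans (ball_inf_le g0 r (X w)))//.
  by case/andP: (g0C (X w)).
have cv : (\int[P]_w (f_ r w)%:E)%E @[r --> \oo] --> (\int[P]_w (g (X w))%:E)%E.
  apply: (@dominated_cvg _ _ _ P setT measurableT (fun r w => (f_ r w)%:E)
    (fun w => (g (X w))%:E) (cst C%:E)) => [r|w _|w _||r w _].
  - exact/measurable_EFinP.
  - apply: cvg_EFin; first exact: nearW.
    exact: (@ball_inf_cvg _ g g0 (X w) gc).
  - by [].
  - exact: (finite_measure_integrable_cst P C measurableT).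
  - by rewrite /= lee_fin.
have intg : P.-integrable setT (EFin \o (g \o X)).
  apply: (bounded_integrable P (C := C) mg) => w /=.
  by have /andP[a b] := g0C (X w); rewrite ger0_norm.
have /fine_cvg/cvgrPdist_le/(_ _ e0)[r _ h] :
    (\int[P]_w (f_ r w)%:E)%E @[r --> \oo] --> (\int[P]_w g (X w))%R%:E.
  by rewrite /Rintegral fineK//; exact: integrable_fin_num.
exists r; have := h r (leqnn r); rewrite /= ler_norml => /andP[_].
by rewrite lerBlDl addrC.
Qed.

(** Of the error [e], one half pays for replacing [g] by [ball_inf], a quarter for the mass missed
    by finitely many patterns, and a quarter for the lower limits of the pattern probabilities. *)
Lemma liminf_expectation (g : localstar R -> R) C (e : R) : continuous g ->
  (forall t, 0 <= g t <= C) -> 0 < e ->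
  \forall k \near G, \int[P]_w g (X w) <= \int[Pk k]_w g (embed (@T k w)) + e.
Proof.
move=> gc g0C e0; have g0 t : 0 <= g t by case/andP: (g0C t).
have gC t : g t <= C by case/andP: (g0C t).
have C0 : 0 <= C := le_trans (g0 (embed leaf)) (gC _).
have /andP[p0 p1] := p01.
have [mw [mb [mean_w mean_b mw0 mb0]]] := offspring_means pmf_w pmf_b subcrit p01 geom_w heavy_b.
have law := offspring_step_law pmf_w pmf_b subcrit p01 geom_w heavy_b mean_w mean_b mb0.
have mprod := mean_product subcrit mean_w mean_b.
have mgeom := mean_geometric pmf_w geom_w mean_w.
have wge h k : 0 <= color_law rho_w rho_b h k.
  by rewrite /color_law; case: odd; [exact: pmf_b.1|exact: pmf_w.1].
set mu := step_of rho_b p in law.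
have e20' : 0 < e / 2 by rewrite divr_gt0.
have [r hr] := ball_inf_integral gc g0C e20'.
pose c pt := ball_inf g r (lr_ball r (embed (plug pt [::]))).
have c0 pt : 0 <= c pt by exact: ball_inf_ge0.
have cC pt : c pt <= C by apply: le_trans (gC (embed (plug pt [::]))); exact: ball_inf_le.
(* [C] may be 0, while a positive bound is needed to divide by. *)
pose C' := C + 1; have C'0 : 0 < C' by rewrite /C'; lra.
have e10 : 0 < e / 4 / C' by rewrite !divr_gt0.
have mw01 : 0 <= mw * mb < 1 by rewrite mprod mulr_ge0 ?ltW.
have [pts [upts hpts mass]] := total_mass pmf_w.1 pmf_b.1
  (nneseries_cvg pmf_b.1 pmf_b.2) (mean_fin pmf_w.1 mean_w) (mean_fin pmf_b.1 mean_b)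
  geom_w law mw0 mw01 r e10.
pose q pt := (1 - mw * mb) / mw * pattern_weight rho_w rho_b pt.
rewrite -/q in mass.
have mwn : mw != 0 by rewrite gt_eqF.
have mbn : mb != 0 by rewrite gt_eqF.
have qP pt : pt \in pts -> fine (P (pattern_event L S xi pt)) = q pt.
  move=> /hpts[od _ _].
  by rewrite (pattern_event_prob lawT_lim mean_w mean_b mwn mbn od).
have limit_side : \int[P]_w ball_inf g r (lr_ball r (X w)) <= \sum_(pt <- pts) c pt * q pt + e / 4.
  have mE pt : pt \in pts -> measurable (pattern_event L S xi pt).
    by move=> /hpts[od _ _]; exact: (measurable_pattern_event lawT_lim od).
  (* This simple function is [c pt] on the event of [pt] and [C] off all events: an upper bound of
     the integrand. *)
  have [int eq] := Rintegral_simple P (fun pt => c pt - C) C mE.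
  apply: (@le_trans _ _ (\int[P]_w (C + \sum_(pt <- pts) (c pt - C) * \1_(pattern_event L S xi pt) w))).
    apply: le_Rintegral => //.
      apply: (bounded_integrable P (C := C)).
        exact: (measurable_fun_discrete (ball_inf g r) (limit_ball_measurable r)).
      move=> w; rewrite ger0_norm ?ball_inf_ge0//.
      by rewrite (le_trans (ball_inf_le g0 r (X w))).
    move=> w _.
    have [||[pt [ptin Ept ->]]|->] := @sum_indic_unique _ Om R _ pts (pattern_event L S xi)
      (fun pt => c pt - C) w.
    - exact: upts.
    - move=> pt pt' /hpts[_ sl sr] /hpts[_ sl' sr'] E E'.
      by apply: (on_pattern_inj E E'); rewrite ?sl ?sr.
    - rewrite addrC subrK; have [_ sl sr] := hpts _ ptin.
      by rewrite /X /limit_tree (on_pattern_ball [::] Ept sl sr).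
    - by rewrite addr0 (le_trans (ball_inf_le g0 r (X w))).
  rewrite eq.
  have -> : \sum_(pt <- pts) (c pt - C) * fine (P (pattern_event L S xi pt)) =
      \sum_(pt <- pts) c pt * q pt - C * \sum_(pt <- pts) q pt.
    rewrite mulr_sumr -sumrB big_seq [RHS]big_seq; apply: eq_bigr => pt ptin.
    by rewrite qP// mulrBl.
  have h1 : C * (1 - e / 4 / C') <= C * \sum_(pt <- pts) q pt by rewrite ler_wpM2l.
  have h2 : C * (e / 4 / C') <= e / 4.
    rewrite mulrA ler_pdivrMr// mulrC ler_wpM2l ?divr_ge0 ?(ltW e0)//.
    by rewrite /C' lerDl.
  lra.
(* Fillings with at least [M] trees keep the events of the conditioned tree disjoint, by
   [plug_inj]. *)
have [M hM] := patterns_below pts.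
(* Each pattern loses [e2], with a coefficient at most [C], for a total of at most [e / 4]. *)
pose e2 := e / 4 / (C' * (size pts).+1%:R).
have e20 : 0 < e2 by rewrite !divr_gt0 ?mulr_gt0.
have ev pt : pt \in pts -> \forall k \near G, q pt - e2 <=
    (\sum_(M <= j < (k - pattern_size pt).+1)
      \sum_(f <- forests (k - pattern_size pt) j) tree_weight rho_w rho_b 0 (plug pt f)) /
    forest_mass mu k 1.
  move=> /hpts[od _ _].
  apply: tree_sizes_conditioning.
  have := pattern_lower wge p0 geom_w law (pt := pt) M od e20.
  have n1 : 1 - p != 0 by rewrite subr_eq0 eq_sym lt_eqF.
  have mwE : mw = p / (1 - p) by exact: (canRL (mulfK n1) mgeom).
  have -> : q pt = pattern_weight rho_w rho_b pt * ((1 - p * (1 + mb)) / p).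
    by rewrite /q mwE; field; rewrite n1 gt_eqF.
  exact.
have {}ev := filter_forall_in conditioning_filter ev.
have large : G [set k | forall pt, pt \in pts -> (pattern_size pt <= k)%N].
  apply: filter_forall_in => pt _.
  exact: tree_sizes_conditioning (tree_sizes_large mu (pattern_size pt)).
have good : G [set k | (0 < GW_size rho_w rho_b k)%E] by exact: withinT.
apply: filterS (filterI good (filterI large ev)) => k [k0 [klarge kev]].
pose F pt := flatten [seq forests (k - pattern_size pt) j | j <- index_iota M (k - pattern_size pt).+1].
have memF pt f : f \in F pt -> (M <= size f)%N /\ forest_size f = (k - pattern_size pt)%N.
  case/flatten_mapP => j; rewrite mem_index_iota mem_forests => /andP[Mj _] /andP[/eqP -> /eqP ->].
  by [].
pose D := flatten [seq [seq (pt, f) | f <- F pt] | pt <- pts].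
have memD x : x \in D -> x.1 \in pts /\ x.2 \in F x.1.
  by case/flatten_mapP => pt ptin /mapP[f fF ->].
have uD : uniq D.
  apply: (@uniq_flatten_key _ _ fst) => // [pt|pt x]; last by case/mapP => f _ ->.
  rewrite map_inj_uniq; last by move=> f f' [].
  apply: (@uniq_flatten_key _ _ size) => [|j|j f]; first exact: iota_uniq.
    exact: uniq_forests.
  by rewrite mem_forests => /andP[/eqP].
pose A (x : pattern * seq plane_tree) : set (Omk k) := @T k @^-1` [set plug x.1 x.2].
have mA x : x \in D -> measurable (A x) by move=> _; exact: (lawT k0 _).1.
(* Here a minorant is wanted: it is 0 off the events, where the bound used is [0 <= g]. *)
have [int eq] := Rintegral_simple (Pk k) (fun x => c x.1) 0 mA.
have finite_side : \sum_(pt <- pts) c pt * (q pt - e2) <= \int[Pk k]_w g (embed (@T k w)).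
  apply: (@le_trans _ _ (\int[Pk k]_w (0 + \sum_(x <- D) c x.1 * \1_(A x) w))); last first.
    apply: le_Rintegral => //.
      apply: (bounded_integrable (Pk k) (C := C)).
        exact: (measurable_fun_discrete (g \o embed) (conditioned_tree_measurable k0)).
      by move=> w; rewrite ger0_norm.
    move=> w _; rewrite add0r.
    have [||[x [xD Ax ->]]|->] := @sum_indic_unique _ (Omk k) R _ D A (fun x => c x.1) w => //.
      move=> [pt f] [pt' f'] /memD[/= ptin /memF[Mf _]] /memD[/= ptin' /memF[Mf' _]] Ax Ax'.
      have [_ sl sr] := hpts _ ptin; have [_ sl' sr'] := hpts _ ptin'.
      have e' : plug pt f = plug pt' f' by move: Ax Ax'; rewrite /A /= => <- <-.
      have [] := plug_inj (allP hM _ ptin) (allP hM _ ptin') _ _ Mf Mf' e'; rewrite ?sl ?sr//.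
      by move=> -> ->.
    have [ptin _] := memD _ xD; have [_ sl sr] := hpts _ ptin.
    rewrite /c (plug_ball [::] x.2 sl sr).
    by have -> : @T k w = plug x.1 x.2 by []; exact: ball_inf_le.
  rewrite eq add0r big_flatten big_map big_seq [leRHS]big_seq; apply: ler_sum => pt ptin.
  rewrite big_map big_flatten big_map /=.
  apply: le_trans (ler_wpM2l (c0 pt) (kev pt ptin)) _.
  rewrite mulr_suml mulr_sumr; apply: ler_sum => j _.
  rewrite mulr_suml mulr_sumr big_seq [leRHS]big_seq; apply: ler_sum => f.
  rewrite mem_forests => /andP[_ /eqP ff].
  rewrite (lawT k0 _).2 /= /GW_cond nb_vertices_plug ff subnKC ?eqxx ?klarge//.
  by rewrite GW_weight (GW_sizeE pmf_w pmf_b geom_w).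
have few : \sum_(pt <- pts) c pt * q pt - e / 4 <= \sum_(pt <- pts) c pt * (q pt - e2).
  under [leRHS]eq_bigr do rewrite mulrBr.
  rewrite sumrB lerD2l lerN2 -mulr_suml.
  have h1 : \sum_(pt <- pts) c pt <= C' * (size pts).+1%:R.
    apply: (@le_trans _ _ (\sum_(pt <- pts) C')).
      by apply: ler_sum => pt _; rewrite (le_trans (cC pt))// lerDl.
    rewrite big_const_seq count_predT iter_addr addr0 -[leLHS]mulr_natr ler_wpM2l ?(ltW C'0)//.
    by rewrite ler_nat.
  have h2 := ler_wpM2r (ltW e20) h1; apply: le_trans h2 _.
  by rewrite /e2 mulrC divfK// gt_eqF// mulr_gt0.
lra.
Qed.

(** Adding [C] makes both [f] and its opposite nonnegative, as the one-sided bound requires. *)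
Lemma cvg_expectation (f : localstar R -> R) C : continuous f -> (forall t, `|f t| <= C) ->
  ('E_(Pk k)[(fun w => f (embed (@T k w)))] @[k --> G] --> 'E_P[(fun w => f (X w))])%E.
Proof.
move=> fc fC.
have fC' t : - C <= f t <= C by rewrite -ler_norml.
pose g1 t := C + 1 * f t; pose g2 t := C + - 1 * f t.
have affine (a b : R) : continuous (fun t : localstar R => a + b * f t).
  move=> t; have h1 : (fun=> a : R) x @[x --> t] --> a by exact: cst_continuous.
  have h2 : (fun=> b : R) x @[x --> t] --> b by exact: cst_continuous.
  exact: (cvgD h1 (cvgM h2 (fc t))).
have g1c : continuous (g1 : localstar R -> R) by exact: affine.
have g2c : continuous (g2 : localstar R -> R) by exact: affine.
have g1C t : 0 <= g1 t <= 2 * C by have := fC' t; rewrite /g1; lra.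
have g2C t : 0 <= g2 t <= 2 * C by have := fC' t; rewrite /g2; lra.
have mfX : measurable_fun setT (f \o X).
  have -> : f \o X = (fun w => g1 (X w) - C).
    by apply/funext => w; rewrite /g1 /= mul1r addrC addKr.
  apply: measurable_funB; last exact: measurable_cst.
  exact: (continuous_limit_measurable g1c g1C).
have fXC w : `|(f \o X) w| <= C by exact: fC.
have mfT k : (0 < GW_size rho_w rho_b k)%E -> measurable_fun setT ((f \o embed) \o @T k).
  by move=> k0; exact: (measurable_fun_discrete (f \o embed) (conditioned_tree_measurable k0)).
have fTC k w : `|((f \o embed) \o @T k) w| <= C by exact: fC.
have good : G [set k | (0 < GW_size rho_w rho_b k)%E] by exact: withinT.
rewrite (expectation_bounded P mfX fXC); apply: cvg_EFin.
  apply: filterS good => k k0.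
  by rewrite (expectation_bounded (Pk k) (mfT k k0) (fTC k)).
apply/cvgrPdist_le => e e0.
have h1 := liminf_expectation g1c g1C e0; have h2 := liminf_expectation g2c g2C e0.
apply: filterS (filterI good (filterI h1 h2)) => k [k0 [/= k1 k2]].
rewrite (expectation_bounded (Pk k) (mfT k k0) (fTC k)) /=.
move: k1 k2; rewrite /g1 /g2.
rewrite !(Rintegral_affine P _ _ mfX fXC) !(Rintegral_affine (Pk k) _ _ (mfT k k0) (fTC k)).
by rewrite ler_norml; lra.
Qed.

End convergence.

Theorem proposition5p3 (R : realType) (rho_w rho_b : nat -> R) (p : R)
    (pmf_w : is_pmf rho_w) (pmf_b : is_pmf rho_b)
    (subcrit : subcritical rho_w rho_b)
    (p01 : 0 < p < 1) (geom_w : forall k : nat, rho_w k = (1 - p) * p ^+ k)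
    (heavy_b : no_exponential_moment rho_b)
    (dk : nat -> measure_display) (Omk : forall k : nat, measurableType (dk k))
    (Pk : forall k : nat, probability (Omk k) R)
    (T : forall k : nat, Omk k -> plane_tree)
    (lawT : forall k : nat, (0 < GW_size rho_w rho_b k)%E ->
       has_law (Pk k) (T k) (GW_cond rho_w rho_b k))
    (d : measure_display) (Om : measurableType d) (P : probability Om R)
    (L : Om -> nat) (S : nat -> Om -> nat * nat) (xi : address -> Om -> nat)
    (lawT_lim : limit_source rho_w rho_b P L S xi) :
  @cvg_in_distribution R (localstar R)
    (within [set k : nat | (0 < GW_size rho_w rho_b k)%E] \oo)
    dk Omk Pk (fun k w => embed (T k w))
    d Om P (limit_tree L S xi).
Proof.
move=> f fc [C fC].
exact: (cvg_expectation pmf_w pmf_b subcrit p01 geom_w heavy_b lawT lawT_lim fc fC).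
Qed.
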